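(* Let $k\ge2$. Then the model checking problem of $\mathrm{LTL}_k(\sim,\mathsf F,\mathsf X)$ is logspace-reducible to the satisfiability problem of $\mathrm{LTL}_k(\sim,\mathsf F,\mathsf X)$.
   Context: Let $\mathrm{AP}$ be a countably infinite set of atomic propositions. A trace is an infinite sequence $t=t(0)t(1)\cdots\in(\wp\mathrm{AP})^\omega$, and $t^i=t(i)t(i+1)\cdots$. A team is a (possibly empty) set $T$ of traces, and $T^i=\{t^i: t\in T\}$. Formulas of $\mathrm{LTL}(\sim)$ are given by $\varphi::=p\mid\neg\varphi\mid\varphi\wedge\varphi\mid\varphi\vee\varphi\mid\mathsf X\varphi\mid\mathsf F\varphi\mid\mathsf G\varphi\mid\varphi\,\mathsf U\,\varphi\mid\varphi\,\mathsf R\,\varphi\mid{\sim}\varphi$ with $p\in\mathrm{AP}$. Synchronous team semantics: $T\models p$ iff $p\in t(0)$ for all $t\in T$; $T\models\neg\varphi$ iff $\{t\}\not\models\varphi$ for all $t\in T$; $T\models\varphi\wedge\psi$ iff $T\models\varphi$ and $T\models\psi$; $T\models\varphi\vee\psi$ iff $T=S\cup U$ for some $S,U$ with $S\models\varphi$ and $U\models\psi$; $T\models\mathsf X\varphi$ iff $T^1\models\varphi$; $T\models\mathsf F\varphi$ iff $T^k\models\varphi$ for some $k\ge0$; $T\models\mathsf G\varphi$ iff $T^k\models\varphi$ for all $k\ge0$; $T\models\varphi\,\mathsf U\,\psi$ iff there is $k\ge0$ with $T^k\models\psi$ and $T^j\models\varphi$ for all $j<k$; $T\models\varphi\,\mathsf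 R\,\psi$ iff for all $k\ge0$, $T^k\models\psi$ or $T^j\models\varphi$ for some $j<k$; $T\models{\sim}\varphi$ iff $T\not\models\varphi$. The temporal depth of a formula is the maximal nesting depth of the temporal operators $\mathsf X,\mathsf F,\mathsf G,\mathsf U,\mathsf R$; $\mathrm{LTL}_k(\sim,O_1,\dots,O_n)$ is the set of $\mathrm{LTL}(\sim)$-formulas of temporal depth at most $k$ whose only temporal operators are among $O_1,\dots,O_n$ (the connectives $\neg,\wedge,\vee,\sim$ are unrestricted). A finite Kripke structure is $K=(W,R,\eta,r)$ with $W$ finite nonempty, $R\subseteq W\times W$ serial, $\eta:W\to\wp\mathrm{AP}$ with finite labels, and root $r\in W$; a path is $\pi\in W^\omega$ with $\pi(0)=r$ and $(\pi(i),\pi(i+1))\in R$; it induces the trace $(\eta(\pi(i)))_{i\ge0}$; $T(K)$ is the team of all induced traces. Model checking of a fragment $L$: the set of pairs $(K,\varphi)$ with $\varphi\in L$, $K$ a finite Kripke structure and $T(K)\models\varphi$. Satisfiability of $L$: the set of $\varphi\in L$ satisfied by some team. *)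

(* Defs.v *)
From Stdlib Require Import PArith BinNat.
From mathcomp Require Import all_boot.

Set Implicit Arguments.
Unset Strict Implicit.
Unset Printing Implicit Defensive.

(* AP = nat (countably infinite).  A trace maps a position i to the set
   t(i) ⊆ AP, represented by its characteristic function. *)
Definition trace := nat -> nat -> bool.
Definition team := trace -> Prop.

Definition tsuffix (i : nat) (t : trace) : trace := fun j => t (i + j).
Definition team_suffix (i : nat) (T : team) : team :=
  fun s => exists t, T t /\ s = tsuffix i t.
Definition singleton_team (t : trace) : team := fun s => s = t.

Inductive ltl : Type :=
| fAtom  : nat -> ltl
| fNeg   : ltl -> ltl
| fAnd   : ltl -> ltl -> ltl
| fOr    : ltl -> ltl -> ltl
| fX     : ltl -> ltl
| fF     : ltl -> ltl
| fG     : ltl -> ltl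
| fU     : ltl -> ltl -> ltl
| fR     : ltl -> ltl -> ltl
| fTilde : ltl -> ltl.

Fixpoint tsat (T : team) (phi : ltl) {struct phi} : Prop :=
  match phi with
  | fAtom p => forall t, T t -> t 0 p = true
  | fNeg a => forall t, T t -> ~ tsat (singleton_team t) a
  | fAnd a b => tsat T a /\ tsat T b
  | fOr a b => exists S U : team,
      (forall t, T t <-> (S t \/ U t)) /\ tsat S a /\ tsat U b
  | fX a => tsat (team_suffix 1 T) a
  | fF a => exists k, tsat (team_suffix k T) a
  | fG a => forall k, tsat (team_suffix k T) a
  | fU a b => exists k, tsat (team_suffix k T) b /\
                 forall j, j < k -> tsat (team_suffix j T) a
  | fR a b => forall k, tsat (team_suffix k T) b \/
                 exists j, j < k /\ tsat (team_suffix j T) a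
  | fTilde a => ~ tsat T a
  end.

Fixpoint tdepth (phi : ltl) : nat :=
  match phi with
  | fAtom _ => 0
  | fNeg a | fTilde a => tdepth a
  | fAnd a b | fOr a b => maxn (tdepth a) (tdepth b)
  | fX a | fF a | fG a => (tdepth a).+1
  | fU a b | fR a b => (maxn (tdepth a) (tdepth b)).+1
  end.

Fixpoint only_FX (phi : ltl) : bool :=
  match phi with
  | fAtom _ => true
  | fNeg a | fTilde a => only_FX a
  | fAnd a b | fOr a b => only_FX a && only_FX b
  | fX a | fF a => only_FX a
  | fG _ | fU _ _ | fR _ _ => false
  end.

Definition in_LTL_FX (k : nat) (phi : ltl) : Prop :=
  tdepth phi <= k /\ only_FX phi = true.

(* Finite Kripke structures (W = {0,..,kW-1})                          *)

Record kripke := Kripke {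
  kW : nat;
  kR : list (nat * nat);
  kL : list (list nat);        (* kL`_w = finite label of world w *)
  kr : nat
}.

Definition wf_kripke (K : kripke) : Prop :=
  0 < kW K /\ kr K < kW K /\ size (kL K) = kW K /\
  (forall e, e \in kR K -> e.1 < kW K /\ e.2 < kW K) /\
  (forall w, w < kW K -> exists v, (w, v) \in kR K).

Definition kpath (K : kripke) (pi : nat -> nat) : Prop :=
  pi 0 = kr K /\ forall i, (pi i, pi i.+1) \in kR K.

Definition label (K : kripke) (w : nat) : nat -> bool :=
  fun p => p \in nth [::] (kL K) w.

Definition team_of (K : kripke) : team :=
  fun t => exists pi, kpath K pi /\ t = (fun i => label K (pi i)).

Inductive token : Type :=
| T0 | T1
| TSep | TEdge | TLab | TKrip | TEnd
| TAtom | TNeg | TAnd | TOr | TX | TF | TG | TU | TR | TTilde.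

Fixpoint pos_bits (p : positive) : list token :=
  match p with
  | xH => [:: T1]
  | xO q => pos_bits q ++ [:: T0]
  | xI q => pos_bits q ++ [:: T1]
  end.

(* binary numeral, most significant bit first *)
Definition enc_nat (n : nat) : list token :=
  match N.of_nat n with
  | N0 => [:: T0]
  | Npos p => pos_bits p
  end.

Fixpoint enc_ltl (phi : ltl) : list token :=
  match phi with
  | fAtom p => TAtom :: enc_nat p
  | fNeg a => TNeg :: enc_ltl a
  | fAnd a b => TAnd :: enc_ltl a ++ enc_ltl b
  | fOr a b => TOr :: enc_ltl a ++ enc_ltl b
  | fX a => TX :: enc_ltl a
  | fF a => TF :: enc_ltl a
  | fG a => TG :: enc_ltl a
  | fU a b => TU :: enc_ltl a ++ enc_ltl b
  | fR a b => TR :: enc_ltl a ++ enc_ltl b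
  | fTilde a => TTilde :: enc_ltl a
  end.

Definition enc_kripke (K : kripke) : list token :=
  [:: TKrip] ++ enc_nat (kW K) ++ [:: TSep] ++ enc_nat (kr K) ++
  flatten (map (fun e => [:: TEdge] ++ enc_nat e.1 ++ [:: TSep] ++ enc_nat e.2)
               (kR K)) ++
  flatten (map (fun l => TLab :: flatten (map (fun p => TSep :: enc_nat p) l))
               (kL K)) ++
  [:: TEnd].

Definition MC_lang (k : nat) (w : list token) : Prop :=
  exists (K : kripke) (phi : ltl),
    wf_kripke K /\ in_LTL_FX k phi /\
    w = enc_kripke K ++ enc_ltl phi /\ tsat (team_of K) phi.

Definition SAT_lang (k : nat) (w : list token) : Prop :=
  exists phi : ltl, in_LTL_FX k phi /\ w = enc_ltl phi /\
    exists T : team, tsat T phi.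

(* Logspace transducers: deterministic TM with a two-way read-only      *)
(* input tape (with endmarkers), one work tape (one-way infinite) and a *)
(* one-way write-only output tape.                                      *)

Inductive move := MLeft | MStay | MRight.
Inductive cell := CLend | CSym of token | CRend.

Record LTM := {
  ltm_Q : finType;
  ltm_G : finType;
  ltm_blank : ltm_G;
  ltm_q0 : ltm_Q;
  (* None = halt; otherwise: new state, input move, symbol written on work
     tape, work-head move, optional output symbol *)
  ltm_delta : ltm_Q -> cell -> ltm_G ->
              option (ltm_Q * move * ltm_G * move * option token)
}.

Record config (M : LTM) := Config {
  c_q : ltm_Q M;
  c_ih : nat;                  (* input head: 0 = left endmarker *)
  c_tape : nat -> ltm_G M;
  c_wh : nat;
  c_out : list token
}.

Definition read_input (x : list token) (i : nat) : cell :=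
  if i == 0 then CLend
  else if i <= size x then CSym (nth T0 x i.-1) else CRend.

Definition move_in (n : nat) (i : nat) (m : move) : nat :=
  match m with
  | MLeft => i.-1
  | MStay => i
  | MRight => minn i.+1 n.+1
  end.

Definition move_work (i : nat) (m : move) : nat :=
  match m with
  | MLeft => i.-1
  | MStay => i
  | MRight => i.+1
  end.

Definition init_config (M : LTM) : config M :=
  @Config M (ltm_q0 M) 0 (fun _ => ltm_blank M) 0 [::].

Definition ltm_step (M : LTM) (x : list token) (c : config M)
  : option (config M) :=
  match ltm_delta (c_q c) (read_input x (c_ih c)) (c_tape c (c_wh c)) with
  | None => None
  | Some (q', mi, g, mw, o) =>
      Some (@Config M q' (move_in (size x) (c_ih c) mi)
              (fun j => if j == c_wh c then g else c_tape c j)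
              (move_work (c_wh c) mw)
              (match o with None => c_out c | Some a => rcons (c_out c) a end))
  end.

Fixpoint ltm_run (M : LTM) (x : list token) (t : nat) : option (config M) :=
  match t with
  | 0 => Some (init_config M)
  | t'.+1 => match ltm_run M x t' with
             | Some c => ltm_step x c
             | None => None
             end
  end.

Definition ltm_computes_in_space (M : LTM) (x y : list token) (s : nat)
  : Prop :=
  exists t c, ltm_run M x t = Some c /\ ltm_step x c = None /\ c_out c = y /\
    forall j, j <= t -> exists cj, ltm_run M x j = Some cj /\ c_wh cj < s.

Definition logspace_computable (f : list token -> list token) : Prop :=
  exists (M : LTM) (c : nat), forall x,
    ltm_computes_in_space M x (f x) (c * (Nat.log2 (size x)).+1).

Definition logspace_reducible (A B : list token -> Prop) : Prop :=
  exists f, logspace_computable f /\ forall x, A x <-> B (f x).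

(* Main.v *)
From HB Require Import structures.
From Stdlib Require Import FunctionalExtensionality PropExtensionality.
From Stdlib Require Import ClassicalEpsilon PeanoNat NArith.
Require Import Defs.
From mathcomp Require Import all_boot zify.

(** The formula asks for a team consisting of "path" traces, each following a
    path of K (worlds are encoded by fresh atoms), and "marker" traces, each
    singling out one position and one world there.  Markers are required to
    exist for every position and every world, so every path is coded by the set
    of the markers it meets.  Since the splitting disjunction quantifies over
    subteams, one can say that every set of markers coding a path agrees with
    some path trace.  Hence the path traces are exactly the paths of K, and the
    given formula is evaluated on them, each atom p being replaced by the
    disjunction of the worlds labelled with p; this keeps the temporal depth.

    The translation acts token by token, so an ill-formed or too deep input
    formula yields an ill-formed or too deep output, and only the encoding of K
    has to be checked by the machine.  Machines are written as programs with
    finite control and finitely many registers bounded by the input size, which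
    a logspace transducer stores in binary on its work tape. *)

Set Implicit Arguments.
Unset Strict Implicit.
Unset Printing Implicit Defensive.

(** * Programs with bounded registers *)

(** The obstacle is that [fex] asks for a trace with a property at one moment, whereas every one of
    infinitely many paths has to be present as a whole. Markers can be demanded one position and one
    world at a time, and paths are recovered from them by a universal quantifier over subteams:
    [tAllPaths] negates a splitting disjunction. Its flat left part may discard only markers, so the
    other part keeps every path trace; the inner split may discard only path traces, so the
    remaining markers still spell out the code with which a surviving path trace is compared. No
    marker may be marked twice, since choosing it for one position would disturb the code at
    another; [tOnce] secures this. G lies outside the fragment and is written as [fbox]. Every axiom
    has at most one X below one such box, hence temporal depth at most 2: this is the origin of
    [2 <= k]. On the machine side, numerals in the input may exceed the register bound. Worlds are
    therefore enumerated by counting label lists, and numerals are compared with each other and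
    copied digit by digit. *)

Definition tok_list : seq token :=
  [:: T0; T1; TSep; TEdge; TLab; TKrip; TEnd; TAtom; TNeg; TAnd; TOr; TX; TF;
      TG; TU; TR; TTilde].
Definition tok_code (t : token) : 'I_17 :=
  match t with
  | T0 => @Ordinal 17 0 isT | T1 => @Ordinal 17 1 isT | TSep => @Ordinal 17 2 isT
  | TEdge => @Ordinal 17 3 isT | TLab => @Ordinal 17 4 isT | TKrip => @Ordinal 17 5 isT
  | TEnd => @Ordinal 17 6 isT | TAtom => @Ordinal 17 7 isT | TNeg => @Ordinal 17 8 isT
  | TAnd => @Ordinal 17 9 isT | TOr => @Ordinal 17 10 isT | TX => @Ordinal 17 11 isT
  | TF => @Ordinal 17 12 isT | TG => @Ordinal 17 13 isT | TU => @Ordinal 17 14 isT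
  | TR => @Ordinal 17 15 isT | TTilde => @Ordinal 17 16 isT
  end.
(** Besides equality tests, finiteness is needed because a token that has been read is remembered in
    the control: the first result type of [bind] is finite. *)
Lemma tok_codeK : cancel tok_code (fun i : 'I_17 => nth T0 tok_list i).
Proof. by case. Qed.
HB.instance Definition _ := Finite.copy token (can_type tok_codeK).

Section Registers.
Variable m : nat.

(** Jump targets are a parameter, so that [imap] can relink code that becomes part of a larger
    program. *)
Inductive instr (X : Type) : Type :=
| IInc of 'I_m & X
| IDec of 'I_m & X & X
| IMove of move & X
| IOut of token & X
| IRead of (cell -> X).

Definition imap (X Y : Type) (f : X -> Y) (i : instr X) : instr Y :=
  match i with
  | IInc r x => IInc r (f x)
  | IDec r x y => IDec r (f x) (f y)
  | IMove d x => IMove d (f x)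
  | IOut t x => IOut t (f x)
  | IRead k => IRead (fun c => f (k c))
  end.

(** Exits carry return values of type [E]; the start may itself be an exit, so [ret] has no control
    state at all. *)
Record prog (E : Type) := Prog {
  pQ : finType;
  pstart : pQ + E;
  pcode : pQ -> instr (pQ + E)
}.

Record state := St { hd : nat; rg : 'I_m -> nat; ou : seq token }.

Definition upd (R : 'I_m -> nat) (r : 'I_m) (v : nat) : 'I_m -> nat :=
  fun i => if i == r then v else R i.

Section Semantics.
Variables (x : seq token) (B : nat).

Definition istep (X : Type) (i : instr X) (s : state) : X * state :=
  match i with
  | IInc r q => (q, St (hd s) (upd (rg s) r (rg s r).+1) (ou s))
  | IDec r qnz qz =>
      if rg s r is v.+1 then (qnz, St (hd s) (upd (rg s) r v) (ou s)) else (qz, s)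
  | IMove d q => (q, St (move_in (size x) (hd s) d) (rg s) (ou s))
  | IOut t q => (q, St (hd s) (rg s) (rcons (ou s) t))
  | IRead k => (k (read_input x (hd s)), s)
  end.

Definition iok (X : Type) (i : instr X) (s : state) : bool :=
  if i is IInc r _ then rg s r < B else true.

(** A derivation certifies termination and, through [iok], that no increment takes a register beyond
    [B], from which the space bound follows. *)
Inductive runs (E : Type) (p : prog E) : pQ p + E -> state -> E -> state -> Prop :=
| runs_exit e s : runs (inr e) s e s
| runs_step q s e s' :
    iok (pcode q) s ->
    runs (istep (pcode q) s).1 (istep (pcode q) s).2 e s' ->
    runs (inl q) s e s'.

Definition exec (E : Type) (p : prog E) (s : state) (e : E) (s' : state) : Prop :=
  runs (p := p) (pstart p) s e s'.

Lemma istep_imap (X Y : Type) (f : X -> Y) (i : instr X) s :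
  istep (imap f i) s = (f (istep i s).1, (istep i s).2).
Proof. by case: i => //= r a b; case: (rg s r). Qed.

Lemma iok_imap (X Y : Type) (f : X -> Y) (i : instr X) s :
  iok (imap f i) s = iok i s.
Proof. by case: i. Qed.

End Semantics.

Definition ret (E : Type) (e : E) : prog E :=
  @Prog E void (inr e) (fun q : void => match q with end).

Definition prim (E : Type) (i : instr E) : prog E :=
  @Prog E unit (inl tt) (fun _ => imap inr i).

Section Bind.
Variables (E1 : finType) (E2 : Type) (p : prog E1) (k : E1 -> prog E2).
(** One copy of the continuation for each return value, a finite set of states because [E1] is
    finite. *)
Definition bind_Q : finType := (pQ p + {e : E1 & pQ (k e)})%type.
Definition bind_snd (e : E1) (z : pQ (k e) + E2) : bind_Q + E2 :=
  match z with
  | inl q => inl (inr (Tagged (fun e => pQ (k e)) q))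
  | inr e2 => inr e2
  end.
Definition bind_fst (z : pQ p + E1) : bind_Q + E2 :=
  match z with
  | inl q => inl (inl q)
  | inr e => bind_snd (pstart (k e))
  end.
Definition bind : prog E2 :=
  @Prog E2 bind_Q (bind_fst (pstart p))
    (fun q => match q with
              | inl q1 => imap bind_fst (pcode q1)
              | inr (existT e q2) => imap (@bind_snd e) (pcode q2)
              end).

Lemma exec_bind x B s e s1 e2 s2 :
  exec x B p s e s1 -> exec x B (k e) s1 e2 s2 -> exec x B bind s e2 s2.
Proof.
move=> H1 H2; rewrite /exec /=.
elim: H1 H2 => {s e s1} [e s|q s e s1 ok _ IH] H2 /=; last first.
  apply: runs_step => /=; first by rewrite iok_imap.
  by rewrite istep_imap; apply: IH.
rewrite /exec in H2.
elim: H2 => {s e2 s2} [e2 s|q s e2 s2 ok _ IH] /=; first exact: runs_exit.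
apply: runs_step => /=; first by rewrite iok_imap.
by rewrite istep_imap.
Qed.
End Bind.

Section Iter.
Variables (A : finType) (E : Type) (p : A -> prog (A + E)).
Definition iter_Q : finType := (A + {a : A & pQ (p a)})%type.
Definition iter_conv (a : A) (z : pQ (p a) + (A + E)) : iter_Q + E :=
  match z with
  | inl q => inl (inr (Tagged (fun a => pQ (p a)) q))
  | inr (inl a') => inl (inl a')
  | inr (inr e) => inr e
  end.
(** The loop head is a state of its own that spends one idle move. The body may thus start directly
    in an exit without making the definition circular. *)
Definition iterp (a0 : A) : prog E :=
  @Prog E iter_Q (inl (inl a0))
    (fun q => match q with
              | inl a => IMove MStay (iter_conv (pstart (p a)))
              | inr (existT a q2) => imap (@iter_conv a) (pcode q2)
              end).

Lemma iter_runs x B a z s e1 s1 e s2 :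
  runs x B (p := p a) z s e1 s1 ->
  runs x B (p := iterp a) (@iter_conv a (inr e1)) s1 e s2 ->
  runs x B (p := iterp a) (iter_conv z) s e s2.
Proof.
move=> H1 H2; elim: H1 H2 => {z s e1 s1} [e1 s|q s e1 s1 ok _ IH] H2 //=.
apply: runs_step => /=; first by rewrite iok_imap.
by rewrite istep_imap; apply: IH.
Qed.

(** The initial value occurs only in [pstart], which a run from a given state never consults. *)
Lemma iterp_start_irrel x B a a' z s e s2 :
  runs x B (p := iterp a) z s e s2 -> runs x B (p := iterp a') z s e s2.
Proof.
elim=> {z s e s2} [e s|q s e s2 ok _ IH]; first exact: runs_exit.
by apply: runs_step.
Qed.

Lemma exec_iter_next x B a s a' s1 e s2 :
  exec x B (p a) s (inl a') s1 -> exec x B (iterp a') s1 e s2 ->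
  exec x B (iterp a) s e s2.
Proof.
move=> H1 H2; apply: runs_step => //=.
case: s H1 => h R o H1; apply: iter_runs H1 _.
exact: iterp_start_irrel H2.
Qed.

Lemma exec_iter_stop x B a s e s1 :
  exec x B (p a) s (inr e) s1 -> exec x B (iterp a) s e s1.
Proof.
move=> H1; apply: runs_step => //=.
by case: s H1 => h R o H1; apply: iter_runs H1 _; apply: runs_exit.
Qed.
End Iter.

Lemma exec_ret x B E (e : E) s : exec x B (ret e) s e s.
Proof. exact: runs_exit. Qed.

Lemma exec_prim x B E (i : instr E) s :
  iok B i s -> exec x B (prim i) s (istep x i s).1 (istep x i s).2.
Proof.
move=> ok; apply: runs_step; rewrite /= ?iok_imap // istep_imap.
exact: runs_exit.
Qed.

End Registers.

(** * Simulation by a logspace transducer *)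

Definition bit (j v : nat) : bool := odd (iter j half v).

Lemma bitS j v : bit j.+1 v = bit j v./2.
Proof. by rewrite /bit iterSr. Qed.

Lemma bit_set j v i : ~~ bit j v -> bit i (v + 2 ^ j) = (i == j) || bit i v.
Proof.
elim: j v i => [|j IH] v i.
  rewrite {1}/bit /= => ev; case: i => [|i].
    by rewrite /bit /= expn0 addn1 /= ev.
  by rewrite !bitS /=; congr bit; lia.
rewrite bitS => nb; case: i => [|i].
  by rewrite /bit /= oddD oddX /= addbF.
rewrite !bitS eqSS -IH //; congr bit.
by rewrite expnS; lia.
Qed.

Lemma bit_shift j q : bit j (2 ^ j * q) = odd q.
Proof.
elim: j q => [|j IH] q; first by rewrite mul1n.
by rewrite bitS -IH; congr bit; rewrite expnS; lia.
Qed.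

Section Simulation.
Variables (m : nat) (E : finType) (p : prog m E).

Let Z : finType := (pQ p + E)%type.
(** [None] is the initial state; its single step installs the flags of cell 0, which the blank tape
    lacks. *)
Definition sim_Q : finType := option ((Z + Z) + Z * 'I_m).
Definition sim_G : finType := (bool * bool * {ffun 'I_m -> bool})%type.
Definition in_main (z : Z) : sim_Q := Some (inl (inl z)).
Definition in_back (z : Z) : sim_Q := Some (inl (inr z)).
Definition in_borrow (z : Z) (r : 'I_m) : sim_Q := Some (inr (z, r)).
Definition setb (b : {ffun 'I_m -> bool}) (r : 'I_m) (v : bool) :
  {ffun 'I_m -> bool} := [ffun i => if i == r then v else b i].

(* A work cell holds a flag marking cell 0, a flag marking the cells in use,
   and one bit of every register (least significant bit in cell 0).  The state
   [in_back] returns to cell 0; [in_borrow] does so writing ones into r. *)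
Definition sim_delta (q : sim_Q) (c : cell) (g : sim_G) :
    option (sim_Q * move * sim_G * move * option token) :=
  let: (h, u, b) := g in
  match q with
  | None => Some (in_main (pstart p), MStay, (true, true, [ffun=> false]), MStay, None)
  | Some (inl (inl (inr _))) => None
  | Some (inl (inl (inl q0))) =>
      match pcode q0 with
      | IInc r z =>
          if b r then Some (q, MStay, (h, u, setb b r false), MRight, None)
          else Some (in_back z, MStay, (h, true, setb b r true), MStay, None)
      | IDec r z1 z0 =>
          if b r then
            if h then Some (in_main z1, MStay, (h, u, setb b r false), MStay, None)
            else Some (in_borrow z1 r, MStay, (h, u, setb b r false), MLeft, None)
          else if u then Some (q, MStay, g, MRight, None)
          else Some (in_back z0, MStay, g, MStay, None)
      | IMove d z => Some (in_main z, d, g, MStay, None)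
      | IOut t z => Some (in_main z, MStay, g, MStay, Some t)
      | IRead k => Some (in_main (k c), MStay, g, MStay, None)
      end
  | Some (inl (inr z)) =>
      if h then Some (in_main z, MStay, g, MStay, None)
      else Some (q, MStay, g, MLeft, None)
  | Some (inr (z, r)) =>
      if h then Some (in_main z, MStay, (h, u, setb b r true), MStay, None)
      else Some (q, MStay, (h, u, setb b r true), MLeft, None)
  end.

Definition sim : LTM :=
  @Build_LTM sim_Q sim_G (false, false, [ffun=> false]) None sim_delta.

Definition rep (l : nat) (R : 'I_m -> nat) : nat -> sim_G :=
  fun j => (j == 0, j < l, [ffun r => bit j (R r)]).

Variables (x : seq token) (B : nat).

Definition conf (q : sim_Q) (s : state m) (l w : nat) : config sim :=
  @Config sim q (hd s) (rep l (rg s)) w (ou s).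

Inductive reach (S : nat) : config sim -> config sim -> Prop :=
| reach_refl c : reach S c c
| reach_step c c1 c2 :
    ltm_step x c = Some c1 -> c_wh c1 < S -> reach S c1 c2 -> reach S c c2.

Lemma reach_trans S c1 c2 c3 : reach S c1 c2 -> reach S c2 c3 -> reach S c1 c3.
Proof.
elim=> {c1 c2} [//|c c1 c2 st lt _ IH] H; apply: reach_step st lt _.
exact: IH.
Qed.

Lemma reach1 S c1 c2 : ltm_step x c1 = Some c2 -> c_wh c2 < S -> reach S c1 c2.
Proof. by move=> st lt; apply: reach_step st lt _; apply: reach_refl. Qed.

Lemma rep_write l l' R j (g : sim_G) R' :
  g = rep l' R' j -> (forall i, i != j -> rep l R i = rep l' R' i) ->
  (fun i => if i == j then g else rep l R i) = rep l' R'.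
Proof.
move=> -> H; apply: functional_extensionality => i.
by case: eqP => [->//|/eqP]; apply: H.
Qed.

Lemma rep_same l R j :
  (fun i => if i == j then rep l R j else rep l R i) = rep l R.
Proof. exact: rep_write. Qed.

Lemma upd_same (R : 'I_m -> nat) r : upd R r (R r) = R.
Proof. by apply: functional_extensionality => i; rewrite /upd; case: eqP => [->|]. Qed.

Lemma upd_twice (R : 'I_m -> nat) r u v : upd (upd R r u) r v = upd R r v.
Proof. by apply: functional_extensionality => i; rewrite /upd; case: eqP. Qed.

Lemma upd_eq (R : 'I_m -> nat) r v : upd R r v r = v.
Proof. by rewrite /upd eqxx. Qed.

(** Apart from initialisation, a write that changes the tape affects one bit of one register and
    possibly the in-use flag of the same cell; this lemma covers all of them. *)
Lemma rep_flip l l' R r v v' (b : bool) j :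
  (forall i, bit i v' = if i == j then b else bit i v) ->
  (forall i, i != j -> (i < l) = (i < l')) ->
  (fun i => if i == j then (j == 0, j < l', setb (rep l (upd R r v) j).2 r b)
            else rep l (upd R r v) i) = rep l' (upd R r v').
Proof.
move=> Hb Hl; apply: rep_write; rewrite /rep /=.
  congr (_, _, _); apply/ffunP => i; rewrite !ffunE /upd.
  by case: eqP => // _; rewrite Hb eqxx.
move=> i ne; congr (_, _, _); first exact: Hl.
apply/ffunP => k; rewrite !ffunE /upd.
by case: eqP => // _; rewrite Hb (negbTE ne).
Qed.

Lemma reach_back S l z s w : w < S ->
  reach S (conf (in_back z) s l w) (conf (in_main z) s l 0).
Proof.
elim: w => [|w IH] lt; apply: reach_step.
- by rewrite /ltm_step /= rep_same; reflexivity.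
- by [].
- exact: reach_refl.
- by rewrite /ltm_step /= rep_same; reflexivity.
- by move: lt => /=; lia.
- by apply: IH; lia.
Qed.

(** A borrow from bit [w.+1] leaves zeros below it; turning them into ones on the way back to cell 0
    adds [(2 ^ w.+1).-1]. *)
Lemma reach_borrow S l z h R o r v w : w < S -> w < l ->
  reach S (conf (in_borrow z r) (St h (upd R r (2 ^ w.+1 * v)) o) l w)
          (conf (in_main z) (St h (upd R r (2 ^ w.+1 * v + (2 ^ w.+1).-1)) o) l 0).
Proof.
elim: w v => [|w IH] v lt ltl.
  apply: reach1 => //; rewrite /ltm_step /= /conf /=; do 2 f_equal.
  apply: rep_flip => // i.
  rewrite (_ : _ + _ = 2 ^ 1 * v + 2 ^ 0) // bit_set; first by case: (i == 0).
  by rewrite /bit /=; lia.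
(* Once cell [w.+1] is set, the value is [2 ^ w.+1] times [v.*2.+1], the form required by the
   induction hypothesis. *)
apply: (reach_step (c1 := conf (in_borrow z r) (St h (upd R r (2 ^ w.+1 * (v.*2.+1))) o) l w)).
- rewrite /ltm_step /= /conf /=; do 2 f_equal.
  apply: rep_flip => // i.
  have -> : 2 ^ w.+1 * v.*2.+1 = 2 ^ w.+2 * v + 2 ^ w.+1.
    by rewrite !expnS; lia.
  rewrite bit_set; first by case: (i == _).
  have -> : 2 ^ w.+2 * v = 2 ^ w.+1 * v.*2 by rewrite !expnS; lia.
  by rewrite bit_shift odd_double.
- by move=> /=; lia.
have -> : 2 ^ w.+2 * v + (2 ^ w.+2).-1 = 2 ^ w.+1 * v.*2.+1 + (2 ^ w.+1).-1.
  have : 0 < 2 ^ w by rewrite expn_gt0.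
  by rewrite !expnS; nia.
by apply: IH; lia.
Qed.

(** The [w] lowest bits of the old value [R r] were ones and have been cleared by the carry, so the
    tape shows [2 ^ w * v]. A new cell is opened exactly when the result is [2 ^ l]. *)
Lemma reach_inc S l h R o r q z v w : pcode q = IInc r z ->
  l < S -> w <= l -> R r = 2 ^ w * v + (2 ^ w).-1 -> R r < 2 ^ l ->
  reach S (conf (in_main (inl q)) (St h (upd R r (2 ^ w * v)) o) l w)
          (conf (in_main z) (St h (upd R r (R r).+1) o)
             (if (R r).+1 == 2 ^ l then l.+1 else l) 0).
Proof.
move=> code lS; have [k] := ubnP (l - w); elim: k w v => // k IH w v ltk wl Rr ltR.
have w0 : 0 < 2 ^ w by rewrite expn_gt0.
case: (boolP (odd v)) => ov.
  have wl' : w < l.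
    rewrite ltn_neqAle wl andbT; apply/negP => /eqP ew.
    by move: ltR; rewrite Rr -ew; case: (v) ov => // v' _; nia.
  have vE : v = (v./2).*2.+1 by lia.
  apply: (reach_step (c1 := conf (in_main (inl q)) (St h (upd R r (2 ^ w.+1 * v./2)) o) l w.+1)).
  - rewrite /ltm_step /= code ffunE upd_eq bit_shift ov /conf /=; do 2 f_equal.
    apply: rep_flip => // i.
    rewrite {2}vE; have -> : 2 ^ w * (v./2).*2.+1 = 2 ^ w.+1 * v./2 + 2 ^ w.
      by rewrite expnS; nia.
    have nb : ~~ bit w (2 ^ w.+1 * v./2).
      have -> : 2 ^ w.+1 * v./2 = 2 ^ w * (v./2).*2 by rewrite expnS; nia.
      by rewrite bit_shift odd_double.
    by rewrite bit_set //; case: eqP => //= ->; apply: negbTE.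
  - by move=> /=; lia.
  apply: IH => //; first by lia.
  by rewrite Rr {1}vE expnS; nia.
have nb : ~~ bit w (2 ^ w * v) by rewrite bit_shift.
set l' := (if _ then _ else _).
have wl' : w < l'.
  rewrite /l'; case: eqP => // ne.
  rewrite ltn_neqAle wl andbT; apply/eqP => ew; apply: ne; move: ltR.
  by rewrite Rr -ew; case: (v) => [|v']; nia.
have ll' : forall i, i != w -> (i < l) = (i < l').
  rewrite /l'; case: eqP => // e i ne.
  have [ew|/eqP new] := (w =P l); first by rewrite -ew; lia.
  have wltl : w < l by lia.
  exfalso; move: e; rewrite Rr.
  have -> : 2 ^ l = 2 ^ w * (2 * 2 ^ (l - w.+1)).
    by rewrite -expnS -expnD; congr (_ ^ _); lia.
  move: ov; set y := 2 ^ (l - _) => ov e.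
  have /eqP : 2 ^ w * v.+1 = 2 ^ w * (2 * y) by lia.
  by rewrite eqn_pmul2l // => /eqP; lia.
apply: (reach_step (c1 := conf (in_back z) (St h (upd R r (R r).+1) o) l' w)).
- rewrite /ltm_step /= code ffunE upd_eq (negbTE nb) /conf /=; do 2 f_equal.
  (* The written flag [true] is replaced by [w < l'] to fit [rep_flip]. *)
  rewrite -[true in (_, true, _)]/(true); rewrite -wl'; apply: rep_flip => // i.
  have -> : (R r).+1 = 2 ^ w * v + 2 ^ w by rewrite Rr; lia.
  by rewrite bit_set //; case: (i == w).
- by move=> /=; lia.
by apply: reach_back; lia.
Qed.

Lemma reach_dec S l h R o r q z1 z0 w v : pcode q = IDec r z1 z0 ->
  l < S -> w <= l -> R r = 2 ^ w * v -> R r < 2 ^ l ->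
  reach S (conf (in_main (inl q)) (St h R o) l w)
    (if R r is u.+1 then conf (in_main z1) (St h (upd R r u) o) l 0
     else conf (in_main z0) (St h R o) l 0).
Proof.
move=> code lS; have [k] := ubnP (l - w); elim: k w v => // k IH w v ltk wl Rr ltR.
have w0 : 0 < 2 ^ w by rewrite expn_gt0.
have RE : upd R r (2 ^ w * v) = R by rewrite -Rr upd_same.
case: (boolP (odd v)) => ov.
  have wl' : w < l.
    rewrite ltn_neqAle wl andbT; apply/negP => /eqP ew.
    by move: ltR; rewrite Rr -ew; case: (v) ov => // v' _; nia.
  have vE : v = (v./2).*2.+1 by lia.
  have flip : (fun i => if i == w then (w == 0, w < l, setb (rep l R w).2 r false)
               else rep l R i) = rep l (upd R r (2 ^ w * (v./2).*2)).
    rewrite -{1 2}RE; apply: rep_flip => // i.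
    rewrite {2}vE; have -> : 2 ^ w * (v./2).*2.+1 = 2 ^ w * (v./2).*2 + 2 ^ w by nia.
    have nb : ~~ bit w (2 ^ w * (v./2).*2) by rewrite bit_shift odd_double.
    by rewrite bit_set //; case: eqP => //= ->; apply: negbTE.
  have bw : bit w (R r) by rewrite Rr bit_shift.
  case: w wl w0 Rr RE wl' flip bw ltk => [|w] wl w0 Rr RE wl' flip bw ltk.
    rewrite (_ : R r = (v./2).*2.+1); last by lia.
    apply: reach1; last by move=> /=; lia.
    rewrite /ltm_step /= code /rep ffunE bw /=; move: flip; rewrite /rep /= => ->.
    by rewrite mul1n.
  apply: (reach_step (c1 := conf (in_borrow z1 r) (St h (upd R r (2 ^ w.+1 * (v./2).*2)) o) l w)).
  - by rewrite /ltm_step /= code /rep ffunE bw /=; move: flip; rewrite /rep /= => ->.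
  - by move=> /=; lia.
  have -> : R r = (2 ^ w.+1 * (v./2).*2 + (2 ^ w.+1).-1).+1.
    by rewrite Rr {1}vE; nia.
  by apply: reach_borrow; lia.
have nb : bit w (R r) = false by rewrite Rr bit_shift; apply: negbTE.
case: (ltnP w l) => [wl'|lw].
  apply: (reach_step (c1 := conf (in_main (inl q)) (St h R o) l w.+1)).
  - rewrite /ltm_step /= code ffunE nb wl' /conf /=; do 2 f_equal.
    exact: rep_same.
  - by move=> /=; lia.
  apply: (IH _ v./2) => //; first by lia.
  by rewrite Rr expnS; nia.
have ew : w = l by lia.
have -> : R r = 0.
  by move: ltR; rewrite Rr -ew; case: (v) => [|v']; nia.
apply: (reach_step (c1 := conf (in_back z0) (St h R o) l w)).
- rewrite /ltm_step /= code ffunE nb ltnNge lw /= /conf /=; do 2 f_equal.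
  exact: rep_same.
- by move=> /=; lia.
by apply: reach_back; lia.
Qed.

Let S := (Nat.log2 B).+2.

(** The number of used cells never decreases, so it is bounded by values reached in the past: cell
    [l] is opened only when some register becomes [2 ^ l], which is at most [B]. *)
Definition fits (l : nat) (R : 'I_m -> nat) : Prop :=
  [/\ 0 < l, 2 ^ l.-1 <= B & forall r, R r < 2 ^ l].

Lemma fits_lt l R : fits l R -> l < S.
Proof.
case=> l0 lB _; rewrite /S; have B0 : 0 < B by apply: leq_trans lB; rewrite expn_gt0.
suff : l.-1 <= Nat.log2 B by lia.
have [_ h] := Nat.log2_spec B (elimT ltP B0).
rewrite leqNgt; apply/negP => lt.
have : 2 ^ (Nat.log2 B).+1 <= 2 ^ l.-1 by rewrite leq_exp2l.
have -> : 2 ^ (Nat.log2 B).+1 = Nat.pow 2 (Nat.log2 B).+1.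
  by elim: (Nat.log2 B).+1 => // n IHn; rewrite expnS IHn.
lia.
Qed.

Lemma reach_istep q s l : fits l (rg s) -> iok B (pcode q) s ->
  exists2 l', fits l' (rg (istep x (pcode q) s).2) &
    reach S (conf (in_main (inl q)) s l 0)
      (conf (in_main (istep x (pcode q) s).1) (istep x (pcode q) s).2 l' 0).
Proof.
move=> F; have lS := fits_lt F; have [l0 lB Rl] := F.
case: s F Rl => h R o F Rl; rewrite /= in Rl.
case code: (pcode q) => [r z|r z1 z0|d z|t z|k] /= ok.
- have RE : upd R r (2 ^ 0 * R r) = R by rewrite mul1n upd_same.
  exists (if (R r).+1 == 2 ^ l then l.+1 else l); last first.
    rewrite -{1}RE; apply: reach_inc => //; first by rewrite expn0; lia.
  case: eqP => [e|ne]; split=> //.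
  + by rewrite -e.
  + move=> i; rewrite /upd expnS; have := Rl i; have := Rl r.
    by case: ifP => _; lia.
  + move=> i; rewrite /upd; have := Rl i; have := Rl r.
    by case: ifP => _; lia.
- have := @reach_dec S l h R o r q z1 z0 0 (R r) code lS (leq0n _).
  rewrite expn0 mul1n => /(_ erefl (Rl r)) H.
  case e : (R r) H => [|v] H; exists l => //; split=> // i.
  rewrite /= /upd; case: ifP => // _; have := Rl r; lia.
- exists l => //; apply: reach1; last by [].
  by rewrite /ltm_step /= code rep_same.
- exists l => //; apply: reach1; last by [].
  by rewrite /ltm_step /= code rep_same.
- exists l => //; apply: reach1; last by [].
  by rewrite /ltm_step /= code rep_same.
Qed.

Lemma reach_runs z s e s' l : runs x B (p := p) z s e s' -> fits l (rg s) ->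
  exists l', reach S (conf (in_main z) s l 0) (conf (in_main (inr e)) s' l' 0).
Proof.
move=> H; elim: H l => {z s e s'} [e s|q s e s' ok _ IH] l F.
  by exists l; apply: reach_refl.
have [l' F' H] := reach_istep F ok.
by have [l2 H2] := IH _ F'; exists l2; apply: reach_trans H H2.
Qed.

Lemma ltm_run_reach c c' t : reach S c c' ->
  ltm_run sim x t = Some c -> c_wh c < S ->
  (forall j, j <= t -> exists cj, ltm_run sim x j = Some cj /\ c_wh cj < S) ->
  exists t', ltm_run sim x t' = Some c' /\
    forall j, j <= t' -> exists cj, ltm_run sim x j = Some cj /\ c_wh cj < S.
Proof.
move=> H; elim: H t => {c c'} [c|c c1 c2 st lt _ IH] t run wc all; first by exists t.
have run1 : ltm_run sim x t.+1 = Some c1 by rewrite /= run.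
apply: (IH t.+1) => // j; rewrite leq_eqVlt => /orP [/eqP ->|]; last exact: all.
by exists c1.
Qed.

Lemma sim_computes e s' : 1 < B -> exec x B p (St 0 (fun _ => 0) [::]) e s' ->
  ltm_computes_in_space sim x (ou s') S.
Proof.
move=> B1 H; pose s0 : state m := St 0 (fun=> 0) [::].
have F : fits 1 (rg s0) by split=> //; apply: leq_trans B1.
have [l R] := reach_runs H F.
have : reach S (init_config sim) (conf (in_main (inr e)) s' l 0).
  apply: reach_step R => //; rewrite /ltm_step /= /conf /=; do 2 f_equal.
  apply: functional_extensionality => j; rewrite /rep /=.
  have bit0 i : bit i 0 = false by elim: i => // i IHi; rewrite bitS.
  by case: j => [|j] /=; congr (_, _, _); apply/ffunP => i; rewrite !ffunE bit0.
case/(ltm_run_reach (t := 0)) => //.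
  by move=> [|//] _; exists (init_config sim).
move=> t [run all]; exists t, (conf (in_main (inr e)) s' l 0); split=> //.
Qed.

End Simulation.

(** For [n = 0] both sides equal 3, so no smaller factor would do. *)
Lemma log2_bound n : (Nat.log2 n.+2).+2 <= 3 * (Nat.log2 n).+1.
Proof.
case: n => [|[|n]] //.
have : (Nat.log2 n.+4 <= Nat.log2 (2 * n.+2))%coq_nat by apply: Nat.log2_le_mono; lia.
rewrite Nat.log2_double; lia.
Qed.

(** Registers hold head positions up to [(size x).+1] and at most one increment beyond, whence the
    bound [(size x).+2]. *)
Lemma logspace_computable_exec m (E : finType) (p : prog m E) (f : seq token -> seq token) :
  (forall x, exists e s', exec x (size x).+2 p (St 0 (fun _ => 0) [::]) e s' /\ ou s' = f x) ->
  logspace_computable f.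
Proof.
move=> H; exists (sim p), 3 => x; have [e [s' [Hx <-]]] := H x.
have [t [c [run [halt [out all]]]]] := sim_computes (B := (size x).+2) isT Hx.
exists t, c; split=> //; split=> //; split=> // j /all [cj [rj lt]]; exists cj; split=> //.
exact: leq_trans lt (log2_bound _).
Qed.

(** * Basic programs *)

Notation "x <~ p ;; q" := (bind p (fun x => q))
  (at level 61, p at next level, right associativity).
Notation "p ;; q" := (bind p (fun _ => q)) (at level 61, right associativity).

Definition isbit (t : token) : bool :=
  match t with T0 | T1 => true | _ => false end.

Fixpoint bits (s : seq token) : seq token :=
  if s is c :: s' then if isbit c then c :: bits s' else [::] else [::].

(** Numerals have no end marker: they stop at the first token that is not a bit. This is the
    condition for a numeral to stand directly before [s]. *)
Definition nbhead (s : seq token) : bool :=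
  if s is c :: _ then ~~ isbit c else true.

Lemma bits_cat bs s : all isbit bs -> nbhead s -> bits (bs ++ s) = bs.
Proof.
elim: bs => [|b bs IH] /=; first by case: s => //= c s _; case: (isbit c).
by case/andP=> -> /IH H /H ->.
Qed.

(* Registers below 6 are scratch space and hold 0 between calls. *)
Definition nreg := 10.
Definition rTmp : 'I_nreg := @Ordinal nreg 0 isT.
Definition rPos : 'I_nreg := @Ordinal nreg 1 isT.
Definition rT1 : 'I_nreg := @Ordinal nreg 2 isT.
Definition rT2 : 'I_nreg := @Ordinal nreg 3 isT.
Definition rA : 'I_nreg := @Ordinal nreg 4 isT.
Definition rB : 'I_nreg := @Ordinal nreg 5 isT.
(** Long-lived registers: a counter of worlds, then head positions in the formula, in the outer edge
    loop and in the inner scan. *)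
Definition rCnt : 'I_nreg := @Ordinal nreg 6 isT.
Definition rPhi : 'I_nreg := @Ordinal nreg 7 isT.
Definition rE : 'I_nreg := @Ordinal nreg 8 isT.
Definition rS : 'I_nreg := @Ordinal nreg 9 isT.

Definition clean (R : 'I_nreg -> nat) : Prop := forall i : 'I_nreg, i < 6 -> R i = 0.

Lemma clean_upd R (r : 'I_nreg) v : clean R -> 6 <= r -> clean (upd R r v).
Proof.
by move=> C r6 i i6; rewrite /upd; case: eqP => [ei|_]; [move: i6 r6; rewrite ei; lia | apply: C].
Qed.

Ltac regs := apply: functional_extensionality => ?; rewrite /upd;
  do ?(case: eqP => ?); subst; try congruence; try lia.

Section Programs.
Variable x : seq token.
Let n := size x.
Notation prog := (prog nreg).
Notation exec := (@exec nreg x n.+2 _).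

(** Position 0 is the left endmarker, so the unread input starts at [h.-1]; at [h = n.+1], the right
    endmarker, [s] is empty. *)
Definition hat (h : nat) (s : seq token) : Prop :=
  [/\ 0 < h, h <= n.+1 & drop h.-1 x = s].

Lemma hat_read h s : hat h s ->
  read_input x h = if s is c :: _ then CSym c else CRend.
Proof.
case=> h0 hn <-; rewrite /read_input; case: h h0 hn => // h _ hn /=.
case: ltnP => hs; last by rewrite drop_oversize.
by rewrite (drop_nth T0).
Qed.

Lemma hat_next h c s : hat h (c :: s) -> hat h.+1 s.
Proof.
case=> h0 hn e; have : size (drop h.-1 x) = (size s).+1 by rewrite e.
rewrite size_drop => sz; split=> //; first by rewrite -/n in sz; lia.
by rewrite -[h.+1.-1](prednK h0) -addn1 addnC -drop_drop e /= drop0.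
Qed.

Lemma hat_cat h s1 s2 : hat h (s1 ++ s2) -> hat (h + size s1) s2.
Proof.
elim: s1 h => [|c s1 IH] h /=; first by rewrite addn0.
by move/hat_next/IH; rewrite addSnnS.
Qed.

Lemma hat_right h c s : hat h (c :: s) -> move_in n h MRight = h.+1.
Proof. by case/hat_next=> _ hn _; rewrite /=; lia. Qed.

Lemma hat1 : hat 1 x.
Proof. by split; rewrite ?drop0. Qed.

Definition inc (r : 'I_nreg) : prog unit := prim (IInc r tt).
Definition dec (r : 'I_nreg) : prog bool := prim (IDec r true false).
Definition mv (d : move) : prog unit := prim (IMove nreg d tt).
Definition out (t : token) : prog unit := prim (IOut nreg t tt).
Definition rd : prog (option token) :=
  prim (IRead nreg (fun c => if c is CSym t then Some t else None)).
Definition at_start : prog bool :=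
  prim (IRead nreg (fun c => if c is CLend then true else false)).
Definition loop (E : Type) (p : prog (unit + E)) : prog E := iterp (fun _ => p) tt.

Lemma exec_inc h R o r : R r <= n.+1 ->
  exec (inc r) (St h R o) tt (St h (upd R r (R r).+1) o).
Proof. by move=> lt; apply: (@exec_prim nreg x n.+2 _ (IInc r tt)). Qed.

Lemma exec_dec0 h R o r : R r = 0 -> exec (dec r) (St h R o) false (St h R o).
Proof.
move=> e; have := @exec_prim nreg x n.+2 _ (IDec r true false) (St h R o) isT.
by rewrite /= e.
Qed.

Lemma exec_decS h R o r v : R r = v.+1 ->
  exec (dec r) (St h R o) true (St h (upd R r v) o).
Proof.
move=> e; have := @exec_prim nreg x n.+2 _ (IDec r true false) (St h R o) isT.
by rewrite /= e.
Qed.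

Lemma exec_mv h R o d : exec (mv d) (St h R o) tt (St (move_in n h d) R o).
Proof. exact: (@exec_prim nreg x n.+2 _ (IMove nreg d tt)). Qed.

Lemma exec_right h R o c s : hat h (c :: s) ->
  exec (mv MRight) (St h R o) tt (St h.+1 R o).
Proof. by move=> H; rewrite -[h.+1](hat_right H); apply: exec_mv. Qed.

Lemma exec_out h R o t : exec (out t) (St h R o) tt (St h R (rcons o t)).
Proof. exact: (@exec_prim nreg x n.+2 _ (IOut nreg t tt)). Qed.

Lemma exec_rd h s R o : hat h s -> exec rd (St h R o) (ohead s) (St h R o).
Proof.
move=> H; have := @exec_prim nreg x n.+2 _
  (IRead nreg (fun c => if c is CSym t then Some t else None)) (St h R o) isT.
by rewrite /= (hat_read H); case: (s).
Qed.

Lemma exec_at_start h R o : exec at_start (St h R o) (h == 0) (St h R o).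
Proof.
have := @exec_prim nreg x n.+2 _
  (IRead nreg (fun c => if c is CLend then true else false)) (St h R o) isT.
by rewrite /= /read_input; case: (h == 0) => //; case: (h <= _).
Qed.

Lemma exec_loop_next E (p : prog (unit + E)) s s1 e s2 :
  exec p s (inl tt) s1 -> exec (loop p) s1 e s2 -> exec (loop p) s e s2.
Proof. exact: exec_iter_next. Qed.

Lemma exec_loop_stop E (p : prog (unit + E)) s e s1 :
  exec p s (inr e) s1 -> exec (loop p) s e s1.
Proof. exact: exec_iter_stop. Qed.

Definition drain (r : 'I_nreg) (body : prog unit) : prog unit :=
  loop (b <~ dec r ;; if b then body ;; ret nreg (inl tt) else ret nreg (inr tt)).

(** [P v] is the state with [v] rounds to go: the loop is described by an explicit family of
    states. *)
Lemma exec_drain r body (P : nat -> state nreg) k :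
  (forall v, v <= k -> rg (P v) r = v) ->
  (forall v, v < k ->
     exec body (St (hd (P v.+1)) (upd (rg (P v.+1)) r v) (ou (P v.+1))) tt (P v)) ->
  exec (drain r body) (P k) tt (P 0).
Proof.
elim: k => [|k IH] Hr Hb.
  apply: exec_loop_stop; have := Hr 0 isT; case: (P 0) => h R o /= e.
  by apply: exec_bind; [apply: exec_dec0 e | apply: exec_ret].
apply: (exec_loop_next (s1 := P k)); last first.
  by apply: IH => v lt; [apply: Hr; lia | apply: Hb; lia].
have := Hr k.+1 (leqnn _); have := Hb k (leqnn _); case: (P k.+1) => h R o /= H e.
apply: exec_bind; first by apply: exec_decS e.
by apply: exec_bind; [apply: H | apply: exec_ret].
Qed.

Definition clear (r : 'I_nreg) : prog unit := drain r (ret nreg tt).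

Lemma exec_clear h R o r : exec (clear r) (St h R o) tt (St h (upd R r 0) o).
Proof.
have := @exec_drain r (ret nreg tt) (fun v => St h (upd R r v) o) (R r).
rewrite /= upd_same; apply=> [v _|v _]; first by rewrite upd_eq.
by rewrite upd_twice; apply: exec_ret.
Qed.

Definition transfer (r a : 'I_nreg) : prog unit := drain r (inc a).

Lemma exec_transfer h R o r a : r != a -> R a = 0 -> R r <= n.+2 ->
  exec (transfer r a) (St h R o) tt (St h (upd (upd R r 0) a (R r)) o).
Proof.
move=> /eqP ne a0 le.
have := @exec_drain r (inc a) (fun v => St h (upd (upd R r v) a (R r - v)) o) (R r).
rewrite /= subn0 subnn.
have -> : upd (upd R r (R r)) a 0 = R by regs.
apply=> [v _|v lt]; first by rewrite /upd eqxx; case: eqP.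
set R1 := upd _ r v.
have -> : upd (upd R r v) a (R r - v) = upd R1 a (R1 a).+1 by rewrite /R1; regs.
by apply: exec_inc; rewrite /R1 /upd eqxx; case: eqP => [/esym //|_]; lia.
Qed.

(** A register can only be read by counting it down, so a second copy is made in [rTmp], from which
    [r] is restored. *)
Definition dup (r a : 'I_nreg) : prog unit :=
  drain r (inc a ;; inc rTmp) ;; transfer rTmp r.

Lemma exec_dup h R o r a :
  r != a -> r != rTmp -> a != rTmp -> R a = 0 -> R rTmp = 0 -> R r <= n.+2 ->
  exec (dup r a) (St h R o) tt (St h (upd R a (R r)) o).
Proof.
move=> /eqP ra /eqP rt /eqP at_ a0 t0 le.
pose P v := upd (upd (upd R r v) a (R r - v)) rTmp (R r - v).
apply: (@exec_bind _ _ _ _ _ _ _ _ _ (St h (P 0) o)).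
  have := @exec_drain r (inc a ;; inc rTmp) (fun v => St h (P v) o) (R r).
  have {1}-> : P (R r) = R by rewrite /P subnn; regs.
  apply=> [v _|v lt] /=; rewrite /P; first by rewrite /upd eqxx; do !case: eqP => //.
  set R1 := upd _ r v.
  apply: exec_bind; first apply: exec_inc.
    by rewrite /R1 /upd eqxx; do !case: eqP => ? //; try congruence; lia.
  set R2 := upd R1 _ _.
  have -> : upd (upd (upd R r v) a (R r - v)) rTmp (R r - v) = upd R2 rTmp (R2 rTmp).+1.
    by rewrite /R2 /R1; regs.
  apply: exec_inc.
  by rewrite /R2 /R1 /upd eqxx; do !case: eqP => ? //; try congruence; lia.
have -> : upd R a (R r) = upd (upd (P 0) rTmp 0) r (P 0 rTmp).
  by rewrite /P; regs.
apply: exec_transfer; first by apply/eqP => e; apply: rt.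
- by rewrite /P /upd eqxx; do !case: eqP => //.
- by rewrite /P upd_eq; lia.
Qed.

Definition rewind : prog unit :=
  loop (b <~ at_start ;; if b then ret nreg (inr tt) else mv MLeft ;; ret nreg (inl tt)).

Lemma exec_rewind h R o : exec rewind (St h R o) tt (St 0 R o).
Proof.
elim: h => [|h IH].
  by apply: exec_loop_stop; apply: exec_bind; [apply: exec_at_start | apply: exec_ret].
apply: exec_loop_next IH; apply: exec_bind; first exact: exec_at_start.
by apply: exec_bind; [apply: exec_mv | apply: exec_ret].
Qed.

(** A program cannot ask where its head is. Positions that matter are kept in registers and regained
    by counting from the left endmarker. *)
Definition goto (r : 'I_nreg) : prog unit :=
  rewind ;; dup r rPos ;; drain rPos (mv MRight).

Lemma exec_goto h R o (r : 'I_nreg) :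
  R rTmp = 0 -> R rPos = 0 -> 2 <= r -> R r <= n.+1 ->
  exec (goto r) (St h R o) tt (St (R r) R o).
Proof.
move=> t0 p0 r2 le; apply: exec_bind; first exact: exec_rewind.
have rp : r <> rPos by move=> e; move: r2; rewrite e.
have rt : r <> rTmp by move=> e; move: r2; rewrite e.
apply: exec_bind; first by apply: exec_dup => //; try exact/eqP; lia.
have := @exec_drain rPos (mv MRight) (fun v => St (R r - v) (upd R rPos v) o) (R r).
rewrite /= subnn subn0.
have -> : upd R rPos 0 = R by rewrite -[RHS](upd_same R rPos) p0.
apply=> [v _|v lt] /=; first by rewrite upd_eq.
rewrite upd_twice.
have -> : R r - v = move_in n (R r - v.+1) MRight by rewrite /=; lia.
exact: exec_mv.
Qed.

End Programs.

(** * Comparing a binary numeral of the input with a register *)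

Lemma pos_bits_isbit p : all isbit (pos_bits p).
Proof. by elim: p => //= p IH; rewrite all_cat IH. Qed.

Lemma enc_nat_isbit u : all isbit (enc_nat u).
Proof. by rewrite /enc_nat; case: N.of_nat => // p; apply: pos_bits_isbit. Qed.

(** Least significant digit first: the order in which a numeral is met when the head moves left. *)
Fixpoint cmpb (l : seq token) (t : nat) : bool :=
  if l is b :: l' then (odd t == (b == T1)) && cmpb l' t./2 else t == 0.

Lemma cmpb_enc u t : cmpb (rev (enc_nat u)) t = (u == t).
Proof.
rewrite /enc_nat; case e : (N.of_nat u) => [|p].
  have <- : 0 = u by have := Nnat.Nat2N.id u; rewrite e.
  by rewrite /= -[T0 == T1]/false; lia.
have <- : Pos.to_nat p = u by have := Nnat.Nat2N.id u; rewrite e.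
elim: p t {e} => [p IH|p IH|] t; rewrite /= ?rev_cat /= ?IH ?eqxx.
- by rewrite eqb_id; lia.
- by rewrite -[T0 == T1]/false; lia.
- by rewrite eqb_id; lia.
Qed.

Section Programs.
Variable x : seq token.
Let n := size x.
Notation prog := (prog nreg).
Notation exec := (@exec nreg x n.+2 _).
Notation hat := (hat x).
Notation ret := (ret nreg).

(** Specifications that forget the head. They suffice, and compose freely, wherever the relevant
    positions are stored in registers. *)
Definition cexec (E : Type) (p : prog E) R o e R' o' : Prop :=
  forall h, exists h', exec p (St h R o) e (St h' R' o').

Lemma cexec_bind (E1 : finType) E2 (p : prog E1) (k : E1 -> prog E2) R o e R1 o1 e2 R2 o2 :
  cexec p R o e R1 o1 -> cexec (k e) R1 o1 e2 R2 o2 -> cexec (bind p k) R o e2 R2 o2.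
Proof.
move=> H1 H2 h; have [h1 X1] := H1 h; have [h2 X2] := H2 h1.
by exists h2; apply: exec_bind X1 X2.
Qed.

Lemma cexec_ret E (e : E) R o : cexec (ret e) R o e R o.
Proof. by move=> h; exists h; apply: exec_ret. Qed.

Lemma cexec_inc R o r : R r <= n.+1 -> cexec (inc r) R o tt (upd R r (R r).+1) o.
Proof. by move=> le h; exists h; apply: exec_inc. Qed.

Lemma cexec_clear R o r : cexec (clear r) R o tt (upd R r 0) o.
Proof. by move=> h; exists h; apply: exec_clear. Qed.

Definition skipbits : prog unit :=
  loop (c <~ rd ;;
        if (if c is Some t then isbit t else false)
        then mv MRight ;; ret (inl tt) else ret (inr tt)).

Lemma exec_skipbits h bs s R o : hat h (bs ++ s) -> all isbit bs -> nbhead s ->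
  exec skipbits (St h R o) tt (St (h + size bs) R o).
Proof.
elim: bs h => [|b bs IH] h H /=.
  move=> _ nb; rewrite addn0; apply: exec_loop_stop.
  apply: exec_bind; first exact: exec_rd H.
  by case: (s) nb => [|c s'] /=; [|case: (isbit c)] => // _; apply: exec_ret.
case/andP=> ib ibs nb; apply: (exec_loop_next (s1 := St h.+1 R o)); last first.
  by rewrite -addSnnS; apply: IH => //; apply: hat_next H.
apply: exec_bind; first exact: exec_rd H.
rewrite /= ib; apply: exec_bind; last exact: exec_ret.
exact: exec_right H.
Qed.

Definition copynum : prog unit :=
  loop (c <~ rd ;;
        if c is Some t then
          if isbit t then out t ;; mv MRight ;; ret (inl tt) else ret (inr tt)
        else ret (inr tt)).

Lemma exec_copynum h s R o : hat h s ->
  exists h', exec copynum (St h R o) tt (St h' R (o ++ bits s)).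
Proof.
elim: s h o => [|c s IH] h o H.
  exists h; rewrite cats0; apply: exec_loop_stop.
  by apply: exec_bind; [apply: exec_rd H | apply: exec_ret].
case ib : (isbit c) => /=; rewrite ib; last first.
  exists h; rewrite cats0; apply: exec_loop_stop.
  by apply: exec_bind; [apply: exec_rd H | rewrite /= ib; apply: exec_ret].
have [h' H'] := IH h.+1 (rcons o c) (hat_next H).
exists h'; rewrite -cat_rcons; apply: exec_loop_next H'.
apply: exec_bind; [apply: exec_rd H | rewrite /= ib].
apply: exec_bind; first exact: exec_out.
by apply: exec_bind; [apply: exec_right H | apply: exec_ret].
Qed.

Definition seek (t0 : token) : prog unit :=
  loop (c <~ rd ;;
        if c is Some t then
          if t == t0 then ret (inr tt) else mv MRight ;; ret (inl tt)
        else ret (inr tt)).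

Lemma exec_seek t h s1 s2 R o : hat h (s1 ++ t :: s2) -> t \notin s1 ->
  exec (seek t) (St h R o) tt (St (h + size s1) R o).
Proof.
elim: s1 h => [|c s1 IH] h H.
  move=> _; rewrite addn0; apply: exec_loop_stop.
  by apply: exec_bind; [apply: exec_rd H | rewrite /= eqxx; apply: exec_ret].
rewrite inE negb_or => /andP [ne ni].
rewrite -addSnnS; apply: (exec_loop_next (s1 := St h.+1 R o)); last first.
  by apply: IH => //; apply: hat_next H.
apply: exec_bind; [apply: exec_rd H | rewrite /= eq_sym (negbTE ne)].
by apply: exec_bind; [apply: exec_right H | apply: exec_ret].
Qed.

Definition halve : prog bool :=
  loop (b <~ dec rT1 ;;
        if b then
          b2 <~ dec rT1 ;;
          if b2 then inc rT2 ;; ret (inl tt) else ret (inr true)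
        else ret (inr false)).

Lemma exec_halve h R o v w : w + v <= n.+1 ->
  exec halve (St h (upd (upd R rT1 v) rT2 w) o) (odd v)
             (St h (upd (upd R rT1 0) rT2 (w + v./2)) o).
Proof.
have [k] := ubnP v; elim: k v w => // k IH [|[|v]] w ltk le.
- rewrite addn0; apply: exec_loop_stop; apply: exec_bind; first exact: exec_dec0.
  exact: exec_ret.
- rewrite addn0; apply: exec_loop_stop; apply: exec_bind; first exact: exec_decS.
  apply: exec_bind; first exact: exec_dec0.
  have -> : upd (upd (upd R rT1 1) rT2 w) rT1 0 = upd (upd R rT1 0) rT2 w by regs.
  exact: exec_ret.
- have -> : w + v.+2./2 = w.+1 + v./2 by rewrite /=; lia.
  have -> : odd v.+2 = odd v by rewrite /= negbK.
  apply: exec_loop_next; last by apply: IH; lia.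
  apply: exec_bind; first exact: exec_decS.
  apply: exec_bind; first exact: exec_decS.
  set R1 := upd _ _ v.
  have -> : upd (upd R rT1 v) rT2 w.+1 = upd R1 rT2 (R1 rT2).+1 by rewrite /R1; regs.
  apply: exec_bind; last exact: exec_ret.
  by apply: exec_inc; rewrite /R1 /upd /=; lia.
Qed.

Definition cmploop : prog bool :=
  loop (c <~ rd ;;
        if (if c is Some t then isbit t else false) then
          b <~ halve ;; transfer rT2 rT1 ;;
          if b == (c == Some T1) then mv MLeft ;; ret (inl tt)
          else clear rT1 ;; ret (inr false)
        else b <~ dec rT1 ;;
             if b then clear rT1 ;; ret (inr false) else ret (inr true)).

Definition cmpnum (w : 'I_nreg) : prog bool :=
  skipbits ;; mv MLeft ;; dup w rT1 ;; cmploop.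

(** The numeral is read backwards from its last digit while [rT1] is halved. The token [c] to its
    left ends the loop, and equality then means that nothing is left in [rT1]. *)
Lemma exec_cmploop h c bs s R o v : hat h (c :: bs ++ s) -> ~~ isbit c ->
  all isbit bs -> clean R -> v <= n.+1 ->
  exists h', exec cmploop (St (h + size bs) (upd R rT1 v) o) (cmpb (rev bs) v) (St h' R o).
Proof.
move=> H nb + C; have [t10 t20] : R rT1 = 0 /\ R rT2 = 0 by rewrite !C.
have R0 u : upd (upd R rT1 u) rT1 0 = R.
  by rewrite upd_twice -[RHS](upd_same R rT1) t10.
elim/last_ind: bs s v H => [|bs b IH] s v H.
  move=> _ le; exists h; rewrite addn0; apply: exec_loop_stop.
  apply: exec_bind; first exact: exec_rd H.
  rewrite /= (negbTE nb); case: v le => [|v] le /=.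
    apply: exec_bind; first exact: exec_dec0.
    by rewrite -{2}(R0 0) upd_twice; apply: exec_ret.
  apply: exec_bind; first exact: exec_decS.
  apply: exec_bind; first exact: exec_clear.
  by rewrite upd_twice R0; apply: exec_ret.
rewrite all_rcons size_rcons rev_rcons /= => /andP [ib ibs] le.
rewrite cat_rcons in H; have Hb := hat_cat (s1 := c :: bs) H.
have [h' X] := IH (b :: s) v./2 H ibs ltac:(lia).
have read : exec rd (St (h + (size bs).+1) (upd R rT1 v) o) (Some b)
    (St (h + (size bs).+1) (upd R rT1 v) o) := exec_rd _ _ Hb.
have hv : exec halve (St (h + (size bs).+1) (upd R rT1 v) o) (odd v)
    (St (h + (size bs).+1) (upd R rT2 v./2) o).
  have := @exec_halve (h + (size bs).+1) R o v 0 le.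
  rewrite add0n (_ : upd (upd R rT1 v) rT2 0 = upd R rT1 v); last by regs.
  by rewrite (_ : upd (upd R rT1 0) rT2 v./2 = upd R rT2 v./2) //; regs.
have tr : exec (transfer rT2 rT1) (St (h + (size bs).+1) (upd R rT2 v./2) o) tt
    (St (h + (size bs).+1) (upd R rT1 v./2) o).
  have := @exec_transfer x (h + (size bs).+1) (upd R rT2 v./2) o rT2 rT1 isT.
  rewrite upd_eq (_ : upd (upd _ rT2 0) rT1 _ = upd R rT1 v./2); last by regs.
  by apply; rewrite ?/upd //=; lia.
case e : (odd v == (b == T1)) => /=.
  exists h'; apply: exec_loop_next X.
  apply: exec_bind; first exact: read.
  rewrite /= ib; apply: exec_bind; first exact: hv.
  apply: exec_bind; first exact: tr.
  rewrite -[Some b == Some T1]/(b == T1) e; apply: exec_bind; last exact: exec_ret.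
  have -> : h + size bs = move_in n (h + (size bs).+1) MLeft by rewrite /=; lia.
  exact: exec_mv.
exists (h + (size bs).+1); apply: exec_loop_stop.
apply: exec_bind; first exact: read.
rewrite /= ib; apply: exec_bind; first exact: hv.
apply: exec_bind; first exact: tr.
rewrite -[Some b == Some T1]/(b == T1) e; apply: exec_bind; first exact: exec_clear.
by rewrite R0; apply: exec_ret.
Qed.

Lemma exec_cmpnum h c u s R o w : hat h (c :: enc_nat u ++ s) -> ~~ isbit c ->
  nbhead s -> clean R -> 6 <= nat_of_ord w -> R w <= n.+1 ->
  exists h', exec (cmpnum w) (St h.+1 R o) (u == R w) (St h' R o).
Proof.
move=> H nb ns C w6 le.
have [h' X] := exec_cmploop o H nb (enc_nat_isbit u) C le.
exists h'; rewrite -cmpb_enc.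
apply: exec_bind; first exact: exec_skipbits (hat_next H) (enc_nat_isbit u) ns.
apply: exec_bind; first exact: exec_mv.
rewrite /=; apply: exec_bind; last exact: X.
by apply: exec_dup => //; try exact: C; try lia; apply/eqP => e; rewrite e in w6.
Qed.

End Programs.

(** * Comparing and scanning the input through stored positions *)

Section Programs.
Variable x : seq token.
Let n := size x.
Notation prog := (prog nreg).
Notation exec := (@exec nreg x n.+2 _).
Notation cexec := (@cexec x _).
Notation hat := (hat x).
Notation ret := (ret nreg).

Lemma cexec_goto_rd R o (r : 'I_nreg) s : R rTmp = 0 -> R rPos = 0 -> 2 <= r ->
  hat (R r) s -> cexec (goto r ;; rd) R o (ohead s) R o.
Proof.
move=> t0 p0 r2 H h; exists (R r); have [_ le _] := H.
by apply: exec_bind; [apply: exec_goto | apply: exec_rd].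
Qed.

(** All terminators of a numeral are identified, the end of the input included, so what follows two
    numerals does not affect their comparison. *)
Definition obit (c : option token) : option bool :=
  if c is Some t then if isbit t then Some (t == T1) else None else None.

(** With a single input head, the program shuttles between the positions in [rA] and [rB], one digit
    at a time. *)
Definition streq : prog bool :=
  loop (c <~ (goto rA ;; rd) ;; d <~ (goto rB ;; rd) ;;
        if obit c == obit d then
          if obit c is Some _ then inc rA ;; inc rB ;; ret (inl tt)
          else clear rA ;; clear rB ;; ret (inr true)
        else clear rA ;; clear rB ;; ret (inr false)).

Lemma cexec_loop_next E (p : prog (unit + E)) R o R1 o1 e R2 o2 :
  cexec p R o (inl tt) R1 o1 -> cexec (loop p) R1 o1 e R2 o2 ->
  cexec (loop p) R o e R2 o2.
Proof.
move=> H1 H2 h; have [h1 X1] := H1 h; have [h2 X2] := H2 h1.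
by exists h2; apply: exec_loop_next X1 X2.
Qed.

Lemma cexec_loop_stop E (p : prog (unit + E)) R o e R1 o1 :
  cexec p R o (inr e) R1 o1 -> cexec (loop p) R o e R1 o1.
Proof.
by move=> H1 h; have [h1 X1] := H1 h; exists h1; apply: exec_loop_stop X1.
Qed.

Lemma bits_obit s : bits s = if obit (ohead s) is Some b then
    (if b then T1 else T0) :: bits (behead s) else [::].
Proof. by case: s => //= -[]. Qed.

Lemma obit_cons s b : obit (ohead s) = Some b -> exists c, s = c :: behead s.
Proof. by case: s => //= c s _; exists c. Qed.

Lemma cexec_streq R o a b s1 s2 : clean R -> hat a s1 -> hat b s2 ->
  cexec streq (upd (upd R rA a) rB b) o (bits s1 == bits s2) R o.
Proof.
move=> C; have [k] := ubnP (size s1).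
elim: k s1 s2 a b => // k IH s1 s2 a b ltk H1 H2.
have C' (i : 'I_nreg) : i < 4 -> upd (upd R rA a) rB b i = 0.
  by move=> i4; rewrite /upd; do ![case: eqP => [e|_]; first by rewrite e in i4]; apply: C; lia.
have rdA : cexec (goto rA ;; rd) (upd (upd R rA a) rB b) o (ohead s1)
    (upd (upd R rA a) rB b) o by apply: cexec_goto_rd => //; exact: C'.
have rdB : cexec (goto rB ;; rd) (upd (upd R rA a) rB b) o (ohead s2)
    (upd (upd R rA a) rB b) o by apply: cexec_goto_rd => //; exact: C'.
have fin e : cexec (clear rA ;; clear rB ;; ret (inr e))
    (upd (upd R rA a) rB b) o (inr e : unit + bool) R o.
  apply: cexec_bind; first exact: cexec_clear.
  apply: cexec_bind; first exact: cexec_clear.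
  set R' := upd _ rB 0; have -> : R' = R; last exact: cexec_ret.
  by move: (C rA isT) (C rB isT) => ? ?; rewrite /R'; regs.
rewrite (bits_obit s1) (bits_obit s2).
case e1 : (obit (ohead s1)) => [b1|]; case e2 : (obit (ohead s2)) => [b2|].
- have [c1 E1] := obit_cons e1; have [c2 E2] := obit_cons e2.
  case: (b1 =P b2) => [eb|ne].
    rewrite -eb eqseq_cons eqxx /=.
    apply: (@cexec_loop_next _ _ _ _ (upd (upd R rA a.+1) rB b.+1) o); last first.
      apply: IH; first by rewrite E1 in ltk.
        by apply: (@hat_next _ _ c1); rewrite -E1.
      by apply: (@hat_next _ _ c2); rewrite -E2.
    apply: cexec_bind; first exact: rdA.
    apply: cexec_bind; first exact: rdB.
    rewrite e1 e2 eb eqxx.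
    apply: cexec_bind; first by apply: cexec_inc; case: H1 => _ le _; rewrite /upd /=.
    apply: cexec_bind; first by apply: cexec_inc; case: H2 => _ le _; rewrite /upd /=.
    set R' := upd _ rB _; have -> : R' = upd (upd R rA a.+1) rB b.+1; last exact: cexec_ret.
    by rewrite /R'; regs.
  have -> : ((if b1 then T1 else T0) :: bits (behead s1) ==
             (if b2 then T1 else T0) :: bits (behead s2)) = false.
    by rewrite eqseq_cons; case: b1 {e1} ne; case: b2 {e2}.
  apply: cexec_loop_stop.
  apply: cexec_bind; first exact: rdA.
  apply: cexec_bind; first exact: rdB.
  by rewrite e1 e2; case: eqP => [[]|_] //; exact: fin.
- apply: cexec_loop_stop.
  apply: cexec_bind; first exact: rdA.
  apply: cexec_bind; first exact: rdB.
  by rewrite e1 e2; exact: fin.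
- apply: cexec_loop_stop.
  apply: cexec_bind; first exact: rdA.
  apply: cexec_bind; first exact: rdB.
  by rewrite e1 e2; exact: fin.
- apply: cexec_loop_stop.
  apply: cexec_bind; first exact: rdA.
  apply: cexec_bind; first exact: rdB.
  by rewrite e1 e2; exact: fin.
Qed.

(* The position is kept in r, so body may move the head freely. *)
Definition scan (E : finType) (r : 'I_nreg) (body : token -> prog (option E)) :
    prog (option E) :=
  loop (c <~ (goto r ;; rd) ;;
        if c is Some t then
          if t == TEnd then ret (inr None)
          else e <~ body t ;;
               if e is Some _ then ret (inr e) else inc r ;; ret (inl tt)
        else ret (inr None)).

Section Scan.
Variables (E : finType) (r : 'I_nreg) (body : token -> prog (option E)).
Hypothesis r6 : 6 <= r.

Lemma scan_end R o s : clean R -> hat (R r) s -> ohead s \in [:: None; Some TEnd] ->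
  cexec (scan r body) R o None R o.
Proof.
move=> C H hs; apply: cexec_loop_stop.
apply: cexec_bind; first by apply: cexec_goto_rd H; rewrite ?C //; lia.
case: (ohead s) hs => [t|] hs; last exact: cexec_ret.
have -> : t == TEnd by move: hs; rewrite !inE.
exact: cexec_ret.
Qed.

Lemma scan_next R o c s R' o' e R2 o2 : clean R -> hat (R r) (c :: s) -> c != TEnd ->
  cexec (body c) R o None R' o' -> R' r = R r ->
  cexec (scan r body) (upd R' r (R r).+1) o' e R2 o2 ->
  cexec (scan r body) R o e R2 o2.
Proof.
move=> C H ne Hb er; apply: cexec_loop_next.
apply: cexec_bind; first by apply: cexec_goto_rd H; rewrite ?C //; lia.
rewrite /= (negbTE ne); apply: cexec_bind; first exact: Hb.
rewrite /= -er; apply: cexec_bind; last exact: cexec_ret.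
by apply: cexec_inc; rewrite er; case: H.
Qed.

Lemma scan_stop R o c s R' o' e : clean R -> hat (R r) (c :: s) -> c != TEnd ->
  cexec (body c) R o (Some e) R' o' -> cexec (scan r body) R o (Some e) R' o'.
Proof.
move=> C H ne Hb; apply: cexec_loop_stop.
apply: cexec_bind; first by apply: cexec_goto_rd H; rewrite ?C //; lia.
rewrite /= (negbTE ne); apply: cexec_bind; first exact: Hb.
exact: cexec_ret.
Qed.

Lemma scan_skip_exec (q : pred token) R o s1 s e R2 o2 :
  (forall c, q c -> c != TEnd /\
     forall pos, cexec (body c) (upd R r pos) o None (upd R r pos) o) ->
  clean R -> all q s1 -> hat (R r) (s1 ++ s) ->
  cexec (scan r body) (upd R r (R r + size s1)) o e R2 o2 ->
  cexec (scan r body) R o e R2 o2.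
Proof.
move=> Hq C qs H X; rewrite -(upd_same R r); move: (R r) qs H X => pos.
elim: s1 pos => [|c s1 IH] pos /=; first by rewrite addn0.
case/andP=> qc qs H X; have [ne bc] := Hq _ qc.
apply: (scan_next (R' := upd R r pos) (clean_upd _ C r6) (c := c) (s := s1 ++ s)) => //.
  by rewrite upd_eq.
rewrite upd_eq upd_twice; apply: IH => //; first exact: hat_next H.
by rewrite addSnnS.
Qed.

Lemma scan_skip (q : pred token) R o s1 s e R2 o2 :
  (forall c, q c -> c != TEnd /\ body c = ret None) ->
  clean R -> all q s1 -> hat (R r) (s1 ++ s) ->
  cexec (scan r body) (upd R r (R r + size s1)) o e R2 o2 ->
  cexec (scan r body) R o e R2 o2.
Proof.
move=> Hq; apply: scan_skip_exec => c /Hq [ne ->]; split=> // pos.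
exact: cexec_ret.
Qed.
End Scan.
End Programs.

(** * Programs reading the encoding of a Kripke structure *)

Lemma enc_nat_inj : injective enc_nat.
Proof. by move=> u v e; apply/eqP; rewrite -cmpb_enc e cmpb_enc. Qed.

Lemma bits_enc u s : nbhead s -> bits (enc_nat u ++ s) = enc_nat u.
Proof. by move=> nb; rewrite bits_cat // enc_nat_isbit. Qed.

Lemma enc_nat_notin c u : ~~ isbit c -> c \notin enc_nat u.
Proof. by move=> nb; apply/negP => /(allP (enc_nat_isbit u)); apply/negP. Qed.

Definition enc_edges (es : seq (nat * nat)) : seq token :=
  flatten [seq TEdge :: enc_nat e.1 ++ TSep :: enc_nat e.2 | e <- es].
Definition enc_items (l : seq nat) : seq token :=
  flatten [seq TSep :: enc_nat p | p <- l].
Definition enc_labels (ls : seq (seq nat)) : seq token :=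
  flatten [seq TLab :: enc_items l | l <- ls].

Lemma enc_kripkeE K : enc_kripke K =
  TKrip :: enc_nat (kW K) ++ TSep :: enc_nat (kr K) ++ enc_edges (kR K) ++
  enc_labels (kL K) ++ [:: TEnd].
Proof. by []. Qed.

Lemma enc_edges_cons e es s : enc_edges (e :: es) ++ s =
  TEdge :: enc_nat e.1 ++ TSep :: enc_nat e.2 ++ enc_edges es ++ s.
Proof. by rewrite /enc_edges /= -!catA. Qed.
Lemma enc_items_cons p l s :
  enc_items (p :: l) ++ s = TSep :: enc_nat p ++ enc_items l ++ s.
Proof. by rewrite /enc_items /= -!catA. Qed.
Lemma enc_labels_cons l ls s :
  enc_labels (l :: ls) ++ s = TLab :: enc_items l ++ enc_labels ls ++ s.
Proof. by rewrite /enc_labels /= -!catA. Qed.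

Lemma nbhead_enc_edges es s : nbhead s -> nbhead (enc_edges es ++ s).
Proof. by case: es. Qed.
Lemma nbhead_enc_items l s : nbhead s -> nbhead (enc_items l ++ s).
Proof. by case: l. Qed.
Lemma nbhead_enc_labels ls s : nbhead s -> nbhead (enc_labels ls ++ s).
Proof. by case: ls. Qed.

Section Programs.
Variable x : seq token.
Let n := size x.
Notation prog := (prog nreg).
Notation exec := (@exec nreg x n.+2 _).
Notation cexec := (@cexec x _).
Notation hat := (hat x).
Notation ret := (ret nreg).

(** Abstracts from the place where a number stands. The delimiter on the left is for [cmpnum], which
    reads backwards; the one on the right also serves [copynum]. *)
Definition locates (p : prog unit) R u : Prop := forall h o, exists h' c s,
  [/\ exec p (St h R o) tt (St h'.+1 R o), hat h' (c :: enc_nat u ++ s),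
      ~~ isbit c & nbhead s].

Definition cmp_at (p : prog unit) (w : 'I_nreg) : prog bool := p ;; cmpnum w.

Lemma cexec_cmp_at p R u o (w : 'I_nreg) : locates p R u -> clean R ->
  6 <= w -> R w <= n.+1 -> cexec (cmp_at p w) R o (u == R w) R o.
Proof.
move=> L C w6 le h; have [h1 [c [s [X H nc ns]]]] := L h o.
have [h2 Y] := exec_cmpnum o H nc ns C w6 le.
by exists h2; apply: exec_bind X Y.
Qed.

Definition copy_at (p : prog unit) : prog unit := p ;; copynum.

Lemma cexec_copy_at p R u o : locates p R u ->
  cexec (copy_at p) R o tt R (o ++ enc_nat u).
Proof.
move=> L h; have [h1 [c [s [X H nc ns]]]] := L h o.
have [h2] := exec_copynum R o (hat_next H); rewrite bits_enc // => Y.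
by exists h2; apply: exec_bind; [exact: X | exact: Y].
Qed.

Definition after (r : 'I_nreg) : prog unit := goto r ;; mv MRight.

Lemma locates_after R (r : 'I_nreg) c u s : clean R -> 2 <= r ->
  hat (R r) (c :: enc_nat u ++ s) -> ~~ isbit c -> nbhead s ->
  locates (after r) R u.
Proof.
move=> C r2 H nc ns h o; exists (R r), c, s; split=> //.
have [_ le _] := H.
by apply: exec_bind; [apply: exec_goto => //; apply: C | apply: exec_right H].
Qed.

(** The two numbers need not fit into registers, so their digits are compared instead of their
    values. *)
Definition eq_after (r1 r2 : 'I_nreg) : prog bool :=
  dup r1 rA ;; inc rA ;; dup r2 rB ;; inc rB ;; streq.

Lemma cexec_eq_after R o (r1 r2 : 'I_nreg) c d s1 s2 :
  clean R -> 6 <= r1 -> 6 <= r2 ->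
  hat (R r1) (c :: s1) -> hat (R r2) (d :: s2) ->
  cexec (eq_after r1 r2) R o (bits s1 == bits s2) R o.
Proof.
move=> C r16 r26 H1 H2.
have ne (r r' : 'I_nreg) : 6 <= r -> r' < 6 -> r != r'.
  by move=> a b; apply/eqP => e; rewrite e in a; lia.
have [_ le1 _] := H1; have [_ le2 _] := H2.
apply: cexec_bind.
  move=> h; exists h; apply: exec_dup; try exact: ne; try exact: C; by [|lia].
apply: cexec_bind; first by apply: cexec_inc; rewrite upd_eq.
apply: cexec_bind.
  move=> h; exists h; apply: exec_dup; try exact: ne;
    rewrite ?upd_eq /upd ?(negbTE (ne r2 rA r26 isT)) //=; by [exact: C | lia].
rewrite upd_twice !upd_eq.
have -> : upd R rA (R r1).+1 r2 = R r2 by rewrite /upd (negbTE (ne r2 rA r26 isT)).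
apply: cexec_bind; first by apply: cexec_inc; rewrite upd_eq.
rewrite upd_twice upd_eq.
by apply: cexec_streq; [| apply: hat_next H1 | apply: hat_next H2].
Qed.

Definition edge_at pos (e : nat * nat) : Prop := exists s,
  hat pos (TEdge :: enc_nat e.1 ++ TSep :: enc_nat e.2 ++ s) /\ nbhead s.

Definition snd_at (r : 'I_nreg) : prog unit := goto r ;; seek TSep ;; mv MRight.

Lemma locates_fst R (r : 'I_nreg) e : clean R -> 2 <= r -> edge_at (R r) e ->
  locates (after r) R e.1.
Proof. by move=> C r2 [s [H ns]]; apply: locates_after H _ _. Qed.

Lemma locates_snd R (r : 'I_nreg) e : clean R -> 2 <= r -> edge_at (R r) e ->
  locates (snd_at r) R e.2.
Proof.
move=> C r2 [s [H ns]] h o.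
have H' := hat_cat (s1 := TEdge :: enc_nat e.1) H.
exists (R r + (size (enc_nat e.1)).+1), TSep, s; split=> //.
have [_ le _] := H.
apply: exec_bind; first by apply: exec_goto => //; apply: C.
apply: exec_bind; last exact: exec_right H'.
by apply: (exec_seek (s1 := TEdge :: _)) H _; rewrite inE /= enc_nat_notin.
Qed.

Section Structure.
Variables (K : kripke) (post : seq token).
Hypothesis xE : x = enc_kripke K ++ post.

Lemma hat_header : hat 1 ((TKrip :: enc_nat (kW K) ++ TSep :: enc_nat (kr K)) ++
  enc_edges (kR K) ++ enc_labels (kL K) ++ TEnd :: post).
Proof.
by have := hat1 x; rewrite {2}xE enc_kripkeE /= -!catA /= -!catA.
Qed.

Lemma exec_mv0 R o : exec (mv MRight) (St 0 R o) tt (St 1 R o).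
Proof. by have := @exec_mv x 0 R o MRight; rewrite /= (minn_idPl _). Qed.

Definition width_at : prog unit := rewind ;; mv MRight ;; mv MRight.
Definition root_at : prog unit := rewind ;; mv MRight ;; seek TSep ;; mv MRight.

Lemma locates_width R : locates width_at R (kW K).
Proof.
move=> h o; have H := hat_header; rewrite /= -!catA /= in H.
eexists 1, TKrip, _; split; last first; [ | | exact: H | ] => //.
apply: exec_bind; first exact: exec_rewind.
apply: exec_bind; first exact: exec_mv0.
exact: exec_right H.
Qed.

Lemma locates_root R : locates root_at R (kr K).
Proof.
move=> h o; have H := hat_header; rewrite /= -!catA /= in H.
have H' := hat_cat (s1 := TKrip :: enc_nat (kW K)) H.
eexists _, TSep, _; split; last first; [ | | exact: H' | ] => //.
  by apply: nbhead_enc_edges; apply: nbhead_enc_labels.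
apply: exec_bind; first exact: exec_rewind.
apply: exec_bind; first exact: exec_mv0.
apply: exec_bind; last exact: exec_right H'.
by apply: (exec_seek (s1 := TKrip :: _)) H _; rewrite inE /= enc_nat_notin.
Qed.

End Structure.
End Programs.

(** * Loops over the edges and over the worlds *)

Section Loops.
Variable x : seq token.
Let n := size x.
Notation prog := (prog nreg).
Notation cexec := (@cexec x _).
Notation hat := (hat x).
Notation ret := (ret nreg).
Variables (K : kripke) (post : seq token).
Hypothesis xE : x = enc_kripke K ++ post.

Lemma all_bits (q : pred token) u : q T0 -> q T1 -> all q (enc_nat u).
Proof.
move=> q0 q1; apply/allP => c /(allP (enc_nat_isbit u)).
by case: c.
Qed.

Definition edgeloop (r : 'I_nreg) (b : prog bool) : prog bool :=
  inc r ;;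
  o <~ scan r (fun c => if c == TEdge then
                 t <~ b ;; ret (if t then Some tt else None) else ret None) ;;
  clear r ;; ret (o : bool).

(** The edge at which a search succeeds still produces its output; later edges do not. *)
Fixpoint outputs_upto (A : Type) (P : pred A) (f : A -> seq token) (s : seq A) :=
  if s is e :: s' then f e ++ (if P e then [::] else outputs_upto P f s') else [::].

Lemma cexec_edgeloop (r : 'I_nreg) b R o P f : 6 <= r -> clean R -> R r = 0 ->
  (forall pos e, e \in kR K -> edge_at x pos e ->
     forall o, cexec b (upd R r pos) o (P e) (upd R r pos) (o ++ f e)) ->
  cexec (edgeloop r b) R o (has P (kR K)) R (o ++ outputs_upto P f (kR K)).
Proof.
move=> r6 C r0 Hb; apply: cexec_bind.
  by apply: cexec_inc; rewrite r0.
rewrite r0; set body := fun c => _.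
pose q c := (c != TEnd) && (c != TEdge).
have bodyq c : q c -> c != TEnd /\ body c = ret None.
  by case/andP=> -> /negbTE ne; rewrite /body ne.
have qb u : all q (enc_nat u) by exact: all_bits.
(* Induction over the edges still ahead; after the last one the labels are skipped up to [TEnd]. *)
have scan_es es pos o' :
    {subset es <= kR K} ->
    hat pos (enc_edges es ++ enc_labels (kL K) ++ TEnd :: post) ->
    exists pos', cexec (scan r body) (upd R r pos) o'
      (if has P es then Some tt else None) (upd R r pos') (o' ++ outputs_upto P f es).
  elim: es pos o' => [|e es IH] pos o' sub H.
    exists (pos + size (enc_labels (kL K))); rewrite cats0.
    apply: (scan_skip r6 (q := q) (s1 := enc_labels (kL K)) bodyq).
    - exact: clean_upd.
    - rewrite /enc_labels; elim: (kL K) => //= l ls IHl; rewrite all_cat IHl andbT.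
      by rewrite /enc_items; elim: (l) => //= p l' IHp; rewrite all_cat IHp qb.
    - by rewrite upd_eq; exact: H.
    rewrite upd_eq upd_twice; apply: (@scan_end _ _ _ _ r6 _ _ (TEnd :: post) (clean_upd _ C r6)) => //.
    by rewrite upd_eq; apply: (hat_cat (s1 := enc_labels (kL K))) H.
  have eK : e \in kR K by apply: sub; rewrite mem_head.
  rewrite enc_edges_cons in H.
  have ea : edge_at x pos e.
    exists (enc_edges es ++ enc_labels (kL K) ++ TEnd :: post); split=> //.
    by apply: nbhead_enc_edges; apply: nbhead_enc_labels.
  have X := Hb pos e eK ea o'.
  have Cp : clean (upd R r pos) by exact: clean_upd.
  have H0 : hat (upd R r pos r) (TEdge :: enc_nat e.1 ++ TSep :: enc_nat e.2 ++
      enc_edges es ++ enc_labels (kL K) ++ TEnd :: post) by rewrite upd_eq.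
  rewrite /=; case Pe : (P e) X => X /=.
    exists pos; rewrite cats0; apply: (scan_stop r6 Cp H0) => //.
    rewrite /body eqxx; apply: cexec_bind; first exact: X.
    exact: cexec_ret.
  have H' := hat_next H; rewrite -cat_cons catA in H'.
  have [pos' Y] := IH _ (o' ++ f e) (fun y ye => sub y (mem_behead (s := e :: es) ye))
    (hat_cat H').
  exists pos'; rewrite catA.
  apply: (scan_next r6 Cp H0) => //.
    rewrite /body eqxx; apply: cexec_bind; first exact: X.
    exact: cexec_ret.
  rewrite upd_eq upd_twice.
  apply: (scan_skip r6 (q := q) (s1 := enc_nat e.1 ++ TSep :: enc_nat e.2) bodyq).
  - exact: clean_upd.
  - by rewrite all_cat qb /= qb.
  - by rewrite upd_eq; exact: H'.
  by rewrite upd_eq upd_twice.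
have [|pos' X] := scan_es (kR K) (1 + size (TKrip :: enc_nat (kW K) ++ TSep :: enc_nat (kr K))) o (fun y ye => ye).
  exact: hat_cat (hat_header xE).
apply: cexec_bind.
  apply: (scan_skip r6 (q := q) (s1 := TKrip :: enc_nat (kW K) ++ TSep :: enc_nat (kr K)) bodyq).
  - exact: clean_upd.
  - by rewrite /= all_cat qb /= qb.
  - by rewrite upd_eq; apply: hat_header xE.
  by rewrite upd_twice upd_eq; exact: X.
apply: cexec_bind; first exact: cexec_clear.
rewrite upd_twice; have -> : upd R r 0 = R by rewrite -r0 upd_same.
by case: (has P (kR K)); exact: cexec_ret.
Qed.

(** World [w] owns the label list with index [w], so counting [TLab] tokens enumerates the worlds.
    The count is below the input size, whereas the binary number [kW K] read from the input might
    not be. *)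
Definition labloop (b : prog bool) : prog bool :=
  inc rS ;;
  o <~ scan rS (fun c => if c == TLab then
                 t <~ b ;; if t then ret (Some tt) else inc rCnt ;; ret None
               else ret None) ;;
  clear rS ;; ret (o : bool).

Lemma size_enc_labels ls : size ls <= size (enc_labels ls).
Proof.
elim: ls => //= l ls IH; rewrite size_cat; apply: leq_trans (leq_addl _ _).
exact: IH.
Qed.

Lemma size_labels : size (kL K) < n.
Proof.
rewrite /n xE enc_kripkeE /= !size_cat /= !size_cat /=.
have := size_enc_labels (kL K); lia.
Qed.

Lemma cexec_labloop b R o P : clean R -> R rS = 0 -> R rCnt = 0 ->
  (forall pos w o, w < size (kL K) ->
     cexec b (upd (upd R rS pos) rCnt w) o (P w) (upd (upd R rS pos) rCnt w) o) ->
  cexec (labloop b) R o (has P (iota 0 (size (kL K))))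
    (upd R rCnt (find P (iota 0 (size (kL K))))) o.
Proof.
move=> C s0 c0 Hb; apply: cexec_bind.
  by apply: cexec_inc; rewrite s0.
rewrite s0; set body := fun c => _.
pose q c := (c != TEnd) && (c != TLab).
have bodyq c : q c -> c != TEnd /\ body c = ret None.
  by case/andP=> -> /negbTE ne; rewrite /body ne.
have qb u : all q (enc_nat u) by exact: all_bits.
have Cp pos w : clean (upd (upd R rS pos) rCnt w) by apply: clean_upd => //; apply: clean_upd.
have swap pos w pos' : upd (upd (upd R rS pos) rCnt w) rS pos' = upd (upd R rS pos') rCnt w.
  by regs.
have scan_ls ls w pos : w + size ls = size (kL K) ->
    hat pos (enc_labels ls ++ TEnd :: post) ->
    exists pos', cexec (scan rS body) (upd (upd R rS pos) rCnt w) o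
      (if has P (iota w (size ls)) then Some tt else None)
      (upd (upd R rS pos') rCnt (w + find P (iota w (size ls)))) o.
  elim: ls w pos => [|l ls IH] w pos sz H.
    by exists pos; rewrite /= addn0; apply: (@scan_end _ _ rS _ isT _ _ (TEnd :: post)).
  rewrite enc_labels_cons in H; rewrite /= in sz.
  have X := Hb pos w o ltac:(lia).
  have H0 : hat (upd (upd R rS pos) rCnt w rS) (TLab :: enc_items l ++ enc_labels ls ++ TEnd :: post) := H.
  rewrite /=; case Pw : (P w) X => X /=.
    exists pos; rewrite addn0; apply: (scan_stop (isT : 6 <= rS) (Cp _ _) H0) => //.
    rewrite /body eqxx; apply: cexec_bind; first exact: X.
    exact: cexec_ret.
  have H' := hat_next H.
  have [pos' Y] := IH w.+1 _ ltac:(lia) (hat_cat H').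
  exists pos'; apply: (scan_next (isT : 6 <= rS) (R' := upd (upd R rS pos) rCnt w.+1) (Cp _ _) H0) => //.
    rewrite /body eqxx; apply: cexec_bind; first exact: X.
    apply: cexec_bind; last exact: cexec_ret.
    have -> : upd (upd R rS pos) rCnt w.+1 =
        upd (upd (upd R rS pos) rCnt w) rCnt (upd (upd R rS pos) rCnt w rCnt).+1.
      by rewrite upd_twice upd_eq.
    by apply: cexec_inc; rewrite upd_eq; have := size_labels; rewrite /n; lia.
  rewrite swap; apply: (scan_skip (isT : 6 <= rS) (q := q) (s1 := enc_items l) bodyq).
  - exact: Cp.
  - by rewrite /enc_items; elim: (l) => //= p l' IHp; rewrite all_cat IHp qb.
  - exact: H'.
  by rewrite swap /= -addSnnS; exact: Y.
have [|pos' X] := scan_ls (kL K) 0 (1 + size ((TKrip :: enc_nat (kW K) ++ TSep :: enc_nat (kr K)) ++ enc_edges (kR K))) erefl.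
  by apply: hat_cat; rewrite -catA; exact: hat_header xE.
have R0 pos : upd (upd R rS pos) rCnt 0 = upd R rS pos.
  by move: c0 => ?; regs.
apply: cexec_bind.
  apply: (scan_skip (isT : 6 <= rS) (q := q) (s1 := (TKrip :: enc_nat (kW K) ++ TSep :: enc_nat (kr K)) ++ enc_edges (kR K)) bodyq).
  - exact: clean_upd.
  - rewrite /= all_cat all_cat qb /= qb /= /enc_edges.
    by elim: (kR K) => //= e es IHe; rewrite -!catA !all_cat IHe qb /= qb.
  - by rewrite -catA; exact: hat_header xE.
  by rewrite upd_twice upd_eq -R0; exact: X.
apply: cexec_bind; first exact: cexec_clear.
rewrite swap add0n; have -> : upd R rS 0 = R by rewrite -s0 upd_same.
by case: (has P _); exact: cexec_ret.
Qed.

Definition exlab (b : prog bool) : prog bool := t <~ labloop b ;; clear rCnt ;; ret t.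

Lemma cexec_exlab b R o P : clean R -> R rS = 0 -> R rCnt = 0 ->
  (forall pos w o, w < size (kL K) ->
     cexec b (upd (upd R rS pos) rCnt w) o (P w) (upd (upd R rS pos) rCnt w) o) ->
  cexec (exlab b) R o (has P (iota 0 (size (kL K)))) R o.
Proof.
move=> C s0 c0 Hb; apply: cexec_bind; first exact: cexec_labloop Hb.
apply: cexec_bind; first exact: cexec_clear.
rewrite upd_twice (_ : upd R rCnt 0 = R); first exact: cexec_ret.
by rewrite -c0 upd_same.
Qed.
End Loops.

(** The counter holds the number of label lists begun, one more than the current world, hence the
    [dec] before the comparison and the [inc] after it. While it is still 0, a [TSep] belongs to the
    header or to an edge and is passed over. *)
Definition memprog : prog nreg bool :=
  inc rS ;;
  o <~ scan rS (fun c =>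
         if c == TLab then inc rCnt ;; ret nreg None
         else if c == TSep then
           b <~ dec rCnt ;;
           if b then
             t1 <~ cmp_at (after rE) rCnt ;; t2 <~ eq_after rPhi rS ;;
             inc rCnt ;; ret nreg (if t1 && t2 then Some tt else None)
           else ret nreg None
         else ret nreg None) ;;
  clear rS ;; clear rCnt ;; ret nreg (o : bool).

(** Loops search for a witness, so conditions on all edges or all worlds are tested by looking for a
    counterexample. The first pass, whose body always fails, merely counts the label lists. *)
Definition wfprog : prog nreg bool :=
  labloop (ret nreg false) ;;
  b1 <~ cmp_at width_at rCnt ;; clear rCnt ;;
  b2 <~ exlab (cmp_at root_at rCnt) ;;
  b3 <~ edgeloop rE (t1 <~ exlab (cmp_at (after rE) rCnt) ;;
                     t2 <~ exlab (cmp_at (snd_at rE) rCnt) ;;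
                     ret nreg (~~ (t1 && t2))) ;;
  b4 <~ exlab (t <~ edgeloop rE (cmp_at (after rE) rCnt) ;; ret nreg (~~ t)) ;;
  ret nreg [&& b1, b2, ~~ b3 & ~~ b4].

Definition wfb (K : kripke) : bool :=
  let L := size (kL K) in
  [&& kW K == L, kr K < L,
      all (fun e => (e.1 < L) && (e.2 < L)) (kR K) &
      all (fun w => has (fun e => e.1 == w) (kR K)) (iota 0 L)].

Lemma wfbP K : wf_kripke K <-> wfb K.
Proof.
rewrite /wfb; split.
  case=> [_ [rW [sz [eW ser]]]]; rewrite sz eqxx rW /=; apply/andP; split.
    by apply/allP => e /eW [-> ->].
  apply/allP => w; rewrite mem_iota /= => /ser [v wv].
  by apply/hasP; exists (w, v) => //=.
case/and4P=> /eqP e rL /allP eL /allP ser; split; first by rewrite e; lia.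
split; first by rewrite e.
split=> //; split=> [ed /eL /andP [] | w]; first by rewrite e.
move=> wW; have /hasP [[w' v] ev /= /eqP <-] : has (fun ed => ed.1 == w) (kR K).
  by apply: ser; rewrite mem_iota /= -e.
by exists v.
Qed.

Fixpoint mem_from (u p w : nat) (ls : seq (seq nat)) : bool :=
  if ls is l :: ls' then ((u == w) && (p \in l)) || mem_from u p w.+1 ls' else false.

Lemma mem_fromE u p w ls :
  mem_from u p w ls = (w <= u) && (p \in nth [::] ls (u - w)).
Proof.
elim: ls w => [|l ls IH] w /=; first by rewrite nth_nil andbF.
rewrite IH; case: (ltngtP w u) => [lt|lt|<-] /=.
- by rewrite (_ : u - w = (u - w.+1).+1) //; lia.
- by [].
- by rewrite subnn orbF.
Qed.

Section Checks.
Variable x : seq token.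
Let n := size x.
Notation cexec := (@cexec x _).
Notation hat := (hat x).
Variables (K : kripke) (post : seq token).
Hypothesis xE : x = enc_kripke K ++ post.
Let L := size (kL K).

Lemma has_iota u : has (fun w => u == w) (iota 0 L) = (u < L).
Proof. by rewrite (@eq_has _ _ (pred1 u)) ?has_pred1 ?mem_iota // => w; rewrite eq_sym. Qed.

Lemma cexec_in_range p R o u : clean R -> R rS = 0 -> R rCnt = 0 ->
  (forall pos w, locates x p (upd (upd R rS pos) rCnt w) u) ->
  cexec (exlab (cmp_at p rCnt)) R o (u < L) R o.
Proof.
move=> C s0 c0 Hp; rewrite -has_iota; apply: (cexec_exlab xE) => // pos w o' wL.
have C' : clean (upd (upd R rS pos) rCnt w) by apply: clean_upd => //; apply: clean_upd.
have := @cexec_cmp_at x p _ u o' rCnt (Hp pos w) C' isT.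
by rewrite upd_eq; apply; have := size_labels xE; lia.
Qed.

Lemma cexec_wfprog R o : clean R -> R rS = 0 -> R rCnt = 0 -> R rE = 0 ->
  cexec wfprog R o (wfb K) R o.
Proof.
move=> C s0 c0 e0.
apply: cexec_bind.
  by apply: (@cexec_labloop x K post xE _ _ _ pred0) => // *; apply: cexec_ret.
have -> : find pred0 (iota 0 (size (kL K))) = L.
  by rewrite hasNfind ?has_pred0 ?size_iota.
apply: cexec_bind.
  apply: (cexec_cmp_at _ (locates_width xE _)); [exact: clean_upd | by [] |].
  by rewrite upd_eq; have := size_labels xE; rewrite /L; lia.
apply: cexec_bind; first exact: cexec_clear.
rewrite upd_twice upd_eq (_ : upd R rCnt 0 = R); last by rewrite -c0 upd_same.
apply: cexec_bind.
  by apply: (@cexec_in_range _ _ _ (kr K)) => // pos w; apply: (locates_root xE).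
apply: cexec_bind.
  have H := @cexec_edgeloop x K post xE rE _ R o
    (fun e => ~~ ((e.1 < L) && (e.2 < L))) (fun _ => [::]) isT C e0.
  apply: H => pos e _ ea o'; rewrite cats0.
  have Cp : clean (upd R rE pos) by exact: clean_upd.
  have Cp' pos' w : clean (upd (upd (upd R rE pos) rS pos') rCnt w).
    by apply: clean_upd => //; apply: clean_upd.
  apply: cexec_bind.
    by apply: (@cexec_in_range _ _ _ (e.1)) => // pos' w; apply: locates_fst.
  apply: cexec_bind; last exact: cexec_ret.
  by apply: (@cexec_in_range _ _ _ (e.2)) => // pos' w; apply: locates_snd.
have oE (A : Type) (P : pred A) (s : seq A) : outputs_upto P (fun _ => [::]) s = [::].
  by elim: s => //= a s ->; case: (P a).
rewrite oE cats0.
apply: cexec_bind.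
  apply: (@cexec_exlab x K post xE _ _ _ (fun w => ~~ has (fun e => e.1 == w) (kR K))) => //.
  move=> pos w o' wL; set R' := upd _ rCnt w.
  have C' : clean R' by apply: clean_upd => //; apply: clean_upd.
  apply: cexec_bind; last exact: cexec_ret.
  have := @cexec_edgeloop x K post xE rE (cmp_at (after rE) rCnt) R' o'
    (fun e => e.1 == w) (fun _ => [::]) isT C' e0.
  rewrite oE cats0; apply=> pos' e _ ea o2; rewrite cats0.
  have C2 : clean (upd R' rE pos') by exact: clean_upd.
  have := @cexec_cmp_at x (after rE) (upd R' rE pos') e.1 o2 rCnt _ C2 isT.
  rewrite (_ : upd R' rE pos' rCnt = w) // => X; apply: X; first exact: locates_fst.
  by have := size_labels xE; lia.
set b := [&& _, _ & _]; have -> : wfb K = b; last exact: cexec_ret.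
by rewrite /wfb -(negbK (all _ (kR K))) -(negbK (all _ (iota _ _))) -!has_predC.
Qed.

Lemma cexec_memprog R o e p s : clean R -> R rS = 0 -> R rCnt = 0 ->
  edge_at x (R rE) e -> hat (R rPhi) (TAtom :: enc_nat p ++ s) -> nbhead s ->
  cexec memprog R o (p \in nth [::] (kL K) e.1) R o.
Proof.
move=> C s0 c0 ea pa ns; apply: cexec_bind; first by apply: cexec_inc; rewrite s0.
rewrite s0; set body := fun c => _.
have Cp pos w : clean (upd (upd R rS pos) rCnt w) by apply: clean_upd => //; apply: clean_upd.
have swap pos w pos' : upd (upd (upd R rS pos) rCnt w) rS pos' = upd (upd R rS pos') rCnt w.
  by regs.
(* One label list: either the scan stops inside it, or it reduces to the scan behind it. The counter
   is [w.+1] because the [TLab] of world [w] has been passed. *)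
have items l w pos t : w < L ->
    hat pos (enc_items l ++ t) -> nbhead t ->
    if (e.1 == w) && (p \in l) then
      exists pos', cexec (scan rS body) (upd (upd R rS pos) rCnt w.+1) o (Some tt)
        (upd (upd R rS pos') rCnt w.+1) o
    else forall r R2,
      cexec (scan rS body) (upd (upd R rS (pos + size (enc_items l))) rCnt w.+1) o r R2 o ->
      cexec (scan rS body) (upd (upd R rS pos) rCnt w.+1) o r R2 o.
  move=> wL; elim: l pos => [|p' l IH] pos H nt.
    by rewrite in_nil andbF => r R2; rewrite addn0.
  rewrite enc_items_cons in H.
  have H0 : hat (upd (upd R rS pos) rCnt w.+1 rS) (TSep :: enc_nat p' ++ enc_items l ++ t) := H.
  have nt' : nbhead (enc_items l ++ t) by apply: nbhead_enc_items.
  have X : cexec (body TSep) (upd (upd R rS pos) rCnt w.+1) o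
      (if (e.1 == w) && (p == p') then Some tt else None)
      (upd (upd R rS pos) rCnt w.+1) o.
    apply: (cexec_bind (R1 := upd (upd R rS pos) rCnt w) (o1 := o)).
      move=> h; exists h; have := @exec_decS x h (upd (upd R rS pos) rCnt w.+1) o rCnt w.
      by rewrite upd_eq upd_twice; apply.
    have Y := @cexec_cmp_at x (after rE) _ e.1 o rCnt (@locates_fst x _ rE e (Cp pos w) isT ea) (Cp pos w) isT.
    apply: cexec_bind.
      by apply: Y; rewrite upd_eq; have := size_labels xE; lia.
    have Z := @cexec_eq_after x _ o rPhi rS TAtom TSep (enc_nat p ++ s) (enc_nat p' ++ enc_items l ++ t) (Cp pos w) isT isT pa H.
    apply: cexec_bind; first exact: Z.
    rewrite !bits_enc // upd_eq (inj_eq enc_nat_inj).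
    apply: cexec_bind; last exact: cexec_ret.
    have := @cexec_inc x (upd (upd R rS pos) rCnt w) o rCnt.
    by rewrite upd_eq upd_twice; apply; have := size_labels xE; lia.
  have H' := hat_cat (hat_next H).
  have next r R2 : cexec (body TSep) (upd (upd R rS pos) rCnt w.+1) o None
      (upd (upd R rS pos) rCnt w.+1) o ->
      cexec (scan rS body) (upd (upd R rS (pos.+1 + size (enc_nat p'))) rCnt w.+1) o r R2 o ->
      cexec (scan rS body) (upd (upd R rS pos) rCnt w.+1) o r R2 o.
    move=> X0 Y; apply: (scan_next (isT : 6 <= rS) (Cp _ _) H0 _ X0) => //.
    rewrite swap.
    apply: (scan_skip (isT : 6 <= rS) (q := isbit) (s1 := enc_nat p') (s := enc_items l ++ t)).
    - by case.
    - exact: Cp.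
    - exact: enc_nat_isbit.
    - exact: hat_next H.
    by rewrite swap; exact: Y.
  have sz : pos + size (enc_items (p' :: l)) = pos.+1 + size (enc_nat p') + size (enc_items l).
    by have := enc_items_cons p' l [::]; rewrite !cats0 => ->; rewrite /= size_cat; lia.
  have := IH _ H' nt; rewrite in_cons.
  case: (e.1 == w) X => /= X; last first.
    by move=> IH' r R2; rewrite sz => Y; apply: next => //; apply: IH'.
  case: (p == p') X => /= X.
    by move=> _; exists pos; apply: (scan_stop (isT : 6 <= rS) (Cp _ _) H0).
  case: (p \in l).
    by case=> pos' Y; exists pos'; apply: next.
  by move=> IH' r R2; rewrite sz => Y; apply: next => //; apply: IH'.
have labels ls w pos : w + size ls = L ->
    hat pos (enc_labels ls ++ TEnd :: post) ->
    exists pos' w', cexec (scan rS body) (upd (upd R rS pos) rCnt w) o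
      (if mem_from e.1 p w ls then Some tt else None) (upd (upd R rS pos') rCnt w') o.
  elim: ls w pos => [|l ls IH] w pos sz H.
    by exists pos, w; apply: (@scan_end _ _ rS _ isT _ _ (TEnd :: post)).
  rewrite enc_labels_cons in H; rewrite /= in sz.
  have H0 : hat (upd (upd R rS pos) rCnt w rS) (TLab :: enc_items l ++ enc_labels ls ++ TEnd :: post) := H.
  have X : cexec (body TLab) (upd (upd R rS pos) rCnt w) o None (upd (upd R rS pos) rCnt w.+1) o.
    apply: cexec_bind; last exact: cexec_ret.
    have := @cexec_inc x (upd (upd R rS pos) rCnt w) o rCnt.
    by rewrite upd_eq upd_twice; apply; have := size_labels xE; rewrite -/L; lia.
  have nt : nbhead (enc_labels ls ++ TEnd :: post) by apply: nbhead_enc_labels.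
  have := items l w pos.+1 _ ltac:(lia) (hat_next H) nt.
  rewrite /=; case: (_ && _) => /=.
    case=> pos' Y; exists pos', w.+1.
    by apply: (scan_next (isT : 6 <= rS) (Cp _ _) H0 _ X) => //; rewrite swap.
  move=> Y; have [pos' [w' Z]] := IH w.+1 _ ltac:(lia) (hat_cat (hat_next H)).
  exists pos', w'; apply: (scan_next (isT : 6 <= rS) (Cp _ _) H0 _ X) => //.
  by rewrite swap; apply: Y.
have Hl : hat (1 + size ((TKrip :: enc_nat (kW K) ++ TSep :: enc_nat (kr K)) ++ enc_edges (kR K)))
    (enc_labels (kL K) ++ TEnd :: post).
  by apply: hat_cat; rewrite -catA; exact: hat_header xE.
have [pos' [w' X]] := labels (kL K) 0 _ erefl Hl.
have R0 pos : upd (upd R rS pos) rCnt 0 = upd R rS pos.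
  by move: c0 => ?; regs.
pose q c := (c != TEnd) && (c != TLab).
have qb u : all q (enc_nat u) by exact: all_bits.
apply: cexec_bind.
  apply: (scan_skip_exec (isT : 6 <= rS) (q := q)
    (s1 := (TKrip :: enc_nat (kW K) ++ TSep :: enc_nat (kr K)) ++ enc_edges (kR K))).
  - move=> c /andP [ne nl]; split=> // pos; rewrite /body (negbTE nl).
    case: (c == TSep); last exact: cexec_ret.
    move=> h; exists h; apply: exec_bind; first exact: exec_dec0.
    exact: exec_ret.
  - exact: clean_upd.
  - rewrite /= all_cat all_cat qb /= qb /= /enc_edges.
    by elim: (kR K) => //= ed es IHe; rewrite -!catA !all_cat IHe qb /= qb.
  - by rewrite -catA; exact: hat_header xE.
  by rewrite upd_twice upd_eq -R0; exact: X.
apply: cexec_bind; first exact: cexec_clear.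
apply: cexec_bind; first exact: cexec_clear.
rewrite swap upd_twice R0 (_ : upd R rS 0 = R); last by rewrite -s0 upd_same.
rewrite mem_fromE subn0 /=.
by case: (p \in _); exact: cexec_ret.
Qed.
End Checks.

(** * Formula templates *)

Definition num_of (l : seq token) : nat :=
  foldl (fun v b => v.*2 + (b == T1)) 0 l.

Lemma num_of_rcons l b : num_of (rcons l b) = (num_of l).*2 + (b == T1).
Proof. by rewrite /num_of foldl_rcons. Qed.

Lemma enc_nat_double v (b : bool) : 0 < v ->
  enc_nat (v.*2 + b) = rcons (enc_nat v) (if b then T1 else T0).
Proof.
move=> v0; rewrite /enc_nat.
have [p ep] : exists p, N.of_nat v = Npos p by case e : (N.of_nat v) => [|p]; [lia|exists p].
have -> : N.of_nat (v.*2 + b) = Npos (if b then xI p else xO p) by case: b; lia.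
by rewrite ep -cats1; case: b.
Qed.

Lemma num_ofK l : all isbit l -> enc_nat (num_of (T1 :: l)) = T1 :: l.
Proof.
suff H : all isbit l -> 0 < num_of (T1 :: l) /\ enc_nat (num_of (T1 :: l)) = T1 :: l.
  by case/H.
elim/last_ind: l => // l b IH; rewrite all_rcons => /andP [ib /IH [n0 e]].
rewrite -rcons_cons num_of_rcons; split; first by lia.
by rewrite enc_nat_double // e; case: b ib.
Qed.

(** The numeral is 10 followed by the digits of [u]: printing it needs no arithmetic, only a copy.
    The leading 1 keeps it canonical, and the prefix keeps it apart from the atoms 0, 1 and 2. *)
Definition world_atom (u : nat) : nat := num_of (T1 :: T0 :: enc_nat u).

Lemma enc_world_atom u : enc_nat (world_atom u) = T1 :: T0 :: enc_nat u.
Proof. by rewrite num_ofK //= enc_nat_isbit. Qed.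

Lemma world_atom_inj : injective world_atom.
Proof.
by move=> u v e; apply: enc_nat_inj; have := enc_world_atom u; rewrite e enc_world_atom => -[].
Qed.

Lemma enc_nat_neq0 u : enc_nat u != [::].
Proof.
case: u => // u; apply/eqP => e; have := cmpb_enc u.+1 u.+1.
by rewrite e eqxx.
Qed.

Lemma world_atom_gt2 u : 2 < world_atom u.
Proof.
have := enc_world_atom u; case: (world_atom u) => [|[|[|//]]] // [] /esym/eqP.
by rewrite (negbTE (enc_nat_neq0 u)).
Qed.

(* Formula templates: [tNeq] and [tMem] are conditional folds over the edges,
   [tSrc false], [tDst false] refer to the edge of the enclosing fold and
   [tSrc true] to the edge bound by [tNeq]. *)
Inductive tm : Type :=
| tAtom of nat | tRoot | tSrc of bool | tDst
| tNeg of tm | tAnd of tm & tm | tOr of tm & tm | tX of tm | tF of tm | tTilde of tm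
| tFold of bool & tm
| tNeq of tm
| tMem of tm.

Definition fA : ltl := fAtom 0.
(** True exactly in the empty team, hence the unit of the splitting disjunction. *)
Definition fff : ltl := fAnd fA (fNeg fA).
Definition ftt : ltl := fOr fA (fNeg fA).

Fixpoint den (K : kripke) (p : nat) (e1 e2 : nat * nat) (M : tm) : ltl :=
  match M with
  | tAtom k => fAtom k
  | tRoot => fAtom (world_atom (kr K))
  | tSrc b => fAtom (world_atom (if b then e2.1 else e1.1))
  | tDst => fAtom (world_atom e1.2)
  | tNeg A => fNeg (den K p e1 e2 A)
  | tAnd A B => fAnd (den K p e1 e2 A) (den K p e1 e2 B)
  | tOr A B => fOr (den K p e1 e2 A) (den K p e1 e2 B)
  | tX A => fX (den K p e1 e2 A)
  | tF A => fF (den K p e1 e2 A)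
  | tTilde A => fTilde (den K p e1 e2 A)
  | tFold b A =>
      if b then foldr (fun e acc => fAnd (den K p e e2 A) acc) ftt (kR K)
      else foldr (fun e acc => fOr (den K p e e2 A) acc) fff (kR K)
  | tNeq A =>
      foldr (fun e acc => if e1.1 == e.1 then acc else fAnd (den K p e1 e A) acc)
        ftt (kR K)
  | tMem A =>
      foldr (fun e acc => if p \in nth [::] (kL K) e.1
                          then fOr (den K p e e2 A) acc else acc) fff (kR K)
  end.

Definition emit (l : seq token) : prog nreg unit :=
  foldr (fun t p => out t ;; p) (ret nreg tt) l.
Definition emit_world (p : prog nreg unit) : prog nreg unit :=
  emit [:: TAtom; T1; T0] ;; copy_at p.

(** In prefix notation a right fold is printed in one pass: operator and operand for each edge, the
    unit at the end. *)
Fixpoint emit_tm (M : tm) : prog nreg unit :=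
  match M with
  | tAtom k => emit (enc_ltl (fAtom k))
  | tRoot => emit_world root_at
  | tSrc b => emit_world (after (if b then rS else rE))
  | tDst => emit_world (snd_at rE)
  | tNeg A => out TNeg ;; emit_tm A
  | tAnd A B => out TAnd ;; emit_tm A ;; emit_tm B
  | tOr A B => out TOr ;; emit_tm A ;; emit_tm B
  | tX A => out TX ;; emit_tm A
  | tF A => out TF ;; emit_tm A
  | tTilde A => out TTilde ;; emit_tm A
  | tFold b A =>
      edgeloop rE (out (if b then TAnd else TOr) ;; emit_tm A ;; ret nreg false) ;;
      emit (enc_ltl (if b then ftt else fff))
  | tNeq A =>
      edgeloop rS (t <~ eq_after rE rS ;;
                   if t then ret nreg false
                   else out TAnd ;; emit_tm A ;; ret nreg false) ;;
      emit (enc_ltl ftt)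
  | tMem A =>
      edgeloop rE (t <~ memprog ;;
                   if t then out TOr ;; emit_tm A ;; ret nreg false
                   else ret nreg false) ;;
      emit (enc_ltl fff)
  end.

(** Register discipline: [b1] and [b2] say that [rE] and [rS] stand on a bound edge, [b3] that
    [rPhi] stands on an atom. A loop needs its register free; [tMem] needs both, because [memprog]
    scans with [rS]. *)
Fixpoint scoped (b1 b2 b3 : bool) (M : tm) : bool :=
  match M with
  | tAtom _ | tRoot => true
  | tSrc b => if b then b2 else b1
  | tDst => b1
  | tNeg A | tX A | tF A | tTilde A => scoped b1 b2 b3 A
  | tAnd A B | tOr A B => scoped b1 b2 b3 A && scoped b1 b2 b3 B
  | tFold _ A => ~~ b1 && scoped true b2 b3 A
  | tNeq A => b1 && ~~ b2 && scoped b1 true b3 A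
  | tMem A => ~~ b1 && ~~ b2 && b3 && scoped true b2 b3 A
  end.

Section Emit.
Variable x : seq token.
Notation cexec := (@cexec x _).
Notation hat := (hat x).
Variables (K : kripke) (post : seq token).
Hypothesis xE : x = enc_kripke K ++ post.

Definition emits (p : prog nreg unit) R (l : seq token) : Prop :=
  forall o, cexec p R o tt R (o ++ l).

Lemma emits_seq p q R l1 l2 : emits p R l1 -> emits q R l2 ->
  emits (p ;; q) R (l1 ++ l2).
Proof. by move=> H1 H2 o; rewrite catA; apply: cexec_bind. Qed.

Lemma emits_out t R : emits (out t) R [:: t].
Proof. by move=> o h; exists h; rewrite cats1; apply: exec_out. Qed.

Lemma emits_cons t q R l : emits q R l -> emits (out t ;; q) R (t :: l).
Proof. by move=> H; rewrite -cat1s; apply: emits_seq => //; apply: emits_out. Qed.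

Lemma emits_emit l R : emits (emit l) R l.
Proof.
elim: l => [|t l IH]; first by move=> o; rewrite cats0; apply: cexec_ret.
exact: emits_cons.
Qed.

Lemma emits_world p R u : locates x p R u ->
  emits (emit_world p) R (enc_ltl (fAtom (world_atom u))).
Proof.
move=> L; rewrite /= enc_world_atom -[_ :: _ :: _ :: _]/([:: TAtom; T1; T0] ++ _).
by apply: emits_seq; [apply: emits_emit | move=> o; apply: cexec_copy_at].
Qed.

Lemma cexec_emits (E : Type) p (q : prog nreg E) R l o e R' o' : emits p R l ->
  cexec q R (o ++ l) e R' o' -> cexec (p ;; q) R o e R' o'.
Proof. by move=> H H'; apply: cexec_bind; [exact: H | exact: H']. Qed.

Lemma emits_fold (r : 'I_nreg) b R f base : 6 <= r -> clean R -> R r = 0 ->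
  (forall pos e, edge_at x pos e ->
     forall o, cexec b (upd R r pos) o false (upd R r pos) (o ++ f e)) ->
  emits (edgeloop r b ;; emit base) R (flatten [seq f e | e <- kR K] ++ base).
Proof.
move=> r6 C r0 H o; rewrite catA; apply: cexec_bind; last exact: emits_emit.
have -> : flatten [seq f e | e <- kR K] = outputs_upto pred0 f (kR K).
  by elim: (kR K) => //= e es ->.
by apply: (cexec_edgeloop xE) => // pos e _; apply: H.
Qed.

Lemma enc_fold (op : ltl -> ltl -> ltl) t (P : pred (nat * nat)) (F : nat * nat -> ltl) base es :
  (forall A B, enc_ltl (op A B) = t :: enc_ltl A ++ enc_ltl B) ->
  enc_ltl (foldr (fun e acc => if P e then op (F e) acc else acc) base es) =
  flatten [seq if P e then t :: enc_ltl (F e) else [::] | e <- es] ++ enc_ltl base.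
Proof. by move=> H; elim: es => //= e es IH; case: (P e); rewrite ?H IH //= catA. Qed.

Lemma emits_tm M b1 b2 b3 R p e1 e2 : scoped b1 b2 b3 M -> clean R -> R rCnt = 0 ->
  (if b1 then edge_at x (R rE) e1 else R rE = 0) ->
  (if b2 then edge_at x (R rS) e2 else R rS = 0) ->
  (b3 -> exists2 s, hat (R rPhi) (TAtom :: enc_nat p ++ s) & nbhead s) ->
  emits (emit_tm M) R (enc_ltl (den K p e1 e2 M)).
Proof.
elim: M b1 b2 R e1 e2 => [k||b||A IH|A IHA B IHB|A IHA B IHB|A IH|A IH|A IH|b A IH|A IH|A IH]
  b1 b2 R e1 e2 sc C c0 H1 H2 H3.
- exact: emits_emit.
- by apply: emits_world; exact: (locates_root xE).
- move: sc => /=; case: b => b12; rewrite b12 in H1 H2 *; apply: emits_world;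
    exact: locates_fst.
- by move: sc => /= b12; rewrite b12 in H1; apply: emits_world; apply: locates_snd.
- by apply: emits_cons; apply: IH sc _ _ _ _ _.
- case/andP: sc => sA sB; apply: emits_cons; apply: emits_seq.
    exact: IHA sA _ _ _ _ _.
  exact: IHB sB _ _ _ _ _.
- case/andP: sc => sA sB; apply: emits_cons; apply: emits_seq.
    exact: IHA sA _ _ _ _ _.
  exact: IHB sB _ _ _ _ _.
- by apply: emits_cons; apply: IH sc _ _ _ _ _.
- by apply: emits_cons; apply: IH sc _ _ _ _ _.
- by apply: emits_cons; apply: IH sc _ _ _ _ _.
- case/andP: sc => /negbTE b1F sA; rewrite b1F in H1.
  have X pos e : edge_at x pos e ->
      emits (emit_tm A) (upd R rE pos) (enc_ltl (den K p e e2 A)).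
    by move=> ea; apply: IH sA _ _ _ _ _ => //; exact: clean_upd.
  have E (op : ltl -> ltl -> ltl) t F base :
      (forall A B, enc_ltl (op A B) = t :: enc_ltl A ++ enc_ltl B) ->
      enc_ltl (foldr (fun e acc => op (F e) acc) base (kR K)) =
      flatten [seq t :: enc_ltl (F e) | e <- kR K] ++ enc_ltl base.
    by move=> ?; exact: (@enc_fold _ t predT).
  have Y t pos e o : edge_at x pos e -> cexec (out t ;; emit_tm A ;; ret nreg false)
      (upd R rE pos) o false (upd R rE pos) (o ++ t :: enc_ltl (den K p e e2 A)).
    move=> ea; rewrite -cat1s catA; apply: cexec_emits; first exact: emits_out.
    by apply: cexec_emits; [exact: (X _ _ ea) | exact: cexec_ret].
  rewrite /=; case: b; [rewrite (E _ TAnd) // | rewrite (E _ TOr) //];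
    by apply: emits_fold => // pos e ea o; apply: Y.
- case/andP: sc => /andP [b1T /negbTE b2F] sA; rewrite b2F b1T in H1 H2.
  rewrite (_ : den _ _ _ _ _ = foldr (fun e acc => if e1.1 != e.1 then fAnd (den K p e1 e A) acc else acc) ftt (kR K)); last first.
    by rewrite /=; elim: (kR K) => //= e es ->; case: (_ == _).
  rewrite (@enc_fold fAnd TAnd (fun e => e1.1 != e.1)) //; apply: emits_fold => // pos e ea o.
  have Cp : clean (upd R rS pos) by exact: clean_upd.
  have [s1 [h1 n1]] := H1; have [s2 [h2 n2]] := ea.
  have Y := @cexec_eq_after x _ o rE rS _ _ _ _ Cp isT isT h1 h2.
  apply: cexec_bind; first exact: Y.
  rewrite !bits_enc // (inj_eq enc_nat_inj).
  case: (e1.1 == e.1) => /=; first by rewrite cats0; exact: cexec_ret.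
  rewrite -cat1s catA; apply: cexec_emits; first exact: emits_out.
  apply: cexec_emits; last exact: cexec_ret.
  by apply: (IH _ _ (upd R rS pos) e1 e sA Cp c0 _ ea H3); rewrite b1T.
- case/andP: sc => /andP [/andP [/negbTE b1F /negbTE b2F] b3T] sA.
  rewrite b1F b2F in H1 H2.
  rewrite [den _ _ _ _ _]/= (@enc_fold fOr TOr (fun e => p \in nth [::] (kL K) e.1)) //.
  apply: emits_fold => // pos e ea o.
  have Cp : clean (upd R rE pos) by exact: clean_upd.
  have [s pa ns] := H3 b3T.
  have Y := @cexec_memprog x K post xE (upd R rE pos) o e p s Cp H2 c0 ea pa ns.
  apply: cexec_bind; first exact: Y.
  case: (p \in _); last by rewrite cats0; exact: cexec_ret.
  rewrite -cat1s catA; apply: cexec_emits; first exact: emits_out.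
  apply: cexec_emits; last exact: cexec_ret.
  by apply: (IH _ _ (upd R rE pos) e e2 sA Cp c0 ea _ H3); rewrite b2F.
Qed.
End Emit.

(** * Team semantics *)

Lemma team_ext (S T : team) : (forall t, S t <-> T t) -> S = T.
Proof.
by move=> H; apply: functional_extensionality => t; apply: propositional_extensionality.
Qed.

(** Flat formulas are evaluated trace by trace. The genuinely team-related content of the axioms is
    thereby confined to [fex], Boolean disjunction and negated splits. *)
Definition flat (phi : ltl) (P : trace -> Prop) : Prop :=
  forall T, tsat T phi <-> forall t, T t -> P t.

(** G expressed by F and contradictory negation, as the fragment requires; [fex] similarly obtains
    an existential quantifier over traces from the universal [fNeg]. *)
Definition fbox (phi : ltl) : ltl := fTilde (fF (fTilde phi)).
Definition fex (phi : ltl) : ltl := fTilde (fNeg phi).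

Lemma flat_single phi P t : flat phi P -> tsat (singleton_team t) phi <-> P t.
Proof. by move=> H; rewrite H; split=> [|Pt s ->]; [apply|]. Qed.

Lemma flat_atom p : flat (fAtom p) (fun t => t 0 p).
Proof. by []. Qed.

Lemma flat_neg phi P : flat phi P -> flat (fNeg phi) (fun t => ~ P t).
Proof.
move=> H T; split=> X t Tt.
  by move/(flat_single t H); apply: X.
by move/(flat_single t H); apply: X.
Qed.

Lemma flat_and phi psi P Q : flat phi P -> flat psi Q ->
  flat (fAnd phi psi) (fun t => P t /\ Q t).
Proof.
move=> HP HQ T; rewrite /= HP HQ; split=> [[p q] t Tt|H].
  by split; [apply: p|apply: q].
by split=> t /H [].
Qed.

Lemma flat_or phi psi P Q : flat phi P -> flat psi Q ->
  flat (fOr phi psi) (fun t => P t \/ Q t).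
Proof.
move=> HP HQ T; split=> [[S [U [TE [/HP s /HQ u]]]] t /TE [/s|/u]|H]; try by auto.
exists (fun t => T t /\ P t), (fun t => T t /\ Q t); split=> [t|].
  by split=> [Tt|[]]; [have [] := H t Tt; auto | case | case].
by rewrite HP HQ; split=> t [].
Qed.

Lemma flat_X phi P : flat phi P -> flat (fX phi) (fun t => P (tsuffix 1 t)).
Proof.
move=> H T; rewrite /= H; split=> [X t Tt|X _ [t [Tt ->]]]; last exact: X.
by apply: X; exists t.
Qed.

Lemma sat_box T phi : tsat T (fbox phi) <-> forall k, tsat (team_suffix k T) phi.
Proof.
split=> [H k|H [k N]]; last exact: N (H k).
by case: (classic (tsat (team_suffix k T) phi)) => // n; case: H; exists k.
Qed.

Lemma flat_box phi P : flat phi P -> flat (fbox phi) (fun t => forall k, P (tsuffix k t)).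
Proof.
move=> H T; rewrite sat_box; split=> [X t Tt k|X k].
  by have /H := X k; apply; exists t.
by apply/H => _ [t [Tt ->]]; apply: X.
Qed.

Lemma sat_ex T phi P : flat phi P -> tsat T (fex phi) <-> exists t, T t /\ P t.
Proof.
move=> H; split=> [X|[t [Tt Pt]] X]; last first.
  by apply: (X t Tt); apply/(flat_single t H).
apply: NNPP => N; apply: X => t Tt /(flat_single t H) Pt; apply: N.
by exists t.
Qed.

Lemma flat_true : flat ftt (fun _ => True).
Proof.
move=> T; rewrite (flat_or (flat_atom 0) (flat_neg (flat_atom 0)) T).
by split=> // _ t _; apply: classic.
Qed.

Lemma flat_false : flat fff (fun _ => False).
Proof.
move=> T; rewrite (flat_and (flat_atom 0) (flat_neg (flat_atom 0)) T).
by split=> H t /H // [].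
Qed.

Section Folds.
Variables (A : eqType) (F : A -> ltl) (r : seq A).

Lemma sat_bigand T (C : pred A) :
  tsat T (foldr (fun e acc => if C e then fAnd (F e) acc else acc) ftt r) <->
  forall e, e \in r -> C e -> tsat T (F e).
Proof.
elim: r => [|e s IH] /=.
  by split=> // _; apply/flat_true.
have E : (forall e', e' \in e :: s -> C e' -> tsat T (F e')) <->
    (C e -> tsat T (F e)) /\ forall e', e' \in s -> C e' -> tsat T (F e').
  split=> [H|[h H] e'].
    by split=> [|e' es]; apply: H; rewrite inE ?eqxx ?es ?orbT.
  by rewrite inE => /orP [/eqP ->|]; [|apply: H].
by rewrite E -IH; case: (C e) => /=; intuition.
Qed.

Lemma flat_bigor (C : pred A) P : (forall e, flat (F e) (P e)) ->
  flat (foldr (fun e acc => if C e then fOr (F e) acc else acc) fff r)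
    (fun t => exists e, [/\ e \in r, C e & P e t]).
Proof.
move=> H; elim: r => [|e s IH] T /=.
  by split=> [/flat_false X t /X //|X]; apply/flat_false => t /X [e []].
have E t : (exists e', [/\ e' \in e :: s, C e' & P e' t]) <->
    (C e /\ P e t) \/ (exists e', [/\ e' \in s, C e' & P e' t]).
  split=> [[e' []]|[[c p]|[e' [es c p]]]].
  - rewrite inE => /orP [/eqP ->|es] c p; first by left.
    by right; exists e'.
  - by exists e; rewrite inE eqxx.
  - by exists e'; rewrite inE es orbT.
have E' : (forall t, T t -> exists e', [/\ e' \in e :: s, C e' & P e' t]) <->
    (forall t, T t -> (C e /\ P e t) \/ (exists e', [/\ e' \in s, C e' & P e' t])).
  by split=> X t /X /E.
rewrite E'; case: (C e); last first.
  rewrite IH; split=> X t /X; first by right.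
  by case=> // -[].
rewrite (flat_or (H e) IH); split=> X t /X [|]; auto.
by case; auto.
Qed.
End Folds.

(** Contradictory negation yields a Boolean disjunction: one [e] for the whole team, whereas under
    [fOr] each trace may choose its own. *)
Lemma sat_bigor (A : eqType) (F : A -> ltl) r T :
  tsat T (fTilde (foldr (fun e acc => fAnd (fTilde (F e)) acc) ftt r)) <->
  exists e, e \in r /\ tsat T (F e).
Proof.
have /= := @sat_bigand _ (fun e => fTilde (F e)) r T predT => ->.
split=> [H|[e [er Fe]] H]; last exact: (H e er isT).
apply: NNPP => N; apply: H => e er _ /= Fe; apply: N.
by exists e.
Qed.

(** A flat disjunct may be given all traces satisfying it, as overlaps are allowed. The split thus
    becomes a quantifier over the subteams that retain every trace violating [P]. *)
Lemma sat_or_flat T phi psi P : flat phi P ->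
  tsat T (fOr phi psi) <->
  exists U : team, (forall t, U t -> T t) /\ (forall t, T t -> ~ U t -> P t) /\ tsat U psi.
Proof.
move=> H; split=> [[S [U [TE [/H s u]]]]|[U [sub [cov u]]]].
  exists U; split=> [t Ut|]; first by apply/TE; right.
  by split=> // t /TE [/s|].
exists (fun t => T t /\ P t), U; split=> [t|].
  split=> [Tt|[[]|/sub]] //.
  by case: (classic (U t)) => [|n]; [right | left; split=> //; apply: cov].
by split=> //; apply/H => t [].
Qed.

Lemma sat_suffix (T : team) k (P : trace -> Prop) :
  (forall s, team_suffix k T s -> P s) <-> (forall t, T t -> P (tsuffix k t)).
Proof. by split=> [H t Tt|H _ [t [Tt ->]]]; apply: H => //; exists t. Qed.

Lemma ex_suffix (T : team) k (P : trace -> Prop) :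
  (exists s, team_suffix k T s /\ P s) <-> (exists t, T t /\ P (tsuffix k t)).
Proof.
split=> [[_ [[t [Tt ->]] Ps]]|[t [Tt Pt]]]; first by exists t.
by exists (tsuffix k t); split=> //; exists t.
Qed.

(** * The axioms on path and marker traces *)

Definition tbox (M : tm) : tm := tTilde (tF (tTilde M)).
Definition tex (M : tm) : tm := tTilde (tNeg M).
Definition tbigor (M : tm) : tm := tTilde (tFold true (tTilde M)).

(* Atom 0 marks the traces that represent paths; in the other ("marker") traces
   atom 1 holds at the marked position and atom 2 after it. *)
Definition tPath : tm := tAtom 0.
Definition tMark : tm := tAtom 1.
Definition tPast : tm := tAtom 2.

Definition tKinds : tm := tOr (tbox tPath) (tbox (tNeg tPath)).
(** Stated for sources of edges only; in a serial structure these include all worlds. The same holds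
    for [tMarkers]. *)
Definition tUnique : tm :=
  tbox (tFold true (tNeq (tNeg (tAnd (tSrc false) (tSrc true))))).
(** Atom 2 holds everywhere after a mark and excludes further marks, so a trace is marked at most
    once; a single X below the box is enough to say this. *)
Definition tOnce : tm :=
  tbox (tAnd (tOr (tNeg tMark) (tX tPast))
             (tAnd (tOr (tNeg tPast) (tX tPast)) (tNeg (tAnd tMark tPast)))).
Definition tMarkers : tm :=
  tbox (tFold true (tex (tAnd (tNeg tPath) (tAnd tMark (tSrc false))))).
Definition tInit : tm := tOr (tNeg tPath) tRoot.
Definition tStep : tm :=
  tbox (tOr (tNeg tPath) (tFold false (tAnd (tSrc false) (tX tDst)))).
(** Some marker is marked now, and all markers marked now carry [w]: at this position the subteam
    codes the world [w] and no other. *)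
Definition tHold (w : tm) : tm :=
  tAnd (tex (tAnd (tNeg tPath) tMark)) (tOr tPath (tOr (tNeg tMark) w)).
Definition tCode : tm :=
  tAnd (tHold tRoot) (tbox (tbigor (tAnd (tHold (tSrc false)) (tX (tHold tDst))))).
(** Markers without a mark at the current position are exempt; all other traces, path traces
    included, carry the source of one common edge. *)
Definition tAgree : tm :=
  tbox (tbigor (tOr (tAnd (tNeg tPath) (tNeg tMark)) (tSrc false))).
(** By [sat_or_flat]: every subteam that contains all path traces and codes a path can be thinned
    out, keeping all its markers, to one with a path trace that agrees with the code. *)
Definition tAllPaths : tm :=
  tTilde (tOr (tNeg tPath) (tAnd tCode (tTilde (tOr tPath (tAnd (tex tPath) tAgree))))).
Definition tAxioms : tm :=
  tAnd tKinds (tAnd tUnique (tAnd tOnce (tAnd tMarkers (tAnd tInit (tAnd tStep tAllPaths))))).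

Section PathAxioms.
Variable K : kripke.
Let R := kR K.
Notation w_ := world_atom.

Definition holds (k : nat) (U : team) (u : nat) : Prop :=
  (exists t, U t /\ (~ t k 0 /\ t k 1)) /\
  forall t, U t -> t k 0 \/ (~ t k 1 \/ t k (w_ u)).

Definition codes_path (U : team) : Prop :=
  holds 0 U (kr K) /\ forall k, exists e, e \in R /\ holds k U e.1 /\ holds k.+1 U e.2.

Definition agrees (V : team) : Prop :=
  forall k, exists e, e \in R /\ forall t, V t -> (~ t k 0 /\ ~ t k 1) \/ t k (w_ e.1).

(** The conditions keep the shape that the flatness lemmas produce; [true] in [ax_step] is the
    trivial filter of [flat_bigor]. *)
Record axioms (T : team) : Prop := MkAxioms {
  ax_kinds : forall t, T t -> (forall k, t k 0) \/ (forall k, ~ t k 0);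
  ax_unique : forall t, T t -> forall k e e', e \in R -> e' \in R ->
    t k (w_ e.1) -> t k (w_ e'.1) -> e.1 = e'.1;
  ax_once : forall t, T t -> forall k,
    [/\ t k 1 -> t k.+1 2, t k 2 -> t k.+1 2 & ~ (t k 1 /\ t k 2)];
  ax_markers : forall k e, e \in R ->
    exists t, T t /\ (~ t k 0 /\ (t k 1 /\ t k (w_ e.1)));
  ax_init : forall t, T t -> ~ t 0 0 \/ t 0 (w_ (kr K));
  ax_step : forall t, T t -> forall k,
    ~ t k 0 \/ exists e, [/\ e \in R, true & t k (w_ e.1) /\ t k.+1 (w_ e.2)];
  ax_all : ~ exists U : team, (forall t, U t -> T t) /\ (forall t, T t -> ~ U t -> ~ t 0 0) /\
    (codes_path U /\
     ~ exists V : team, (forall t, V t -> U t) /\ (forall t, U t -> ~ V t -> t 0 0) /\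
       ((exists t, V t /\ t 0 0) /\ agrees V))
}.

Lemma sat_hold p e1 e2 k U h u :
  (forall T, tsat T (den K p e1 e2 h) <-> forall t, T t -> t 0 (w_ u)) ->
  tsat (team_suffix k U) (den K p e1 e2 (tHold h)) <-> holds k U u.
Proof.
move=> H; rewrite [den _ _ _ _ _]/= -[fTilde (fNeg _)]/(fex _).
set f1 := fex _; set f2 := fOr _ _.
rewrite -[tsat _ _]/(tsat (team_suffix k U) f1 /\ tsat (team_suffix k U) f2).
rewrite /f1 (sat_ex _ (flat_and (flat_neg (flat_atom 0)) (flat_atom 1))) ex_suffix.
rewrite /f2 (flat_or (flat_atom 0) (flat_or (flat_neg (flat_atom 1)) H)) sat_suffix.
by rewrite /tsuffix /= addn0.
Qed.

Lemma sat_hold0 p e1 e2 U h u :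
  (forall T, tsat T (den K p e1 e2 h) <-> forall t, T t -> t 0 (w_ u)) ->
  tsat U (den K p e1 e2 (tHold h)) <-> holds 0 U u.
Proof.
have {1}-> : U = team_suffix 0 U.
  apply: team_ext => t; split=> [Ut|[s [Us ->]]]; last exact: Us.
  by exists t.
exact: sat_hold.
Qed.

Lemma team_suffixD i j U : team_suffix i (team_suffix j U) = team_suffix (j + i) U.
Proof.
apply: team_ext => t; split=> [[_ [[s [Us ->]] ->]]|[s [Us ->]]].
  by exists s; split=> //; apply: functional_extensionality => k; rewrite /tsuffix addnA.
exists (tsuffix j s); split; first by exists s.
by apply: functional_extensionality => k; rewrite /tsuffix addnA.
Qed.

Lemma sat_code p e1 e2 U : tsat U (den K p e1 e2 tCode) <-> codes_path U.
Proof.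
rewrite /codes_path -(@sat_hold0 p e1 e2 U tRoot (kr K)) //.
rewrite -[tsat _ _]/(tsat U (den K p e1 e2 (tHold tRoot)) /\ tsat U (fbox (fTilde (foldr
  (fun e acc => fAnd (fTilde (fAnd (den K p e e2 (tHold (tSrc false))) (fX (den K p e e2 (tHold tDst))))) acc) ftt R)))).
rewrite sat_box.
have E k : tsat (team_suffix k U) (fTilde (foldr
  (fun e acc => fAnd (fTilde (fAnd (den K p e e2 (tHold (tSrc false))) (fX (den K p e e2 (tHold tDst))))) acc) ftt R)) <->
  exists e, e \in R /\ holds k U e.1 /\ holds k.+1 U e.2.
  rewrite (sat_bigor (fun e => fAnd (den K p e e2 (tHold (tSrc false))) (fX (den K p e e2 (tHold tDst))))).
  have E' e : tsat (team_suffix k U) (fAnd (den K p e e2 (tHold (tSrc false))) (fX (den K p e e2 (tHold tDst)))) <->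
      holds k U e.1 /\ holds k.+1 U e.2.
    rewrite -(@sat_hold p e e2 k U (tSrc false) e.1) //.
    rewrite -(@sat_hold p e e2 k.+1 U tDst e.2) //.
    by rewrite -addn1 -team_suffixD.
  by split=> -[e [eR /E' X]]; exists e.
by split=> -[H X]; split=> // k; apply/E.
Qed.

Lemma sat_agree p e1 e2 V : tsat V (den K p e1 e2 tAgree) <-> agrees V.
Proof.
rewrite -[tsat _ _]/(tsat V (fbox (fTilde (foldr
  (fun e acc => fAnd (fTilde (fOr (fAnd (fNeg (fAtom 0)) (fNeg (fAtom 1))) (fAtom (w_ e.1)))) acc) ftt R)))).
rewrite sat_box.
have E k : tsat (team_suffix k V) (fTilde (foldr
  (fun e acc => fAnd (fTilde (fOr (fAnd (fNeg (fAtom 0)) (fNeg (fAtom 1))) (fAtom (w_ e.1)))) acc) ftt R)) <->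
  exists e, e \in R /\ forall t, V t -> (~ t k 0 /\ ~ t k 1) \/ t k (w_ e.1).
  rewrite (sat_bigor (fun e => fOr (fAnd (fNeg (fAtom 0)) (fNeg (fAtom 1))) (fAtom (w_ e.1)))).
  have E' e : tsat (team_suffix k V) (fOr (fAnd (fNeg (fAtom 0)) (fNeg (fAtom 1))) (fAtom (w_ e.1))) <->
      forall t, V t -> (~ t k 0 /\ ~ t k 1) \/ t k (w_ e.1).
    rewrite (flat_or (flat_and (flat_neg (flat_atom 0)) (flat_neg (flat_atom 1))) (flat_atom (w_ e.1))).
    by rewrite sat_suffix /tsuffix addn0.
  by split=> -[e [eR /E' X]]; exists e.
by split=> X k; apply/E.
Qed.

Lemma sat_axioms p e1 e2 T : tsat T (den K p e1 e2 tAxioms) <-> axioms T.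
Proof.
have X1 : tsat T (den K p e1 e2 tKinds) <->
    forall t, T t -> (forall k, t k 0) \/ (forall k, ~ t k 0).
  have := flat_or (flat_box (flat_atom 0)) (flat_box (flat_neg (flat_atom 0))) T.
  have S0 k t q : tsuffix k t 0 q = t k q by rewrite /tsuffix addn0.
  move=> ->; split=> H t /H [] X; [left|right|left|right] => k; have := X k;
    by rewrite S0.
have X2 : tsat T (den K p e1 e2 tUnique) <->
    forall t, T t -> forall k e e', e \in R -> e' \in R ->
    t k (w_ e.1) -> t k (w_ e'.1) -> e.1 = e'.1.
  rewrite -[tsat _ _]/(tsat T (fbox (foldr (fun e acc => fAnd (foldr (fun e' acc' =>
    if e.1 == e'.1 then acc' else fAnd (fNeg (fAnd (fAtom (w_ e.1)) (fAtom (w_ e'.1)))) acc')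
    ftt R) acc) ftt R))) sat_box.
  have E k : tsat (team_suffix k T) (foldr (fun e acc => fAnd (foldr (fun e' acc' =>
    if e.1 == e'.1 then acc' else fAnd (fNeg (fAnd (fAtom (w_ e.1)) (fAtom (w_ e'.1)))) acc')
    ftt R) acc) ftt R) <->
    forall e e', e \in R -> e' \in R -> e.1 != e'.1 -> forall t, T t ->
      ~ (t k (w_ e.1) /\ t k (w_ e'.1)).
    rewrite (sat_bigand (fun e => foldr (fun e' acc' =>
      if e.1 == e'.1 then acc' else fAnd (fNeg (fAnd (fAtom (w_ e.1)) (fAtom (w_ e'.1)))) acc')
      ftt R) R (team_suffix k T) predT).
    have E' e : tsat (team_suffix k T) (foldr (fun e' acc' =>
        if e.1 == e'.1 then acc' else fAnd (fNeg (fAnd (fAtom (w_ e.1)) (fAtom (w_ e'.1)))) acc')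
        ftt R) <-> forall e', e' \in R -> e.1 != e'.1 -> forall t, T t ->
          ~ (t k (w_ e.1) /\ t k (w_ e'.1)).
      rewrite (_ : foldr _ _ _ = foldr (fun e' acc' => if e.1 != e'.1 then
          fAnd (fNeg (fAnd (fAtom (w_ e.1)) (fAtom (w_ e'.1)))) acc' else acc') ftt R); last first.
        by elim: R => //= e' s ->; case: (_ == _).
      rewrite (sat_bigand (fun e' => fNeg (fAnd (fAtom (w_ e.1)) (fAtom (w_ e'.1))))).
      have E2 e' : tsat (team_suffix k T) (fNeg (fAnd (fAtom (w_ e.1)) (fAtom (w_ e'.1)))) <->
          forall t, T t -> ~ (t k (w_ e.1) /\ t k (w_ e'.1)).
        rewrite (flat_neg (flat_and (flat_atom (w_ e.1)) (flat_atom (w_ e'.1)))).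
        by rewrite sat_suffix /tsuffix addn0.
      by split=> H e' eR ne; apply/E2; apply: H.
    split=> [H e e' eR eR' ne|H e eR _]; first by have /E' := H e eR isT; apply.
    by apply/E' => e' eR'; apply: H.
  split=> [H t Tt k e e' eR eR' q q'|H k].
    apply/eqP; apply: contraT => ne; have /E := H k.
    by case/(_ _ _ eR eR' ne _ Tt).
  apply/E => e e' eR eR' /eqP ne t Tt [q q']; apply: ne; exact: (H t Tt k).
have X3 : tsat T (den K p e1 e2 tOnce) <-> forall t, T t -> forall k,
    [/\ t k 1 -> t k.+1 2, t k 2 -> t k.+1 2 & ~ (t k 1 /\ t k 2)].
  have := flat_box (flat_and (flat_or (flat_neg (flat_atom 1)) (flat_X (flat_atom 2)))
    (flat_and (flat_or (flat_neg (flat_atom 2)) (flat_X (flat_atom 2)))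
      (flat_neg (flat_and (flat_atom 1) (flat_atom 2))))) T.
  move=> ->; split=> H t Tt k; have := H t Tt k; rewrite /tsuffix !addn0 addn1.
    by case=> [[] ? [[] ? ?]]; split=> // ?; tauto.
  case: (t k 1); case: (t k 2); case: (t k.+1 2) => -[a b c]; intuition.
have X4 : tsat T (den K p e1 e2 tMarkers) <-> forall k e, e \in R ->
    exists t, T t /\ (~ t k 0 /\ (t k 1 /\ t k (w_ e.1))).
  rewrite -[tsat _ _]/(tsat T (fbox (foldr (fun e acc => fAnd
    (fex (fAnd (fNeg (fAtom 0)) (fAnd (fAtom 1) (fAtom (w_ e.1))))) acc) ftt R))) sat_box.
  have E k : tsat (team_suffix k T) (foldr (fun e acc => fAnd
    (fex (fAnd (fNeg (fAtom 0)) (fAnd (fAtom 1) (fAtom (w_ e.1))))) acc) ftt R) <->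
    forall e, e \in R -> exists t, T t /\ (~ t k 0 /\ (t k 1 /\ t k (w_ e.1))).
    rewrite (sat_bigand (fun e => fex (fAnd (fNeg (fAtom 0)) (fAnd (fAtom 1) (fAtom (w_ e.1)))))
      R (team_suffix k T) predT).
    have E2 e : tsat (team_suffix k T) (fex (fAnd (fNeg (fAtom 0)) (fAnd (fAtom 1) (fAtom (w_ e.1))))) <->
        exists t, T t /\ (~ t k 0 /\ (t k 1 /\ t k (w_ e.1))).
      rewrite (sat_ex _ (flat_and (flat_neg (flat_atom 0)) (flat_and (flat_atom 1) (flat_atom (w_ e.1))))).
      by rewrite ex_suffix /tsuffix addn0.
    by split=> H e eR; [apply/E2; apply: H | move=> _; apply/E2; apply: H].
  by split=> H k; [apply/E | apply/E => e; apply: H].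
have X5 : tsat T (den K p e1 e2 tInit) <-> forall t, T t -> ~ t 0 0 \/ t 0 (w_ (kr K)).
  exact: (flat_or (flat_neg (flat_atom 0)) (flat_atom (w_ (kr K)))).
have X6 : tsat T (den K p e1 e2 tStep) <-> forall t, T t -> forall k,
    ~ t k 0 \/ exists e, [/\ e \in R, true & t k (w_ e.1) /\ t k.+1 (w_ e.2)].
  have := flat_box (flat_or (flat_neg (flat_atom 0)) (flat_bigor R predT
    (fun e => flat_and (flat_atom (w_ e.1)) (flat_X (flat_atom (w_ e.2)))))) T.
  by move=> ->; split=> H t Tt k; have := H t Tt k; rewrite /tsuffix !addn0 addn1.
have X7 : tsat T (den K p e1 e2 tAllPaths) <-> ~ exists U : team,
    (forall t, U t -> T t) /\ (forall t, T t -> ~ U t -> ~ t 0 0) /\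
    (codes_path U /\ ~ exists V : team, (forall t, V t -> U t) /\
      (forall t, U t -> ~ V t -> t 0 0) /\ ((exists t, V t /\ t 0 0) /\ agrees V)).
  set body := den K p e1 e2 (tAnd tCode (tTilde (tOr tPath (tAnd (tex tPath) tAgree)))).
  rewrite -[tsat _ _]/(~ tsat T (fOr (fNeg (fAtom 0)) body)).
  rewrite (sat_or_flat _ _ (flat_neg (flat_atom 0))).
  have E U : tsat U body <-> (codes_path U /\ ~ exists V : team, (forall t, V t -> U t) /\
      (forall t, U t -> ~ V t -> t 0 0) /\ ((exists t, V t /\ t 0 0) /\ agrees V)).
    rewrite -(sat_code p e1 e2).
    have E2 : tsat U (fOr (fAtom 0) (den K p e1 e2 (tAnd (tex tPath) tAgree))) <->
        exists V : team, (forall t, V t -> U t) /\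
        (forall t, U t -> ~ V t -> t 0 0) /\ ((exists t, V t /\ t 0 0) /\ agrees V).
      rewrite (sat_or_flat _ _ (flat_atom 0)).
      have E3 V : tsat V (den K p e1 e2 (tAnd (tex tPath) tAgree)) <->
          ((exists t, V t /\ t 0 0) /\ agrees V).
        by rewrite -(sat_agree p e1 e2) -(sat_ex V (flat_atom 0)).
      by split=> -[V [a [b /E3 c]]]; exists V.
    by rewrite -E2.
  by split=> H [U [a [b /E c]]]; apply: H; exists U.
rewrite -[tsat _ _]/(tsat T (den K p e1 e2 tKinds) /\ tsat T (den K p e1 e2 tUnique) /\
  tsat T (den K p e1 e2 tOnce) /\ tsat T (den K p e1 e2 tMarkers) /\
  tsat T (den K p e1 e2 tInit) /\ tsat T (den K p e1 e2 tStep) /\ tsat T (den K p e1 e2 tAllPaths)).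
rewrite X1 X2 X3 X4 X5 X6 X7; split; first by case=> ? [? [? [? [? [? ?]]]]].
by case=> *; do 6 (split=> //).
Qed.
End PathAxioms.

(** * Correctness of the formula *)

(** The disjunction over edges reaches every world through its outgoing edges. *)
Definition tLabel : tm := tMem (tSrc false).

Section Translation.
Variable K : kripke.
Notation w_ := world_atom.

Definition label_formula (p : nat) : ltl := den K p (0, 0) (0, 0) tLabel.

Fixpoint translate (phi : ltl) : ltl :=
  match phi with
  | fAtom p => label_formula p
  | fNeg a => fNeg (translate a)
  | fAnd a b => fAnd (translate a) (translate b)
  | fOr a b => fOr (translate a) (translate b)
  | fX a => fX (translate a)
  | fF a => fF (translate a)
  | fTilde a => fTilde (translate a)
  | _ => phi
  end.

(** The left part of the split consists of markers and the right part of path traces, so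
    [translate phi] is evaluated on exactly the path traces. *)
Definition reduction_formula (phi : ltl) : ltl :=
  fAnd (den K 0 (0, 0) (0, 0) tAxioms) (fOr (fNeg fA) (fAnd fA (translate phi))).

Definition relabel (t : trace) : trace := fun i p =>
  has (fun e => (p \in nth [::] (kL K) e.1) && t i (w_ e.1)) (kR K).

Definition team_image (T : team) : team := fun s => exists t, T t /\ s = relabel t.

Lemma flat_label p : flat (label_formula p) (fun t => relabel t 0 p).
Proof.
move=> T; rewrite (flat_bigor (F := fun e => fAtom (w_ e.1)) (kR K)
  (fun e => p \in nth [::] (kL K) e.1) (fun e => flat_atom (w_ e.1)) T).
split=> H t /H; first by case=> e [eR pe te]; apply/hasP; exists e; rewrite ?pe.
by case/hasP=> e eR /andP [pe te]; exists e.
Qed.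

Lemma team_image_suffix k T : team_image (team_suffix k T) = team_suffix k (team_image T).
Proof.
apply: team_ext => s; split=> [[_ [[t [Tt ->]] ->]]|[_ [[t [Tt ->]] ->]]].
  by exists (relabel t); split=> //; exists t.
by exists (tsuffix k t); split=> //; exists t.
Qed.

Lemma team_image_single t : team_image (singleton_team t) = singleton_team (relabel t).
Proof. by apply: team_ext => s; split=> [[_ [-> ->]]|->] //; exists t. Qed.

(** Satisfaction is transported along [relabel], which commutes with suffixes and maps singletons to
    singletons. A split of the image is pulled back to preimages inside [T], whose images are again
    the given parts. *)
Lemma sat_translate phi T : only_FX phi ->
  tsat T (translate phi) <-> tsat (team_image T) phi.
Proof.
elim: phi T => //= [p|a IH|a IHa b IHb|a IHa b IHb|a IH|a IH|a IH] T.
- move=> _; rewrite -[tsat _ _]/(tsat T (label_formula p)) (flat_label p T).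
  by split=> [H _ [t [Tt ->]]|H t Tt]; apply: H => //; exists t.
- move=> ok; split=> [H _ [t [Tt ->]]|H t Tt].
    by rewrite -team_image_single -IH //; apply: H.
  by rewrite IH // team_image_single; apply: H; exists t.
- by case/andP=> oka okb; rewrite IHa // IHb.
- case/andP=> oka okb; split=> [[S [U [TE [s u]]]]|[S [U [TE [s u]]]]].
    exists (team_image S), (team_image U); rewrite -IHa // -IHb //; split=> // r; split.
      by case=> t [/TE [St|Ut] ->]; [left|right]; exists t.
    by case=> -[t [X ->]]; exists t; split=> //; apply/TE; [left|right].
  exists (fun t => T t /\ S (relabel t)), (fun t => T t /\ U (relabel t)).
  split=> [t|].
    split=> [Tt|[[]|[]] //].
    have /TE [St|Ut] : team_image T (relabel t) by exists t.
      by left.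
    by right.
  rewrite IHa // IHb //; split.
    rewrite (_ : team_image _ = S) //; apply: team_ext => r; split.
      by case=> t [[_ St] ->].
    move=> Sr; have [t [Tt e]] : team_image T r by apply/TE; left.
    by exists t; rewrite -e.
  rewrite (_ : team_image _ = U) //; apply: team_ext => r; split.
    by case=> t [[_ Ut] ->].
  move=> Ur; have [t [Tt e]] : team_image T r by apply/TE; right.
  by exists t; rewrite -e.
- by move=> ok; rewrite IH // team_image_suffix.
- move=> ok; have E k : tsat (team_suffix k T) (translate a) <->
      tsat (team_suffix k (team_image T)) a by rewrite IH // team_image_suffix.
  by split=> -[k /E X]; exists k.
- by move=> ok; rewrite IH.
Qed.

Lemma tdepth_translate phi : only_FX phi -> tdepth (translate phi) = tdepth phi.
Proof.
elim: phi => //= [p|a IHa b IHb|a IHa b IHb|a IH|a IH].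
- by move=> _; rewrite /label_formula /=; elim: (kR K) => //= e s IH; case: (_ \in _) => //=; rewrite IH.
- by case/andP=> oka okb; rewrite IHa // IHb.
- by case/andP=> oka okb; rewrite IHa // IHb.
- by move=> ok; rewrite IH.
- by move=> ok; rewrite IH.
Qed.

Lemma only_FX_label p : only_FX (label_formula p).
Proof. by rewrite /label_formula /=; elim: (kR K) => //= e s IH; case: (_ \in _). Qed.

Lemma only_FX_translate phi : only_FX (translate phi) = only_FX phi.
Proof.
elim: phi => //= [p|a IHa b IHb|a IHa b IHb]; last 2 first.
- by rewrite IHa IHb.
- by rewrite IHa IHb.
exact: only_FX_label.
Qed.

Lemma only_FX_den p e1 e2 M : only_FX (den K p e1 e2 M).
Proof.
elim: M e1 e2 => //= [A IHA B IHB|A IHA B IHB|b A IH|A IH|A IH] e1 e2;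
  rewrite ?IHA ?IHB //.
- by case: b; elim: (kR K) => //= e s ->; rewrite IH.
- by elim: (kR K) => //= e s IHs; case: (_ == _); rewrite //= IHs IH.
- by elim: (kR K) => //= e s IHs; case: (_ \in _); rewrite //= IHs IH.
Qed.

Fixpoint depth_tm (M : tm) : nat :=
  match M with
  | tAtom _ | tRoot | tSrc _ | tDst => 0
  | tNeg A | tTilde A | tFold _ A | tNeq A | tMem A => depth_tm A
  | tAnd A B | tOr A B => maxn (depth_tm A) (depth_tm B)
  | tX A | tF A => (depth_tm A).+1
  end.

Lemma tdepth_den p e1 e2 M : tdepth (den K p e1 e2 M) <= depth_tm M.
Proof.
elim: M e1 e2 => //= [A IHA B IHB|A IHA B IHB|b A IH|A IH|A IH] e1 e2.
- by rewrite geq_max !leq_max IHA IHB orbT.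
- by rewrite geq_max !leq_max IHA IHB orbT.
- by case: b; elim: (kR K) => //= e s IHs; rewrite geq_max IH IHs.
- by elim: (kR K) => //= e s IHs; case: (_ == _); rewrite //= geq_max IH IHs.
- by elim: (kR K) => //= e s IHs; case: (_ \in _); rewrite //= geq_max IH IHs.
Qed.

Lemma in_LTL_reduction k phi : 2 <= k -> only_FX phi ->
  in_LTL_FX k (reduction_formula phi) <-> in_LTL_FX k phi.
Proof.
move=> k2 ok; rewrite /in_LTL_FX /reduction_formula.
have dD : tdepth (den K 0 (0, 0) (0, 0) tAxioms) <= k.
  (* [depth_tm tAxioms] computes to 2; here [2 <= k] is used. *)
  apply: leq_trans (tdepth_den 0 (0, 0) (0, 0) tAxioms) _; exact: k2.
have := only_FX_den 0 (0, 0) (0, 0) tAxioms.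
move: (den _ _ _ _ _) dD => D dD oD /=.
by rewrite tdepth_translate // !geq_max /= only_FX_translate ok dD oD.
Qed.

Hypothesis wfK : wf_kripke K.

(** Makes [ax_unique], which speaks about sources only, applicable to the target of an edge. *)
Lemma edge_source u v : (u, v) \in kR K -> exists v', (v, v') \in kR K.
Proof. by case: wfK => _ [_ [_ [eW ser]]] /eW [_ /ser]. Qed.

Lemma root_source : exists v, (kr K, v) \in kR K.
Proof. by case: wfK => _ [rW [_ [_ ser]]]; apply: ser. Qed.

Lemma relabel_path (t : trace) pi :
  (forall k e e', e \in kR K -> e' \in kR K -> t k (w_ e.1) -> t k (w_ e'.1) -> e.1 = e'.1) ->
  kpath K pi -> (forall i, t i (w_ (pi i))) -> relabel t = fun i => label K (pi i).
Proof.
move=> uni [_ st] ti; apply: functional_extensionality => i.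
apply: functional_extensionality => p; apply/hasP/idP.
  case=> e eR /andP [pe te]; have -> : pi i = e.1 by apply: uni (st i) eR (ti i) te.
  exact: pe.
by move=> pp; exists (pi i, pi i.+1) => //=; rewrite ti andbT.
Qed.

Lemma reduction_sound phi T : only_FX phi ->
  tsat T (reduction_formula phi) -> tsat (team_of K) phi.
Proof.
move=> ok [S1 S2]; have [kinds uni once mks init step all] := proj1 (sat_axioms K 0 (0, 0) (0, 0) T) S1.
have [A [AT [cov [A0 /(sat_translate _ ok)]]]] :=
  proj1 (sat_or_flat T (fAnd fA (translate phi)) (flat_neg (flat_atom 0))) S2.
suff -> : team_image A = team_of K by [].
have A0' t : A t -> forall k, t k 0.
  by move=> At; have /= a0 := A0 t At; case: (kinds t (AT t At)) => // /(_ 0).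
apply: team_ext => s; split.
  case=> t [At ->]; have Tt := AT t At.
  (* Each position offers an edge; uniqueness of world atoms makes consecutive choices fit together
     into a path. *)
  have H k : exists e, e \in kR K /\ t k (w_ e.1) /\ t k.+1 (w_ e.2).
    by case: (step t Tt k) => [/(_ (A0' t At k))|[e [eR _ X]]] //; exists e.
  pose f k := proj1_sig (constructive_indefinite_description _ (H k)).
  have Hf k : f k \in kR K /\ t k (w_ (f k).1) /\ t k.+1 (w_ (f k).2).
    by rewrite /f; case: (constructive_indefinite_description _ _).
  have path : kpath K (fun k => (f k).1).
    split=> [|k].
      have [v rv] := root_source; have [f0 [q0 _]] := Hf 0.
      have [/(_ (A0' t At 0))//|qr] := init t Tt.
      exact: (uni t Tt 0 (f 0) (kr K, v) f0 rv q0 qr).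
    have [fk [_ q1]] := Hf k; have [fk1 [q1' _]] := Hf k.+1.
    case e : (f k) fk q1 => [u v] fk q1; have [v' vv'] := edge_source fk.
    by have -> : (f k.+1).1 = v := uni t Tt k.+1 (f k.+1) (v, v') fk1 vv' q1' q1.
  exists (fun k => (f k).1); split=> //.
  by apply: relabel_path => // [k|k]; [apply: uni | case: (Hf k) => _ []].
case=> pi [path ->]; have [p0 pst] := path.
(* The markers compatible with [pi]; added to the path traces [A], they form the subteam that codes
   [pi]. *)
pose S t := T t /\ ~ t 0 0 /\ forall i, t i 1 -> t i (w_ (pi i)).
pose U t := A t \/ S t.
have U_mark k : exists t, U t /\ (~ t k 0 /\ (t k 1 /\ t k (w_ (pi k)))).
  have [t [Tt [t0 [t1 tq]]]] := mks k _ (pst k); exists t; split=> //; right; split=> //.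
  split; first by case: (kinds t Tt) => X; [case: t0 | apply: X].
  (* A marker marked at [k] has no other mark, so it belongs to [S] as soon as it carries [pi k] at
     position [k]. *)
  have past j : t j 1 -> forall d, t (j + d).+1 2.
    move=> tj; elim=> [|d IH]; first by rewrite addn0; case: (once t Tt j) => X _ _; apply: X.
    by rewrite addnS; case: (once t Tt (j + d).+1) => _ X _; apply: X.
  have no j i : j < i -> t j 1 -> t i 1 -> False.
    move=> lt tj ti; have := past j tj (i - j.+1); rewrite (_ : (_ + _).+1 = i); last by lia.
    by move=> t2; case: (once t Tt i) => _ _; apply.
  move=> i ti; case: (ltngtP i k) => [lt|lt|->] //.
    by case: (no _ _ lt ti t1).
  by case: (no _ _ lt t1 ti).
have U_hold k : holds k U (pi k).
  split; first by have [t [Ut [t0 [t1 _]]]] := U_mark k; exists t.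
  move=> t [At|[_ [_ X]]]; first by left; apply: A0'.
  by right; case: (boolP (t k 1)) => [/X|]; [right | left; apply/negP].
(* Without such a [V], the subteam [U] would be exactly what [all] excludes. *)
have [V [VU [covV [[t [Vt t0]] ag]]]] : exists V : team, (forall t, V t -> U t) /\
    (forall t, U t -> ~ V t -> t 0 0) /\ ((exists t, V t /\ t 0 0) /\ agrees K V).
  apply: NNPP => N; apply: all; exists U; split; first by move=> t [/AT|[]].
  split; first by move=> t Tt nU; apply: cov => // At; apply: nU; left.
  split=> //; split; first by rewrite -p0; apply: U_hold.
  by move=> k; exists (pi k, pi k.+1); split; [apply: pst | split; apply: U_hold].
have At : A t by case: (VU t Vt) => // -[_ []].
exists t; split=> //; symmetry; apply: relabel_path => // [k|k].
  exact: (uni t (AT t At)).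
(* The marker [b] for position [k] is in [V], because only path traces were dropped. It forces the
   common world to be [pi k], and the path trace [t] carries that world too. *)
have [e [eR X]] := ag k; have [b [Ub [b0 [b1 bq]]]] := U_mark k.
have Tb : T b by case: Ub => [/AT|[]].
have Vb : V b.
  apply: NNPP => nV; have bb := covV b Ub nV.
  by case: (kinds b Tb) => Y; [apply: b0 | apply: (Y 0)].
have be : e.1 = pi k.
  case: (X b Vb) => [[_ /(_ b1)]|bq'] //.
  exact: (uni b Tb k e _ eR (pst k) bq' bq).
by case: (X t Vt) => [[/(_ (A0' t At k))]|] //; rewrite be.
Qed.

(** * The model formed by all paths and all markers *)

Definition path_trace (pi : nat -> nat) : trace :=
  fun i p => (p == 0) || (p == w_ (pi i)).
(** The world atom is constant along the trace; only the mark at [k] ties it to a position. *)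
Definition marker_trace (k u : nat) : trace :=
  fun i p => [|| (p == 1) && (i == k), (p == 2) && (k < i) | p == w_ u].
Definition model : team := fun t =>
  (exists pi, kpath K pi /\ t = path_trace pi) \/ exists k u, t = marker_trace k u.

Let w_small u p : p < 3 -> (p == w_ u) = false.
Proof. by move=> p3; have := world_atom_gt2 u; case: eqP => // <-; lia. Qed.
Let w_eq u v : (w_ u == w_ v) = (u == v).
Proof. exact: inj_eq world_atom_inj u v. Qed.
Let w_const u p : p < 3 -> (w_ u == p) = false.
Proof. by move=> p3; rewrite eq_sym w_small. Qed.

Lemma path_trace0 pi k : path_trace pi k 0.
Proof. by []. Qed.
Lemma path_traceS pi k p : 0 < p < 3 -> path_trace pi k p = false.
Proof. by case: p => // p; rewrite /path_trace => /andP [_ p3]; rewrite w_small. Qed.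
Lemma path_trace_world pi k u : path_trace pi k (w_ u) = (u == pi k).
Proof. by rewrite /path_trace w_const // w_eq. Qed.
Lemma marker_trace0 j u k : marker_trace j u k 0 = false.
Proof. by rewrite /marker_trace w_small. Qed.
Lemma marker_trace1 j u k : marker_trace j u k 1 = (k == j).
Proof. by rewrite /marker_trace w_small //= orbF. Qed.
Lemma marker_trace2 j u k : marker_trace j u k 2 = (j < k).
Proof. by rewrite /marker_trace w_small //= orbF. Qed.
Lemma marker_trace_world j u k v : marker_trace j u k (w_ v) = (v == u).
Proof. by rewrite /marker_trace (w_const v (isT : 1 < 3)) (w_const v (isT : 2 < 3)) w_eq. Qed.

Lemma model_unique t k u v : model t -> t k (w_ u) -> t k (w_ v) -> u = v.
Proof.
case=> [[pi [_ ->]]|[j [u' ->]]].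
  by rewrite !path_trace_world => /eqP -> /eqP ->.
by rewrite !marker_trace_world => /eqP -> /eqP ->.
Qed.

Lemma model_axioms : axioms K model.
Proof.
split.
- move=> t [[pi [_ ->]]|[j [u ->]]]; first by left=> k; apply: path_trace0.
  by right=> k; rewrite marker_trace0.
- by move=> t mt k e e' _ _; apply: model_unique.
- move=> t [[pi [_ ->]]|[j [u ->]]] k; first by rewrite !path_traceS //; split=> // -[].
  rewrite !marker_trace1 !marker_trace2; split=> [/eqP ->|lt|[/eqP ->]] //; last by rewrite ltnn.
  exact: ltnW.
- move=> k e eR; exists (marker_trace k e.1); split; first by right; exists k, e.1.
  by rewrite marker_trace0 marker_trace1 marker_trace_world !eqxx.
- move=> t [[pi [[p0 _] ->]]|[j [u ->]]]; last by left; rewrite marker_trace0.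
  by right; rewrite path_trace_world p0.
- move=> t [[pi [[_ st] ->]]|[j [u ->]]] k; last by left; rewrite marker_trace0.
  by right; exists (pi k, pi k.+1); split=> //; rewrite !path_trace_world.
move=> [U [UM [cov [[h0 hs] N]]]]; apply: N.
pose f k := proj1_sig (constructive_indefinite_description _ (hs k)).
have Hf k : f k \in kR K /\ holds k U (f k).1 /\ holds k.+1 U (f k).2.
  by rewrite /f; case: (constructive_indefinite_description _ _).
(* A marker of [U] marked at [k] would carry both world atoms, so the chosen edges join up into a
   path. *)
have uni k u v : holds k U u -> holds k U v -> u = v.
  case=> [[t [Ut [t0 t1]]] Hu] [_ Hv]; apply: (@model_unique t k); first exact: UM.
    by case: (Hu t Ut) => // -[].
  by case: (Hv t Ut) => // -[].
have path : kpath K (fun k => (f k).1).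
  split=> [|k]; first by have [_ [h _]] := Hf 0; apply: uni h h0.
  have [fR [_ h]] := Hf k; have [_ [h' _]] := Hf k.+1.
  by rewrite (uni _ _ _ h' h); case: (f k) fR.
set p := path_trace (fun k => (f k).1).
(* What was split off from the model contains no path trace. *)
have Up : U p.
  apply: NNPP => nU; apply: (cov p _ nU); last by [].
  by left; exists (fun k => (f k).1).
(* All markers of [U] are kept, and [p] as the only path trace. *)
exists (fun t => U t /\ (~ t 0 0 \/ t = p)); split; first by move=> t [].
split.
  move=> t Ut nV; apply: contraT => /negP t0; case: nV.
  by split=> //; left.
split; first by exists p; split=> //; split=> //; right.
move=> k; have [fR [[_ h] _]] := Hf k; exists (f k); split=> // t [Ut [t0|->]]; last first.
  by right; rewrite /p path_trace_world.
have tk : ~ t k 0.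
  by case: (UM t Ut) t0 => [[pi [_ ->]] []|[j [u ->]] _]; rewrite ?marker_trace0.
by case: (h t Ut) => [//|[n1|q]]; [left | right].
Qed.

Lemma reduction_complete phi : only_FX phi ->
  tsat (team_of K) phi -> tsat model (reduction_formula phi).
Proof.
move=> ok sat; split; first by apply/sat_axioms; apply: model_axioms.
apply/(sat_or_flat model (fAnd fA (translate phi)) (flat_neg (flat_atom 0))).
exists (fun t => exists pi, kpath K pi /\ t = path_trace pi); split; first by left.
split.
  move=> t [X nX|[j [u ->]] _]; first by case: (nX X).
  by rewrite marker_trace0.
split; first by move=> t [pi [_ ->]]; apply: path_trace0.
apply/(sat_translate _ ok).
rewrite (_ : team_image _ = team_of K) //.
have E pi : kpath K pi -> relabel (path_trace pi) = fun i => label K (pi i).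
  move=> path; apply: relabel_path => // [k e e' _ _|i]; rewrite !path_trace_world //.
  by move=> /eqP -> /eqP ->.
apply: team_ext => s; split.
  by case=> _ [[pi [path ->]] ->]; exists pi; rewrite E.
case=> pi [path ->]; exists (path_trace pi); rewrite E //; split=> //.
by exists pi.
Qed.

Lemma reduction_correct phi : only_FX phi ->
  tsat (team_of K) phi <-> exists T, tsat T (reduction_formula phi).
Proof.
move=> ok; split=> [H|[T]]; last exact: reduction_sound.
by exists model; apply: reduction_complete.
Qed.
End Translation.

(** * Syntax *)

(** Phases of a finite automaton over tokens; a numeral remembers the field it belongs to, which
    determines what may follow it. *)
Inductive numctx := cWidth | cRoot | cFst | cSnd | cItem | cAtom.
Inductive phase := Num of numctx & option bool | Init | InLabel | InFormula | Reject.

Definition numctx_code (c : numctx) : 'I_6 :=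
  match c with
  | cWidth => @Ordinal 6 0 isT | cRoot => @Ordinal 6 1 isT | cFst => @Ordinal 6 2 isT
  | cSnd => @Ordinal 6 3 isT | cItem => @Ordinal 6 4 isT | cAtom => @Ordinal 6 5 isT
  end.
Lemma numctx_codeK : cancel numctx_code
  (fun i : 'I_6 => nth cWidth [:: cWidth; cRoot; cFst; cSnd; cItem; cAtom] i).
Proof. by case. Qed.
HB.instance Definition _ := Finite.copy numctx (can_type numctx_codeK).

Definition phase_code (s : phase) : (numctx * option bool) + bool * bool :=
  match s with
  | Num c b => inl (c, b)
  | Init => inr (false, false) | InLabel => inr (false, true)
  | InFormula => inr (true, false) | Reject => inr (true, true)
  end.
Definition phase_decode (s : (numctx * option bool) + bool * bool) : phase :=
  match s with
  | inl (c, b) => Num c b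
  | inr (b, b') => if b then if b' then Reject else InFormula
                   else if b' then InLabel else Init
  end.
Lemma phase_codeK : cancel phase_code phase_decode.
Proof. by case. Qed.
HB.instance Definition _ := Finite.copy phase (can_type phase_codeK).

(** G, U and R are rejected here. Arities are not examined, which would be beyond a finite
    automaton. *)
Definition formula_step (t : token) : phase :=
  match t with
  | TNeg | TAnd | TOr | TX | TF | TTilde => InFormula
  | TAtom => Num cAtom None
  | _ => Reject
  end.

Definition after_num (c : numctx) (t : token) : phase :=
  match c, t with
  | cWidth, TSep => Num cRoot None
  | (cRoot | cSnd), TEdge => Num cFst None
  | cFst, TSep => Num cSnd None
  | (cRoot | cSnd | cItem), TLab => InLabel
  | (cRoot | cSnd | cItem), TEnd => InFormula
  | cItem, TSep => Num cItem None
  | cAtom, _ => formula_step t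
  | _, _ => Reject
  end.

(* [Num c None] expects a numeral; [Num c (Some b)] is inside it, b telling
   whether further digits are allowed (they are not after a leading 0). *)
Definition phase_step (s : phase) (t : token) : phase :=
  match s with
  | Init => if t is TKrip then Num cWidth None else Reject
  | Num c None =>
      match t with T0 => Num c (Some false) | T1 => Num c (Some true) | _ => Reject end
  | Num c (Some b) =>
      if isbit t then if b then Num c (Some true) else Reject else after_num c t
  | InLabel =>
      match t with
      | TSep => Num cItem None | TLab => InLabel | TEnd => InFormula | _ => Reject
      end
  | InFormula => formula_step t
  | Reject => Reject
  end.

Definition accepting (s : phase) : bool :=
  match s with InFormula | Num cAtom (Some _) => true | _ => false end.

Definition acc (s : phase) (l : seq token) : bool := accepting (foldl phase_step s l).

Lemma acc_cons s c l : acc s (c :: l) = acc (phase_step s c) l.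
Proof. by []. Qed.

Lemma acc_reject l : acc Reject l = false.
Proof. by elim: l. Qed.

Lemma acc_num_nb c b b' l : nbhead l -> acc (Num c (Some b)) l = acc (Num c (Some b')) l.
Proof. by case: l => [_|t l /negbTE nb]; [case: c | rewrite !acc_cons /= nb]. Qed.

Lemma acc_numS c bs l : all isbit bs ->
  acc (Num c (Some true)) (bs ++ l) = acc (Num c (Some true)) l.
Proof. by elim: bs => //= b bs IH /andP [ib /IH]; rewrite acc_cons /= ib. Qed.

Definition canonical (l : seq token) : bool :=
  match l with
  | [:: T0] => true
  | T1 :: l' => all isbit l'
  | _ => false
  end.

Lemma num_of_canonical l : canonical l -> enc_nat (num_of l) = l.
Proof. by case: l => // -[] // [|//] // b l H; apply: num_ofK. Qed.

Lemma enc_nat_canonical u : canonical (enc_nat u).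
Proof.
rewrite /enc_nat; case: (N.of_nat u) => // p.
suff [l [-> al]] : exists l, pos_bits p = T1 :: l /\ all isbit l by [].
elim: p => [p [l [e al]]|p [l [e al]]|]; last by exists [::].
- by exists (l ++ [:: T1]); rewrite /= e all_cat al.
- by exists (l ++ [:: T0]); rewrite /= e all_cat al.
Qed.

Lemma num_of_enc u : num_of (enc_nat u) = u.
Proof. by apply: enc_nat_inj; apply: num_of_canonical; apply: enc_nat_canonical. Qed.

Lemma acc_enc_nat c u l : nbhead l ->
  acc (Num c None) (enc_nat u ++ l) = acc (Num c (Some true)) l.
Proof.
move=> nb; case: (enc_nat u) (enc_nat_canonical u) => // -[] // s.
  by case: s => // _; rewrite acc_cons (acc_num_nb _ _ true).
by move=> /= al; rewrite acc_cons acc_numS.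
Qed.

Lemma bits_split s : exists bs s', [/\ s = bs ++ s', all isbit bs & nbhead s'].
Proof.
elim: s => [|c s [bs [s' [-> al nb]]]]; first by exists [::], [::].
case ic : (isbit c); last by exists [::], (c :: bs ++ s'); rewrite /= ic.
by exists (c :: bs), s'; rewrite /= ic.
Qed.

Lemma acc_num_inv c s : acc (Num c None) s ->
  exists u s', [/\ s = enc_nat u ++ s', nbhead s' & acc (Num c (Some true)) s'].
Proof.
case: s => [|t s]; first by case: c.
rewrite acc_cons; case: t; rewrite ?acc_reject //= => H.
  have nb : nbhead s.
    by case: s H => // t s; rewrite acc_cons /=; case: (isbit t); rewrite ?acc_reject.
  by exists 0, s; split=> //; rewrite -(acc_num_nb _ false).
have [bs [s' [e al nb]]] := bits_split s.
exists (num_of (T1 :: bs)), s'; rewrite num_ofK // e; split=> //.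
by rewrite e acc_numS in H.
Qed.

(** The phase lies inside a label, so [l] is the unread rest of the current one and [ls] are the
    later ones. A numeral is consumed as a block, hence the induction on size. *)
Lemma acc_label_inv s : acc InLabel s -> exists l ls rest,
  s = enc_items l ++ enc_labels ls ++ TEnd :: rest /\ acc InFormula rest.
Proof.
have [n] := ubnP (size s); elim: n s => // n IH [|t s] //= ltn.
rewrite acc_cons; case: t ltn; rewrite ?acc_reject //= => ltn.
- case/acc_num_inv => u [s' [e nb H]].
  have : acc InLabel s'.
    by case: s' nb H {e} => // t s' /negbTE nb; rewrite !acc_cons /= nb; case: t nb.
  case/IH => [|l [ls [rest [e' Hr]]]].
    by move: ltn; rewrite e size_cat; lia.
  by exists (u :: l), ls, rest; rewrite enc_items_cons -e' e.
- case/IH => [|l [ls [rest [e Hr]]]]; first by lia.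
  by exists [::], (l :: ls), rest; rewrite enc_labels_cons -e.
- by move=> H; exists [::], [::], s.
Qed.

Lemma after_num_root c t : c \in [:: cRoot; cSnd] -> after_num c t = after_num cSnd t.
Proof. by case: c; case: t. Qed.

(** The same tokens may follow the root and the target of an edge, so one induction treats both
    phases. *)
Lemma acc_edges_inv c s : c \in [:: cRoot; cSnd] -> nbhead s ->
  acc (Num c (Some true)) s -> exists es ls rest,
  s = enc_edges es ++ enc_labels ls ++ TEnd :: rest /\ acc InFormula rest.
Proof.
have [n] := ubnP (size s); elim: n s c => // n IH [|t s] c ltn cc nb.
  by case: c cc.
rewrite acc_cons /= (negbTE nb).
rewrite after_num_root //; case: t nb ltn; rewrite ?acc_reject //= => _ ltn.
- case/acc_num_inv => u [[|t s1] [e1 nb1]] //.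
  rewrite acc_cons /= (negbTE nb1); case: t e1 nb1; rewrite ?acc_reject //= => e1 _.
  case/acc_num_inv => v [s2 [e2 nb2 H2]].
  case: (IH s2 cSnd _ _ nb2 H2) => // [|es [ls [rest [e H]]]].
    by move: ltn; rewrite e1 e2 !size_cat /= size_cat; lia.
  by exists ((u, v) :: es), ls, rest; rewrite enc_edges_cons -e e1 e2.
- case/acc_label_inv => l [ls [rest [e H]]].
  by exists [::], (l :: ls), rest; rewrite enc_labels_cons -e.
- by move=> H; exists [::], [::], s.
Qed.

Lemma acc_kripke_inv s : acc Init s -> exists K rest,
  s = enc_kripke K ++ rest /\ acc InFormula rest.
Proof.
case: s => // t s; rewrite acc_cons; case: t; rewrite ?acc_reject //=.
case/acc_num_inv => w [[|t s1] [e1 nb1]] //.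
rewrite acc_cons /= (negbTE nb1); case: t e1 nb1; rewrite ?acc_reject //= => e1 _.
case/acc_num_inv => r [s2 [e2 nb2 H2]].
have [es [ls [rest [e H]]]] := acc_edges_inv (isT : cRoot \in [:: cRoot; cSnd]) nb2 H2.
exists (Kripke w es ls r), rest; split; last by [].
change (TKrip :: s = enc_kripke (Kripke w es ls r) ++ rest).
by rewrite enc_kripkeE e1 e2 e /= -!catA /= -!catA.
Qed.

Lemma acc_enc_items l s : nbhead s -> acc InLabel (enc_items l ++ s) = acc InLabel s.
Proof.
move=> nb; elim: l => // u l IH; rewrite enc_items_cons acc_cons /= -IH.
rewrite acc_enc_nat; last exact: nbhead_enc_items.
case: (enc_items l ++ s) (nbhead_enc_items l nb) => // t s' /= /negbTE nt.
by rewrite !acc_cons /= nt; case: t nt.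
Qed.

Lemma acc_enc_labels ls s : acc InLabel (enc_labels ls ++ TEnd :: s) = acc InFormula s.
Proof.
elim: ls => // l ls IH; rewrite enc_labels_cons acc_cons /= acc_enc_items ?IH //.
exact: nbhead_enc_labels.
Qed.

Lemma acc_enc_edges c es s : c \in [:: cRoot; cSnd] ->
  nbhead s -> acc (Num c (Some true)) (enc_edges es ++ s) = acc (Num cSnd (Some true)) s.
Proof.
move=> cc nb; elim: es c cc => [|e es IH] c cc.
  case: s nb => [|t s nb]; first by case: c cc.
  by rewrite /= !acc_cons /= (negbTE nb) after_num_root.
have nb' : nbhead (enc_edges es ++ s) by apply: nbhead_enc_edges.
rewrite enc_edges_cons acc_cons /= (_ : after_num c TEdge = Num cFst None); last by case: c cc.
by rewrite acc_enc_nat // acc_cons /= acc_enc_nat // IH.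
Qed.

Lemma acc_enc_kripke K s : acc Init (enc_kripke K ++ s) = acc InFormula s.
Proof.
rewrite enc_kripkeE /= acc_cons /= -!catA acc_enc_nat //= acc_cons /= -!catA acc_enc_nat; last first.
  by apply: nbhead_enc_edges; apply: nbhead_enc_labels.
rewrite acc_enc_edges //; last exact: nbhead_enc_labels.
rewrite -[RHS](acc_enc_labels (kL K)).
by case: (kL K) => [|l ls] /=; rewrite ?enc_labels_cons.
Qed.

Lemma nbhead_enc_ltl phi s : nbhead (enc_ltl phi ++ s).
Proof. by case: phi. Qed.

Lemma acc_enc_ltl phi s : only_FX phi -> nbhead s ->
  acc InFormula (enc_ltl phi ++ s) = acc InFormula s.
Proof.
elim: phi s => //= [p|a IHa b IHb|a IHa b IHb] s.
- move=> _ nb; rewrite acc_cons /= acc_enc_nat //.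
  by case: s nb => // t s nb; rewrite !acc_cons /= (negbTE nb).
- by case/andP=> oka okb nb; rewrite acc_cons -catA IHa ?IHb // nbhead_enc_ltl.
- by case/andP=> oka okb nb; rewrite acc_cons -catA IHa ?IHb // nbhead_enc_ltl.
Qed.

Definition unop (t : token) : option (ltl -> ltl) :=
  match t with
  | TNeg => Some fNeg | TX => Some fX | TF => Some fF | TTilde => Some fTilde
  | _ => None
  end.
Definition binop (t : token) : option (ltl -> ltl -> ltl) :=
  match t with TAnd => Some fAnd | TOr => Some fOr | _ => None end.

Lemma acc_formula_inv s : acc InFormula s ->
  [\/ s = [::],
      exists t s' , [/\ s = t :: s', (unop t : bool) || binop t & acc InFormula s'] |
      exists p s', [/\ s = TAtom :: enc_nat p ++ s', nbhead s' & acc InFormula s']].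
Proof.
case: s => [|t s]; first by constructor 1.
have [->|ne] := eqVneq t TAtom; last first.
  move=> H; constructor 2; exists t, s; move: H; rewrite acc_cons.
  by case: t ne; rewrite //= acc_reject.
rewrite acc_cons => /acc_num_inv [p [s' [e nb H]]].
constructor 3; exists p, s'; rewrite e; split=> //.
by case: s' nb H {e} => // t' s' nb; rewrite !acc_cons /= (negbTE nb).
Qed.

(** Unique readability of prefix notation; the conditions on [s] and [t] fix the end of a numeral in
    last position. *)
Lemma enc_ltl_prefix a b s t : enc_ltl a ++ s = enc_ltl b ++ t ->
  nbhead s -> nbhead t -> a = b /\ s = t.
Proof.
elim: a b s t => [p|a IH|a IHa c IHc|a IHa c IHc|a IH|a IH|a IH|a IHa c IHc|a IHa c IHc|a IH] b s t.
- case: b => // q [e] ns nt.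
  have e' : enc_nat p = enc_nat q by rewrite -(bits_enc p ns) e bits_enc.
  by split; [rewrite (enc_nat_inj e') | move/eqP: e; rewrite e' eqseq_cat // eqxx => /eqP].
- by case: b => // b [e] ns nt; have [-> ->] := IH _ _ _ e ns nt.
- case: b => //= b d [e] ns nt; rewrite -!catA in e.
  have [-> e2] := IHa _ _ _ e (nbhead_enc_ltl _ _) (nbhead_enc_ltl _ _).
  by have [-> ->] := IHc _ _ _ e2 ns nt.
- case: b => //= b d [e] ns nt; rewrite -!catA in e.
  have [-> e2] := IHa _ _ _ e (nbhead_enc_ltl _ _) (nbhead_enc_ltl _ _).
  by have [-> ->] := IHc _ _ _ e2 ns nt.
- by case: b => // b [e] ns nt; have [-> ->] := IH _ _ _ e ns nt.
- by case: b => // b [e] ns nt; have [-> ->] := IH _ _ _ e ns nt.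
- by case: b => // b [e] ns nt; have [-> ->] := IH _ _ _ e ns nt.
- case: b => //= b d [e] ns nt; rewrite -!catA in e.
  have [-> e2] := IHa _ _ _ e (nbhead_enc_ltl _ _) (nbhead_enc_ltl _ _).
  by have [-> ->] := IHc _ _ _ e2 ns nt.
- case: b => //= b d [e] ns nt; rewrite -!catA in e.
  have [-> e2] := IHa _ _ _ e (nbhead_enc_ltl _ _) (nbhead_enc_ltl _ _).
  by have [-> ->] := IHc _ _ _ e2 ns nt.
- by case: b => // b [e] ns nt; have [-> ->] := IH _ _ _ e ns nt.
Qed.

(** * Translation of the formula token by token *)

Section TokenTranslation.
Variable K : kripke.

(** An atom token looks ahead at its numeral, so the digits themselves can be erased when they are
    reached. *)
Definition trans1 (c : token) (s : seq token) : seq token :=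
  if isbit c then [::]
  else if c == TAtom then enc_ltl (label_formula K (num_of (bits s))) else [:: c].

Fixpoint trans (s : seq token) : seq token :=
  if s is c :: s' then trans1 c s' ++ trans s' else [::].

Lemma trans_bits bs s : all isbit bs -> trans (bs ++ s) = trans s.
Proof. by elim: bs => //= b bs IH /andP [ib /IH ->]; rewrite /trans1 ib. Qed.

Lemma trans_atom p s : nbhead s ->
  trans (TAtom :: enc_nat p ++ s) = enc_ltl (label_formula K p) ++ trans s.
Proof.
by move=> nb; rewrite /= /trans1 /= bits_enc // num_of_enc trans_bits ?enc_nat_isbit.
Qed.

Lemma trans_enc phi s : only_FX phi -> nbhead s ->
  trans (enc_ltl phi ++ s) = enc_ltl (translate K phi) ++ trans s.
Proof.
elim: phi s => // [p|a IH|a IHa b IHb|a IHa b IHb|a IH|a IH|a IH] s.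
- by move=> _ nb; apply: trans_atom.
- by move=> ok nb; rewrite /= IH.
- by case/andP=> oka okb nb; rewrite /= -!catA IHa ?IHb // nbhead_enc_ltl.
- by case/andP=> oka okb nb; rewrite /= -!catA IHa ?IHb // nbhead_enc_ltl.
- by move=> ok nb; rewrite /= IH.
- by move=> ok nb; rewrite /= IH.
- by move=> ok nb; rewrite /= IH.
Qed.

Lemma nbhead_trans s : acc InFormula s -> nbhead (trans s).
Proof.
case/acc_formula_inv => [->|[t [s' [-> H _]]]|[p [s' [-> nb _]]]] //.
  by case: t H.
by rewrite trans_atom // nbhead_enc_ltl.
Qed.

Lemma trans_nil s : acc InFormula s -> trans s = [::] -> s = [::].
Proof.
case/acc_formula_inv => [->|[t [s' [-> H _]]]|[p [s' [-> nb _]]]] //.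
  by case: t H.
by rewrite trans_atom //; case: (label_formula K p).
Qed.

(** Operators are kept and each atom becomes one complete formula, so a parse of the output pulls
    back to a parse of the input. This is what allows the machine to skip parsing. *)
Lemma trans_enc_inv s chi y : acc InFormula s -> nbhead y ->
  trans s = enc_ltl chi ++ y -> exists phi rest,
  [/\ s = enc_ltl phi ++ rest, only_FX phi, chi = translate K phi,
      y = trans rest & acc InFormula rest].
Proof.
have [n] := ubnP (size s); elim: n s chi y => // n IH s chi y ltn.
case/acc_formula_inv => [->|[t [s' [es top Hs']]]|[p [s' [es nb Hs']]]] ny; first by case: chi.
  have un a (op : ltl -> ltl) : (forall a, enc_ltl (op a) = t :: enc_ltl a) ->
      (forall a, only_FX (op a) = only_FX a) ->
      (forall a, translate K (op a) = op (translate K a)) ->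
      trans s' = enc_ltl a ++ y -> exists phi rest,
      [/\ s = enc_ltl phi ++ rest, only_FX phi, op a = translate K phi,
      y = trans rest & acc InFormula rest].
    move=> E F G /IH [||//|phi [rest [e1 ok1 e2 e3 H]]] //.
      by move: ltn; rewrite es /=; lia.
    by exists (op phi), rest; rewrite E F G es e1 e2.
  have bin a b (op : ltl -> ltl -> ltl) :
      (forall a b, enc_ltl (op a b) = t :: enc_ltl a ++ enc_ltl b) ->
      (forall a b, only_FX (op a b) = only_FX a && only_FX b) ->
      (forall a b, translate K (op a b) = op (translate K a) (translate K b)) ->
      trans s' = enc_ltl a ++ enc_ltl b ++ y -> exists phi rest,
      [/\ s = enc_ltl phi ++ rest, only_FX phi, op a b = translate K phi,
      y = trans rest & acc InFormula rest].
    move=> E F G /IH [|||phi [rest [e1 ok1 e2 e3 H]]] //.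
    - by move: ltn; rewrite es /=; lia.
    - exact: nbhead_enc_ltl.
    case: (IH rest b y _ H ny (esym e3)) => [|phi2 [rest2 [e1' ok2 e2' e3' H2]]].
      by move: ltn; rewrite es e1 /= size_cat; lia.
    exists (op phi phi2), rest2; split=> //.
    - by rewrite E es e1 e1' /= -catA.
    - by rewrite F ok1.
    - by rewrite G -e2 -e2'.
  rewrite {1}es; case: t top es un bin => // _ es un bin; case: chi => //= a.
  - by case=> e; apply: (un a fNeg).
  - by move=> b []; rewrite -catA => e; apply: (bin a b fAnd).
  - by move=> b []; rewrite -catA => e; apply: (bin a b fOr).
  - by case=> e; apply: (un a fX).
  - by case=> e; apply: (un a fF).
  - by case=> e; apply: (un a fTilde).
rewrite es trans_atom // => /enc_ltl_prefix [||<- <-] //; first exact: nbhead_trans.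
by exists (fAtom p), s'.
Qed.
End TokenTranslation.

(** * The reduction *)

Definition syntax_check : prog nreg bool :=
  rewind ;; mv MRight ;;
  iterp (fun s : phase =>
    c <~ rd ;;
    if c is Some t then mv MRight ;; ret nreg (inl (phase_step s t))
    else ret nreg (inr (accepting s))) Init.

Definition translate_token (c : token) : prog nreg (option unit) :=
  if isbit c then ret nreg None
  else if c == TAtom then emit_tm tLabel ;; ret nreg None
  else out c ;; ret nreg None.

(** The tokens of [fOr (fNeg fA) (fAnd fA _)] up to the hole. *)
Definition path_guard : seq token :=
  [:: TOr; TNeg; TAtom; T0; TAnd; TAtom; T0].

(** The scan with the idle body serves only to bring [rPhi] to [TEnd]; the formula starts one token
    later. *)
Definition emit_reduction : prog nreg unit :=
  out TAnd ;; emit_tm tAxioms ;; emit path_guard ;;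
  inc rPhi ;; scan rPhi (fun _ => ret nreg (@None unit)) ;; inc rPhi ;;
  scan rPhi translate_token ;; ret nreg tt.

(** A rejected input yields the empty output, which encodes no formula. [wfprog] runs only after the
    syntax check, since its specification presupposes an encoded structure. *)
Definition reduction_prog : prog nreg unit :=
  b <~ (t <~ syntax_check ;; if t then wfprog else ret nreg false) ;;
  if b then emit_reduction else ret nreg tt.

Section Run.
Variable x : seq token.
Notation cexec := (@cexec x _).
Notation exec := (@exec nreg x (size x).+2 _).
Notation hat := (hat x).

Lemma cexec_syntax_check R o : cexec syntax_check R o (acc Init x) R o.
Proof.
have loop_spec s h l : hat h l -> exists h', exec (iterp (fun s : phase =>
    c <~ rd ;;
    if c is Some t then mv MRight ;; ret nreg (inl (phase_step s t))
    else ret nreg (inr (accepting s))) s) (St h R o) (acc s l) (St h' R o).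
  elim: l s h => [|t l IH] s h H.
    exists h; apply: exec_iter_stop; apply: exec_bind; first exact: exec_rd H.
    exact: exec_ret.
  have [h' X] := IH (phase_step s t) h.+1 (hat_next H).
  exists h'; apply: exec_iter_next X; apply: exec_bind; first exact: exec_rd H.
  by apply: exec_bind; [apply: exec_right H | apply: exec_ret].
move=> h; have [h' X] := loop_spec Init 1 x (hat1 x).
exists h'; apply: exec_bind; first exact: exec_rewind.
by apply: exec_bind; [apply: exec_mv0 | exact: X].
Qed.

Lemma cexec_translate K post R pos s : x = enc_kripke K ++ post ->
  clean R -> R rE = 0 -> R rS = 0 -> R rCnt = 0 -> hat pos s -> acc InFormula s ->
  forall o, exists pos', cexec (scan rPhi translate_token) (upd R rPhi pos) o None
    (upd R rPhi pos') (o ++ trans K s).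
Proof.
move=> xE C e0 s0 c0; have [n] := ubnP (size s); elim: n s pos => // n IH s pos ltn H.
have Cp q : clean (upd R rPhi q) by exact: clean_upd.
case/acc_formula_inv => [es|[t [s' [es top Hs']]]|[p [s' [es nb Hs']]]] o; rewrite es in H ltn *.
- exists pos; rewrite cats0.
  by apply: (@scan_end _ _ rPhi _ isT _ _ [::]).
- have [pos' X] := IH s' pos.+1 ltac:(move: ltn => /=; lia) (hat_next H) Hs' (o ++ [:: t]).
  have nt : (isbit t = false) * ((t == TAtom) = false) * (t != TEnd) by case: t {es H X ltn} top.
  exists pos'; rewrite /= /trans1 !nt catA.
  apply: (scan_next (isT : 6 <= rPhi) (R' := upd R rPhi pos) (Cp _) (c := t) (s := s') H); last first.
  + by rewrite upd_twice; exact: X.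
  + by [].
  + rewrite /translate_token !nt; apply: cexec_emits; first exact: emits_out.
    exact: cexec_ret.
  by rewrite nt.
have H' := hat_next H.
have [pos' X] := IH s' (pos.+1 + size (enc_nat p)) ltac:(move: ltn => /=; rewrite size_cat; lia)
  (hat_cat H') Hs' (o ++ enc_ltl (label_formula K p)).
exists pos'; rewrite trans_atom // catA.
apply: (scan_next (isT : 6 <= rPhi) (R' := upd R rPhi pos) (Cp _) (c := TAtom) (s := enc_nat p ++ s') H); last first.
- rewrite upd_twice.
  apply: (scan_skip (isT : 6 <= rPhi) (q := isbit) (s1 := enc_nat p) (s := s')) => //.
  + by move=> c ic; rewrite /translate_token ic; case: c ic.
  + exact: enc_nat_isbit.
  by rewrite upd_twice; exact: X.
- by [].
- apply: cexec_emits; last exact: cexec_ret.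
  apply: (emits_tm (b1 := false) (b2 := false) (b3 := true) xE) => //.
  by move=> _; exists s'.
- by [].
Qed.

Lemma exec_reduction_yes K rest : x = enc_kripke K ++ rest -> acc InFormula rest -> wfb K ->
  exists s', exec reduction_prog (St 0 (fun _ => 0) [::]) tt s' /\
    ou s' = TAnd :: enc_ltl (den K 0 (0, 0) (0, 0) tAxioms) ++ path_guard ++ trans K rest.
Proof.
move=> xE Hr wf; set R : 'I_nreg -> nat := fun _ => 0.
have C : clean R by [].
have Cp q : clean (upd R rPhi q) by exact: clean_upd.
set l := TAnd :: _.
have split_x : x = (TKrip :: enc_nat (kW K) ++ TSep :: enc_nat (kr K) ++ enc_edges (kR K) ++
    enc_labels (kL K)) ++ TEnd :: rest.
  by rewrite xE enc_kripkeE /= -!catA /= -!catA.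
set s1 := (TKrip :: _) in split_x.
have noend : all (fun c => c != TEnd) s1.
  have nb u : all (fun c => c != TEnd) (enc_nat u) by exact: all_bits.
  rewrite /s1 /= !all_cat nb /= !all_cat nb /=; apply/andP; split.
    by rewrite /enc_edges; elim: (kR K) => //= e es IH; rewrite -catA !all_cat IH nb /= nb.
  rewrite /enc_labels; elim: (kL K) => //= a ls IH; rewrite all_cat IH andbT.
  by rewrite /enc_items; elim: a => //= u a IHa; rewrite all_cat IHa nb.
have H1 : hat 1 (s1 ++ TEnd :: rest) by rewrite -split_x; apply: hat1.
have H2 := hat_cat H1.
suff [R' X] : exists R', cexec reduction_prog R [::] tt R' l.
  by have [h Y] := X 0; eexists; split; [exact: Y|].
have [pos' X] := cexec_translate xE C erefl erefl erefl (hat_next H2) Hr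
  ([::] ++ TAnd :: enc_ltl (den K 0 (0, 0) (0, 0) tAxioms) ++ path_guard).
exists (upd R rPhi pos').
apply: cexec_bind.
  apply: cexec_bind; first exact: cexec_syntax_check.
  rewrite xE acc_enc_kripke Hr -xE.
  exact: (cexec_wfprog xE).
rewrite wf; apply: cexec_emits; first exact: emits_out.
apply: cexec_emits.
  exact: (@emits_tm x K rest xE tAxioms false false false R 0 (0, 0) (0, 0)).
apply: cexec_emits; first exact: emits_emit.
apply: cexec_bind; first exact: cexec_inc.
apply: cexec_bind.
  apply: (scan_skip (isT : 6 <= rPhi) (q := fun c => c != TEnd) (s1 := s1) (s := TEnd :: rest)) => //.
  rewrite upd_eq upd_twice.
  by apply: (@scan_end _ _ rPhi _ isT _ _ (TEnd :: rest)) => //; rewrite upd_eq.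
apply: cexec_bind; first by apply: cexec_inc; rewrite upd_eq; case: H2.
rewrite upd_eq upd_twice.
apply: cexec_bind; last exact: cexec_ret.
have -> : l = [::] ++ (TAnd :: enc_ltl (den K 0 (0, 0) (0, 0) tAxioms) ++ path_guard) ++ trans K rest.
  by rewrite /l cat0s cat_cons -catA.
exact: X.
Qed.

Lemma exec_reduction_no :
  (acc Init x -> exists K rest, x = enc_kripke K ++ rest /\ wfb K = false) ->
  exists s', exec reduction_prog (St 0 (fun _ => 0) [::]) tt s' /\ ou s' = [::].
Proof.
move=> H; set R : 'I_nreg -> nat := fun _ => 0.
suff X : cexec reduction_prog R [::] tt R [::].
  by have [h Y] := X 0; eexists; split; [exact: Y|].
apply: (cexec_bind (e := false) (R1 := R) (o1 := [::])); last exact: cexec_ret.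
apply: cexec_bind; first exact: cexec_syntax_check.
case: (acc Init x) H => [[//|K [rest [xE wf]]]|_]; last exact: cexec_ret.
by rewrite -wf; apply: (cexec_wfprog xE).
Qed.
End Run.

Lemma guarded_formula_inv D chi s : nbhead s ->
  TAnd :: enc_ltl D ++ path_guard ++ s = enc_ltl chi ->
  exists2 psi, chi = fAnd D (fOr (fNeg fA) (fAnd fA psi)) & s = enc_ltl psi.
Proof.
have nb phi : nbhead (enc_ltl phi) by rewrite -[enc_ltl _]cats0 nbhead_enc_ltl.
move=> ns; case: chi => // a b [e].
have {e} [<- e] := enc_ltl_prefix e isT (nb b).
case: b e => // b c [e].
have {e} [<- e] := @enc_ltl_prefix (fNeg fA) b (TAnd :: enc_ltl fA ++ s) _ e isT (nb c).
case: c e => // c d [e].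
have {e} [<- ->] := @enc_ltl_prefix fA c s _ e ns (nb d).
by exists d.
Qed.

Lemma reduction_step k x : 2 <= k -> exists y,
  (exists e s', exec x (size x).+2 reduction_prog (St 0 (fun _ => 0) [::]) e s' /\ ou s' = y) /\
  (MC_lang k x <-> SAT_lang k y).
Proof.
move=> k2.
have yes K rest : x = enc_kripke K ++ rest -> acc InFormula rest -> wf_kripke K ->
    exists2 s', exec x (size x).+2 reduction_prog (St 0 (fun _ => 0) [::]) tt s' &
      ou s' = TAnd :: enc_ltl (den K 0 (0, 0) (0, 0) tAxioms) ++ path_guard ++ trans K rest.
  move=> xE Hr /wfbP wf; have [s' [X e]] := exec_reduction_yes xE Hr wf.
  by exists s'.
have accF phi : only_FX phi -> acc InFormula (enc_ltl phi).
  by move=> ok; rewrite -[enc_ltl _]cats0 acc_enc_ltl.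
have transE K phi : only_FX phi -> trans K (enc_ltl phi) = enc_ltl (translate K phi).
  by move=> ok; rewrite -[enc_ltl phi]cats0 trans_enc // cats0.
case: (classic (MC_lang k x)) => [mc|nmc].
  have [K [phi [wf [infx [xE sat]]]]] := mc; have [_ ok] := infx.
  have [s' X e] := yes K _ xE (accF _ ok) wf.
  exists (ou s'); split; first by exists tt, s'.
  split=> // _; exists (reduction_formula K phi); split; first by apply/in_LTL_reduction.
  split; first by rewrite e transE.
  exact/(reduction_correct wf ok).
have no y : ~ SAT_lang k y -> MC_lang k x <-> SAT_lang k y by move=> ns; split.
have nil : ~ SAT_lang k [::] by case=> phi [_ [e _]]; case: phi e.
case: (classic (exists K rest, [/\ x = enc_kripke K ++ rest, acc InFormula rest & wf_kripke K])).
  (* The structure is fine, but the formula part is ill-formed, too deep or false. A satisfiable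
     output formula of the fragment would pull back to a formula witnessing [MC_lang k x]. *)
  case=> K [rest [xE Hr wf]]; have [s' X e] := yes K rest xE Hr wf.
  exists (ou s'); split; first by exists tt, s'.
  apply: no => -[chi [inchi [echi [T satT]]]]; apply: nmc.
  rewrite e in echi; have [psi chiE etr] := guarded_formula_inv (nbhead_trans K Hr) echi.
  have := @trans_enc_inv K rest psi [::] Hr isT; rewrite cats0 => /(_ etr).
  case=> phi [rest' [restE ok psiE e' Hr']].
  have r0 : rest' = [::] by apply: (trans_nil (K := K)).
  rewrite r0 cats0 in restE.
  have chiE' : chi = reduction_formula K phi by rewrite chiE psiE.
  rewrite chiE' in inchi satT.
  exists K, phi; split=> //; split; first by apply/(in_LTL_reduction K k2 ok).
  split; first by rewrite xE restE.
  by apply/(reduction_correct wf ok); exists T.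
move=> nK; have [s' [X e]] : exists s',
    exec x (size x).+2 reduction_prog (St 0 (fun _ => 0) [::]) tt s' /\ ou s' = [::].
  apply: exec_reduction_no => /acc_kripke_inv [K [rest [xE Hr]]].
  exists K, rest; split=> //; apply/negP => /wfbP wf; apply: nK.
  by exists K, rest.
by exists [::]; split; [exists tt, s' | apply: no].
Qed.

Theorem mainTheorem17 (k : nat) (hk : 2 <= k) :
  logspace_reducible (MC_lang k) (SAT_lang k).
Proof.
pose f x := proj1_sig (constructive_indefinite_description _ (reduction_step x hk)).
have Hf x := proj2_sig (constructive_indefinite_description _ (reduction_step x hk)).
exists f; split; last by move=> x; case: (Hf x).
by apply: (@logspace_computable_exec _ _ reduction_prog) => x; case: (Hf x).
Qed.
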